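(* Let $\boldsymbol{H}\colon Y\to\mathbb{C}$ be a bounded $\mu$-measurable function, and let $\boldsymbol{K}\colon Y^2\to\mathbb{C}$ be the kernel of a bi-integral operator $K\in\mathfrak{R}(L^2(Y,\mu))$. For $\lambda\in\mathbb{C}$ and $\psi\in L^2(Y,\mu)$ consider the linear integral equation of the third kind $$\boldsymbol{H}(x)\phi(x)-\lambda\int_{Y}\boldsymbol{K}(x,y)\phi(y)\,d\mu(y)=\psi(x)\quad\text{for $\mu$-almost every } x\in Y, \qquad (A)$$ with unknown $\phi\in L^2(Y,\mu)$. Suppose that the essential range of $\boldsymbol{H}$ contains the point $0$, that is, $$\mu\{y\in Y\colon |\boldsymbol{H}(y)|<\varepsilon\}>0\quad\text{for all }\varepsilon>0.$$ Then equation (A) is equivalent to a first-kind integral equation in $L^2$. Precisely, there exist a unitary operator $U\colon L^2(Y,\mu)\to L^2$, a map $\psi\mapsto w_\psi$ from $L^2(Y,\mu)$ to $L^2$, and functions $\boldsymbol{\varGamma}_0,\boldsymbol{\varGamma}\colon\mathbb{R}^2\to\mathbb{C}$, none of them depending on $\lambda$, such that: (1) $\boldsymbol{\varGamma}_0$ and $\boldsymbol{\varGamma}$ are Hilbert-Schmidt $K^\infty$ kernels of Mercer type, and for every $\lambda\in\mathbb{C}$ the function $\boldsymbol{\varGamma}_0-\lambda\boldsymbol{\varGamma}$ is also a Hilbert-Schmidt $K^\infty$ kernel of Mercer type; (2) for every $\lambda\in\mathbb{C}$ and all $\phi,\psi\in L^2(Y,\mu)$, the function $\phi$ satisfies (A)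 if and only if $f=U\phi$ and $w=w_\psi$ satisfy $$\int_{\mathbb{R}}\left(\boldsymbol{\varGamma}_0(s,t)-\lambda\boldsymbol{\varGamma}(s,t)\right)f(t)\,dt=w(s)\quad\text{for almost every } s\in\mathbb{R}.$$
   Context: $(Y,\mu)$ is a measure space with a positive, $\sigma$-finite, complete, separable and nonatomic measure $\mu$; $L^2(Y,\mu)$ is the complex Hilbert space of (classes of) square-integrable $\mu$-measurable complex functions on $Y$. $L^2$ denotes $L^2(\mathbb{R})$ with Lebesgue measure. $\mathfrak{R}(\mathcal{H})$ is the algebra of bounded linear operators on a Hilbert space $\mathcal{H}$. A unitary operator $U\colon\mathcal{H}\to L^2$ is a surjective linear operator preserving inner products. A linear operator $T\colon L^2(Y,\mu)\to L^2(Y,\mu)$ is integral if there is a $\mu\times\mu$-measurable function (kernel) $\boldsymbol{T}\colon Y^2\to\mathbb{C}$ such that $(Tf)(x)=\int_Y\boldsymbol{T}(x,y)f(y)\,d\mu(y)$ for every $f\in L^2(Y,\mu)$ and $\mu$-almost every $x\in Y$; one says $\boldsymbol{T}$ induces $T$. It is bi-integral if its adjoint $T^*$ is also an integral operator. The same terms are used for $Y=\mathbb{R}$ with Lebesgue measure. For a locally compact space $X$ and a Banach space $B$, $C(X,B)$ is the Banach space (sup norm) of continuous functions $f\colon X\to B$ vanishing at infinity, i.e. for every $\varepsilon>0$ there is a compact set outside which $\|f(x)\|_B<\varepsilon$. A bi-Carleman kernel on $\mathbb{R}^2$ is a kernel $\boldsymbol{T}$ with $\int_{\mathbb{R}}|\boldsymbol{T}(x,y)|^2dy<\infty$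 and $\int_{\mathbb{R}}|\boldsymbol{T}(y,x)|^2dy<\infty$ for almost every $x\in\mathbb{R}$. A Hilbert-Schmidt kernel on $\mathbb{R}^2$ is a kernel $\boldsymbol{\varGamma}$ with $\int_{\mathbb{R}}\int_{\mathbb{R}}|\boldsymbol{\varGamma}(x,y)|^2dy\,dx<\infty$. A $K^\infty$ kernel is a bi-Carleman kernel $\boldsymbol{T}$ on $\mathbb{R}^2$ such that: (i) $\boldsymbol{T}$ and all its partial derivatives of all orders are in $C(\mathbb{R}^2,\mathbb{C})$; (ii) the function $\boldsymbol{t}\colon\mathbb{R}\to L^2$, $\boldsymbol{t}(s)=\overline{\boldsymbol{T}(s,\cdot)}$, and its strong derivatives of all orders are in $C(\mathbb{R},L^2)$; (iii) the function $\boldsymbol{t}'\colon\mathbb{R}\to L^2$, $\boldsymbol{t}'(s)=\boldsymbol{T}(\cdot,s)$ (here the prime is part of the name, not a derivative), and its strong derivatives of all orders are in $C(\mathbb{R},L^2)$. For $T\in\mathfrak{R}(\mathcal{H})$, $\mathcal{M}^{+}(T)$ is the set of all positive operators $P\in\mathfrak{R}(\mathcal{H})$ (that is, $\langle Px,x\rangle\ge 0$ for all $x\in\mathcal{H}$) that can be written as $P=TB$ or as $P=BT$ for some $B\in\mathfrak{R}(\mathcal{H})$. A $K^\infty$ kernel $\boldsymbol{T}$ is of Mercer type if it induces an integral operator $T\in\mathfrak{R}(L^2)$ such that every operator in $\mathcal{M}^{+}(T)$ is also an integral operator induced by a $K^\infty$ kernel. *)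

(* Defs.v *)
From HB Require Import structures.
From mathcomp Require Import all_boot all_order all_algebra.
From mathcomp Require Import complex.
From mathcomp Require Import all_classical all_reals all_analysis.
From mathcomp Require Import measurable_realfun.

Set Implicit Arguments.
Unset Strict Implicit.
Unset Printing Implicit Defensive.

Import Order.TTheory GRing.Theory Num.Theory.
Import numFieldNormedType.Exports.
Import Normc.

Local Open Scope classical_set_scope.
Local Open Scope ring_scope.
Local Open Scope complex_scope.
Local Open Scope quotient_scope.

(* The topology and norm of R[i] are those of the numFieldType R[i]; its norm
   `|z| takes values in R[i], and normc z : R is the same number. *)
HB.instance Definition _ (R : realType) := NormedModule.copy R[i] (R[i])^o.

Section complex_functions.
Context d (T : measurableType d) (R : realType).
Implicit Types (f g : T -> R[i]) (mu : {measure set T -> \bar R}).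

Definition cmeasurable f :=
  measurable_fun setT (fun x => complex.Re (f x)) /\
  measurable_fun setT (fun x => complex.Im (f x)).

Definition cintegrable mu f :=
  mu.-integrable setT (fun x => (complex.Re (f x))%:E) /\
  mu.-integrable setT (fun x => (complex.Im (f x))%:E).

Definition cintegral mu f : R[i] :=
  (\int[mu]_x complex.Re (f x)) +i* (\int[mu]_x complex.Im (f x)).

Definition sqint mu : {pred T -> R[i]} := mem [set f | cmeasurable f /\
  (\int[mu]_x ((normc (f x)) ^+ 2)%:E < +oo)%E].

Definition l2norm mu f : R := Num.sqrt (\int[mu]_x (normc (f x)) ^+ 2).

Lemma cmeasurable_cst (c : R[i]) : cmeasurable (fun=> c).
Proof. by split; exact: measurable_cst. Qed.

Lemma cmeasurableD f g : cmeasurable f -> cmeasurable g ->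
  cmeasurable (fun x => f x + g x).
Proof.
move=> [rf jf] [rg jg]; split.
  by under eq_fun do rewrite raddfD; exact: measurable_funD.
by under eq_fun do rewrite raddfD; exact: measurable_funD.
Qed.

Lemma cmeasurableM f g : cmeasurable f -> cmeasurable g ->
  cmeasurable (fun x => f x * g x).
Proof.
move=> [rf jf] [rg jg]; split.
- rewrite (_ : (fun _ => _) = (fun x => complex.Re (f x) * complex.Re (g x) -
      complex.Im (f x) * complex.Im (g x))); last first.
    by apply/funext => x; case: (f x) => a b; case: (g x).
  by apply: measurable_funB; exact: measurable_funM.
- rewrite (_ : (fun _ => _) = (fun x => complex.Re (f x) * complex.Im (g x) +
      complex.Im (f x) * complex.Re (g x))); last first.
    by apply/funext => x; case: (f x) => a b; case: (g x).
  by apply: measurable_funD; exact: measurable_funM.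
Qed.

Lemma normc_ge0 (z : R[i]) : 0 <= normc z.
Proof. by case: z => a b; exact: sqrtr_ge0. Qed.

Lemma normr_normc (z : R[i]) : `|z| = (normc z)%:C.
Proof. by case: z. Qed.

Lemma normc_sqr (z : R[i]) :
  normc z ^+ 2 = complex.Re z ^+ 2 + complex.Im z ^+ 2.
Proof. by case: z => a b; rewrite sqr_sqrtr// addr_ge0// sqr_ge0. Qed.

Lemma measurable_normc f : cmeasurable f ->
  measurable_fun setT (fun x => normc (f x)).
Proof.
move=> [rf jf].
rewrite (_ : (fun _ => _) = (fun x => (complex.Re (f x) ^+ 2 +
    complex.Im (f x) ^+ 2) `^ 2^-1)); last first.
  apply/funext => x; rewrite -normc_sqr -powR_mulrn ?normc_ge0//.
  by rewrite -powRrM mulfV// powRr1 ?normc_ge0.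
apply: (@measurableT_comp _ _ _ _ _ _ (@powR R ^~ 2^-1)) => //.
by apply: measurable_funD; exact: measurable_funX.
Qed.

Lemma sqintP mu f : reflect (cmeasurable f /\
  (\int[mu]_x ((normc (f x)) ^+ 2)%:E < +oo)%E) (f \in sqint mu).
Proof. by apply: (iffP idP) => [/set_mem|h]//; exact/mem_set. Qed.

Lemma l2norm_ge0 mu f : 0 <= l2norm mu f.
Proof. exact: sqrtr_ge0. Qed.

Local Notation N mu f := ('N[mu]_2%:E [EFin \o (fun x => normc (f x))])%E.

Lemma Lnorm_sqr mu f :
  (N mu f `^ 2 = \int[mu]_x ((normc (f x)) ^+ 2)%:E)%E.
Proof.
rewrite powR_Lnorm//; apply: eq_integral => x _ /=.
by rewrite ger0_norm ?normc_ge0// powR_mulrn ?normc_ge0.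
Qed.

Lemma sqint_Lnorm mu f :
  f \in sqint mu <-> cmeasurable f /\ (N mu f < +oo)%E.
Proof.
split=> [/sqintP[mf]|[mf Nf]].
  rewrite -Lnorm_sqr => Nf; split=> //.
  by apply: (@lty_poweRy _ _ 2).
by apply/sqintP; split => //; rewrite -Lnorm_sqr; exact: poweR_lty.
Qed.

Lemma l2norm_Lnorm mu f : f \in sqint mu -> N mu f = (l2norm mu f)%:E.
Proof.
move=> /[dup] /sqint_Lnorm[_ Nf] /sqintP[_ sf].
have N0 : (0 <= N mu f)%E by exact: Lnorm_ge0.
move: (Lnorm_sqr mu f) Nf N0; case: (N mu f) => [r||]//= E _.
rewrite lee_fin => r0; congr (_%:E).
by rewrite /l2norm /Rintegral -E/= powR_mulrn// sqrtr_sqr ger0_norm.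
Qed.

Lemma le_Lnorm mu (u v : T -> R) :
  measurable_fun setT u -> measurable_fun setT v ->
  (forall x, 0 <= u x) -> (forall x, u x <= v x) ->
  ('N[mu]_2%:E [EFin \o u] <= 'N[mu]_2%:E [EFin \o v])%E.
Proof.
move=> mu' mv u0 uv; rewrite unlock.
have v0 x : 0 <= v x by exact: le_trans (u0 x) (uv x).
have i0 (w : T -> R) : (0 <= \int[mu]_x (`|(EFin \o w) x| `^ 2))%E.
  by apply: integral_ge0 => x _; exact: poweR_ge0.
rewrite gt0_ler_poweR//.
- by rewrite in_itv/= leey i0.
- by rewrite in_itv/= leey i0.
apply: ge0_le_integral => //.
- by move=> x _; exact: poweR_ge0.
- apply/measurable_EFinP.
  apply/(@measurableT_comp _ _ _ _ _ _ (fun x : R => x `^ 2)%R) => //.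
  exact/measurableT_comp.
- apply/measurable_EFinP.
  apply/(@measurableT_comp _ _ _ _ _ _ (fun x : R => x `^ 2)%R) => //.
  exact/measurableT_comp.
- move=> x _; rewrite /= lee_fin !ger0_norm//.
  by rewrite ge0_ler_powR// nnegrE.
Qed.

Lemma Lnorm_triangle mu f g : cmeasurable f -> cmeasurable g ->
  (N mu (fun x => f x + g x)%R <= N mu f + N mu g)%E.
Proof.
move=> mf mg; apply: (@le_trans _ _
    ('N[mu]_2%:E [EFin \o (fun x => normc (f x) + normc (g x))%R])%E).
  apply: le_Lnorm; [| |by move=> x; exact: normc_ge0|].
  - by apply: measurable_normc; exact: cmeasurableD.
  - by apply: measurable_funD; exact: measurable_normc.
  - by move=> x; exact: le_normcD.
apply: minkowski_EFin; [exact: measurable_normc|exact: measurable_normc|].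
by rewrite ler1n.
Qed.

Lemma sqint0 mu : (0 : T -> R[i]) \in sqint mu.
Proof.
apply/sqintP; split; first exact: cmeasurable_cst.
by under eq_integral do rewrite normc0 expr0n/=; rewrite integral0.
Qed.

Lemma sqintD mu f g : f \in sqint mu -> g \in sqint mu -> f + g \in sqint mu.
Proof.
move=> /sqint_Lnorm[mf Nf] /sqint_Lnorm[mg Ng]; apply/sqint_Lnorm; split.
  exact: cmeasurableD.
by apply: (le_lt_trans (Lnorm_triangle mu mf mg)); rewrite lte_add_pinfty.
Qed.

Lemma sqintZ mu (a : R[i]) f : f \in sqint mu -> a *: f \in sqint mu.
Proof.
move=> /sqintP[mf sf]; apply/sqintP; split.
  by apply: (cmeasurableM _ mf); exact: cmeasurable_cst.
rewrite (_ : (\int[mu]_x _ = (normc a ^+ 2)%:E *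
    \int[mu]_x ((normc (f x)) ^+ 2)%:E)%E); last first.
  rewrite -ge0_integralZl//.
  - by apply: eq_integral => x _; rewrite -EFinM -exprMn -normcM.
  - by apply/measurable_EFinP/measurable_funX/measurable_normc.
  - by move=> *; rewrite lee_fin sqr_ge0.
  - by rewrite lee_fin sqr_ge0.
by rewrite lte_mul_pinfty ?lee_fin ?sqr_ge0.
Qed.

Lemma sqint_submod_closed mu : submod_closed (sqint mu).
Proof.
split; first exact: sqint0.
by move=> a f g Hf Hg; apply: sqintD => //; exact: sqintZ.
Qed.

HB.instance Definition _ mu :=
  GRing.isSubmodClosed.Build _ _ (sqint mu) (sqint_submod_closed mu).

Lemma ler_l2normD mu f g : f \in sqint mu -> g \in sqint mu ->
  l2norm mu (f + g) <= l2norm mu f + l2norm mu g.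
Proof.
move=> Hf Hg; rewrite -lee_fin EFinD -!l2norm_Lnorm ?sqintD//.
by apply: Lnorm_triangle; [case/sqintP : Hf|case/sqintP : Hg].
Qed.

Lemma l2normZ mu (a : R[i]) f : f \in sqint mu ->
  l2norm mu (a *: f) = normc a * l2norm mu f.
Proof.
move=> /sqintP[mf sf]; rewrite /l2norm.
rewrite (_ : \int[mu]_x _ = normc a ^+ 2 * \int[mu]_x (normc (f x)) ^+ 2).
  by rewrite sqrtrM ?sqr_ge0// sqrtr_sqr ger0_norm ?normc_ge0.
rewrite -RintegralZl//.
  by apply: eq_Rintegral => x _; rewrite -exprMn -normcM.
apply/integrableP; split.
  by apply/measurable_EFinP/measurable_funX/measurable_normc.
by under eq_integral do rewrite gee0_abs ?lee_fin ?sqr_ge0//.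
Qed.

Lemma ae_eq_l2norm mu f g : {ae mu, forall x, f x = g x} ->
  f \in sqint mu -> g \in sqint mu -> l2norm mu f = l2norm mu g.
Proof.
move=> fg /sqintP[mf _] /sqintP[mg _]; congr Num.sqrt; congr fine.
apply: ae_eq_integral => //.
- by apply/measurable_EFinP/measurable_funX/measurable_normc.
- by apply/measurable_EFinP/measurable_funX/measurable_normc.
- by apply: filterS fg => x -> _.
Qed.

Lemma l2norm_eq0 mu f : f \in sqint mu -> l2norm mu f = 0 ->
  {ae mu, forall x, f x = 0}.
Proof.
move=> Hf nf; have /sqintP[mf _] := Hf.
have := @Lnorm_eq0_eq0 _ _ _ mu (EFin \o (fun x => normc (f x))) 2%:E.
rewrite l2norm_Lnorm// nf => /(_ _ _ erefl) h.
apply: (filterS _ (h _ _)) => [x /(_ I) [/eq0_normc]//||].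
  by apply/measurable_EFinP/measurable_normc.
by rewrite lte_fin.
Qed.

End complex_functions.

Section L2_space.
Context d (T : measurableType d) (R : realType).
Variable mu : {measure set T -> \bar R}.

Record sqfun := SqFun {
  sqfun_fun :> T -> R[i] ;
  sqfunP : sqfun_fun \in sqint mu }.

HB.instance Definition _ := [isSub for sqfun_fun].
HB.instance Definition _ := [Choice of sqfun by <:].
HB.instance Definition _ := [SubChoice_isSubLmodule of sqfun by <:].

Definition nullfun : {pred sqfun} :=
  mem [set f : sqfun | {ae mu, forall x, f x = 0}].

Lemma nullfunP (f : sqfun) :
  reflect {ae mu, forall x, f x = 0} (f \in nullfun).
Proof. by apply: (iffP idP) => [/set_mem|h]//; exact/mem_set. Qed.

Lemma nullfun_zmod_closed : zmod_closed nullfun.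
Proof.
split; first by apply/nullfunP; exact: aeW.
move=> f g /nullfunP f0 /nullfunP g0; apply/nullfunP.
apply: filterS2 f0 g0 => x fx gx.
by rewrite -[LHS]/(f x - g x) fx gx subr0.
Qed.

HB.instance Definition _ :=
  GRing.isZmodClosed.Build _ nullfun nullfun_zmod_closed.

(* L^2(T, mu) : complex square-integrable functions modulo a.e. equality.  An
   element is used as a function through a chosen representative, so only
   statements up to a.e. equality are meaningful about its values. *)
Definition L2 : Type := {ideal_quot nullfun}.
HB.instance Definition _ := GRing.Zmodule.on L2.
HB.instance Definition _ := EqQuotient.on L2.

Definition L2_fun (f : L2) : T -> R[i] := sqfun_fun (repr f).
Coercion L2_fun : L2 >-> Funclass.

Definition toL2 (f : T -> R[i]) (fP : f \in sqint mu) : L2 :=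
  \pi_L2 (SqFun fP).

Lemma L2_sqint (f : L2) : (f : T -> R[i]) \in sqint mu.
Proof. exact: sqfunP. Qed.

Lemma L2_ae_pi (f : sqfun) : {ae mu, forall x, (\pi_L2 f : L2) x = f x}.
Proof.
have : repr (\pi_L2 f) - f \in nullfun by rewrite Quotient.idealrBE reprK.
by move=> /nullfunP; apply: filterS => x /= /eqP; rewrite subr_eq0 => /eqP.
Qed.

Lemma toL2E (f : T -> R[i]) (fP : f \in sqint mu) :
  {ae mu, forall x, toL2 fP x = f x}.
Proof. exact: L2_ae_pi. Qed.

Lemma L2P (f g : L2) : f = g <-> {ae mu, forall x, f x = g x}.
Proof.
split=> [->|fg]; first exact: aeW.
rewrite -[f]reprK -[g]reprK; apply/eqP; rewrite -Quotient.idealrBE.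
apply/nullfunP; apply: filterS fg => x /= fgx.
by apply/eqP; rewrite subr_eq0; exact/eqP.
Qed.

Lemma L2D (f g : L2) : {ae mu, forall x, (f + g : L2) x = f x + g x}.
Proof.
have := L2_ae_pi (repr f + repr g).
rewrite (_ : \pi_L2 _ = f + g)//.
by rewrite -[f in RHS]reprK -[g in RHS]reprK; exact: Quotient.pi_add.
Qed.

Definition L2_scale (a : R[i]) (f : L2) : L2 := \pi_L2 (a *: repr f).

Lemma L2_scaleE (a : R[i]) (f : L2) :
  {ae mu, forall x, L2_scale a f x = a * f x}.
Proof. exact: L2_ae_pi. Qed.

Let scaleA (a b : R[i]) (f : L2) :
  L2_scale a (L2_scale b f) = L2_scale (a * b) f.
Proof.
apply/L2P; have := L2_scaleE a (L2_scale b f).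
have := L2_scaleE b f; have := L2_scaleE (a * b) f.
by apply: filterS3 => x -> E ->; rewrite E mulrA.
Qed.

Let scale1 : left_id 1 L2_scale.
Proof.
by move=> f; apply/L2P; apply: filterS (L2_scaleE 1 f) => x ->; rewrite mul1r.
Qed.

Let scaleDr : right_distributive L2_scale +%R.
Proof.
move=> a f g; apply/L2P.
have E1 := L2_scaleE a (f + g); have E2 := L2D f g.
have E3 := L2D (L2_scale a f) (L2_scale a g).
have E4 := L2_scaleE a f; have E5 := L2_scaleE a g.
near=> x; rewrite (near E1 x)// (near E2 x)// (near E3 x)//.
by rewrite (near E4 x)// (near E5 x)// mulrDr.
Unshelve. all: by end_near. Qed.

Let scaleDl (f : L2) : {morph L2_scale^~ f : a b / a + b}.
Proof.
move=> a b /=; apply/L2P.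
have E1 := L2_scaleE (a + b) f.
have E3 := L2D (L2_scale a f) (L2_scale b f).
have E4 := L2_scaleE a f; have E5 := L2_scaleE b f.
near=> x; rewrite (near E1 x)// (near E3 x)//.
by rewrite (near E4 x)// (near E5 x)// mulrDl.
Unshelve. all: by end_near. Qed.

HB.instance Definition _ :=
  GRing.Zmodule_isLmodule.Build R[i] L2 scaleA scale1 scaleDr scaleDl.

Lemma L2Z (a : R[i]) (f : L2) : {ae mu, forall x, (a *: f : L2) x = a * f x}.
Proof. exact: L2_scaleE. Qed.

Definition L2_norm (f : L2) : R[i] := (l2norm mu f)%:C.

Let ler_normD (f g : L2) : L2_norm (f + g) <= L2_norm f + L2_norm g.
Proof.
rewrite /L2_norm -rmorphD/= lecR (ae_eq_l2norm (L2D f g)) ?L2_sqint//.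
  by apply: ler_l2normD; exact: L2_sqint.
by apply: sqintD; exact: L2_sqint.
Qed.

Let normrZ (a : R[i]) (f : L2) : L2_norm (a *: f) = `|a| * L2_norm f.
Proof.
rewrite /L2_norm (ae_eq_l2norm (L2Z a f)) ?L2_sqint//; last first.
  by apply: sqintZ; exact: L2_sqint.
by rewrite (l2normZ a (L2_sqint f)) normr_normc rmorphM.
Qed.

Let normr0_eq0 (f : L2) : L2_norm f = 0 -> f = 0.
Proof.
move=> /(congr1 (@complex.Re R))/= /(l2norm_eq0 (L2_sqint f)) f0.
apply/L2P; have := L2_ae_pi 0; rewrite piE.
by apply: filterS2 f0 => x -> ->.
Qed.

HB.instance Definition _ :=
  Lmodule_isNormed.Build R[i] L2 ler_normD normrZ normr0_eq0.

Definition inner (f g : L2) : R[i] := cintegral mu (fun x => f x * (g x)^*).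

Lemma inner_norm (f : L2) : inner f f = `|f| ^+ 2.
Proof.
rewrite -[`|f|]/(L2_norm f) /L2_norm -rmorphXn/= sqr_sqrtr; last first.
  by apply: Rintegral_ge0 => x _; exact: sqr_ge0.
rewrite /inner /cintegral; congr (_ +i* _).
  by apply: eq_Rintegral => x _; rewrite normc_sqr; case: (f x) => a b/=;
    rewrite mulrN opprK !expr2.
rewrite -[RHS](Rintegral_set0 mu (fun=> 0)) -[RHS](_ : \int[mu]_x 0 = _).
  by apply: eq_Rintegral => x _; case: (f x) => a b/=; rewrite mulrN mulrC addNr.
by rewrite Rintegral_set0 /Rintegral integral0.
Qed.

End L2_space.

Section operators.
Context (R : realType).

Definition bounded_op (V W : normedModType R[i]) (A : V -> W) :=
  linear A /\ exists M : R, forall v, `|A v| <= M%:C * `|v|.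

Definition unitary d d' (S : measurableType d) (T : measurableType d')
    (mu : {measure set S -> \bar R}) (nu : {measure set T -> \bar R})
    (U : L2 mu -> L2 nu) :=
  [/\ linear U, (forall g, exists f, U f = g) &
      forall f g, inner (U f) (U g) = inner f g].

Context d (Y : measurableType d) (mu : {sigma_finite_measure set Y -> \bar R}).
Implicit Types (K : Y * Y -> R[i]) (A P S : L2 mu -> L2 mu).

(* The library's mu \x mu lives on the product sigma-algebra and is not
   complete; kernels are measurable for its completion. *)
Definition kernel_measurable K := exists2 K' : Y * Y -> R[i],
  cmeasurable K' & {ae (mu \x mu)%E, forall z, K z = K' z}.

Definition induces K A := kernel_measurable K /\
  forall f : L2 mu, {ae mu, forall x,
    cintegrable mu (fun y => K (x, y) * f y) /\
    A f x = cintegral mu (fun y => K (x, y) * f y)}.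

Definition integral_op A := exists K, induces K A.

Definition adjoint_of A S := bounded_op S /\
  forall f g, inner (A f) g = inner f (S g).

Definition bi_integral A := integral_op A /\
  exists2 S, adjoint_of A S & integral_op S.

Definition positive_op P := forall f, 0 <= inner (P f) f.

Definition mercer_set A P := [/\ bounded_op P, positive_op P &
  exists2 B : L2 mu -> L2 mu, bounded_op B & P = A \o B \/ P = B \o A].

End operators.

Arguments induces {R d Y} mu K A.

Section measures.
Context (R : realType) d (Y : measurableType d).
Variable mu : {measure set Y -> \bar R}.

Definition nonatomic := forall A, measurable A -> (0 < mu A)%E ->
  exists B, [/\ measurable B, B `<=` A, (0 < mu B)%E & (mu B < mu A)%E].

(* countable density of the measure algebra, equivalently separability of L2 *)
Definition separable_measure := exists A : nat -> set Y,
  (forall n, measurable (A n)) /\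
  forall B, measurable B -> (mu B < +oo)%E -> forall e : R, 0 < e ->
    exists n, (mu ((B `\` A n) `|` (A n `\` B)) < e%:E)%E.

End measures.

Section smoothness.
Context (R : realType).

Definition C0 (X : topologicalType) (B : normedModType R[i]) (f : X -> B) :=
  continuous f /\
  forall e : R, 0 < e ->
    exists2 Q : set X, compact Q & forall x, ~ Q x -> `|f x| < e%:C.

Definition is_sderive (B : normedModType R[i]) (f g : R -> B) :=
  forall s : R, (h^-1)%:C *: (f (s + h) - f s) @[h --> 0^'] --> g s.

Definition C0_smooth (B : normedModType R[i]) (f : R -> B) :=
  exists D : nat -> R -> B,
    [/\ D 0%N = f, forall n, is_sderive (D n) (D n.+1) & forall n, C0 (D n)].

(* D w is the iterated partial derivative along the word w, whose head is the
   outermost derivation: false for the first variable, true for the second. *)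
Definition C0_smooth2 (f : R * R -> R[i]) :=
  exists D : seq bool -> R * R -> R[i],
    [/\ D [::] = f,
        forall w y, is_sderive (fun x => D w (x, y))
                               (fun x => D (false :: w) (x, y)),
        forall w x, is_sderive (fun y => D w (x, y))
                               (fun y => D (true :: w) (x, y)) &
        forall w, C0 (D w)].

End smoothness.

Section kernels_on_the_line.
Context (R : realType).
Implicit Types G : R * R -> R[i].

(* Lebesgue measure on the Borel sets: every class of Lebesgue-measurable
   functions has a Borel representative, so L2 leb is the usual L^2(R). *)
Local Notation leb := (@lebesgue_measure R).

Definition bi_carleman G := kernel_measurable leb G /\
  {ae leb, forall x : R, (\int[leb]_y ((normc (G (x, y))) ^+ 2)%:E < +oo)%E /\
                         (\int[leb]_y ((normc (G (y, x))) ^+ 2)%:E < +oo)%E}.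

Definition hilbert_schmidt G := kernel_measurable leb G /\
  (\int[leb]_x \int[leb]_y ((normc (G (x, y))) ^+ 2)%:E < +oo)%E.

Definition Kinfty G :=
  [/\ bi_carleman G,
      C0_smooth2 G,
      exists2 t : R -> L2 leb,
        forall s, {ae leb, forall y, t s y = (G (s, y))^*} & C0_smooth t &
      exists2 t' : R -> L2 leb,
        forall s, {ae leb, forall x, t' s x = G (x, s)} & C0_smooth t'].

Definition mercer_type G := Kinfty G /\
  exists A : L2 leb -> L2 leb, [/\ bounded_op A, induces leb G A &
    forall P, mercer_set A P -> exists2 Q, Kinfty Q & induces leb Q P].

End kernels_on_the_line.

(* Main.v *)
Require Import Defs.
From HB Require Import structures.
From mathcomp Require Import all_boot all_order all_algebra.
From mathcomp Require Import complex.
From mathcomp Require Import all_classical all_reals all_analysis.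
From mathcomp Require Import measurable_realfun.
From mathcomp Require Import ring lra.

(** The equation (A) reads [(H - lam K) phi = psi] in [L2 mu]. Composing on the left
    with an injective bounded operator [S] does not change its solutions, so it is
    enough to choose [S] and a unitary [U] such that [S H] and [S K] become, on the
    line, operators with smooth kernels of Mercer type.

    Fix an orthonormal basis [u n] of [L2] of the line consisting of smooth functions
    all of whose derivatives vanish at infinity ([smooth_basis]), and numbers [rho n]
    that decrease so fast that [\sum_n rho n u_n^(i)] converges absolutely for every
    order [i] ([weights]). Call an operator [A] decaying if [|A u_n|] and [|A^* u_n|]
    are at most [C (rho n)^2]. Three facts make this the right notion.

    - Decaying operators form a vector space, so [S H - lam S K] is handled together
      with [S H] and [S K].

    - The matrix of a decaying operator satisfies [|a_nm| <= C rho_n rho_m], and under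
      this bound the double series [\sum_nm a_nm u_n(s) conj(u_m(t))] and all its formal
      derivatives converge absolutely. It defines a Hilbert-Schmidt kernel with all the
      required smoothness that induces the operator ([kernel_of_Kinfty]). The notion
      of smoothness used on the way, [chain], is a system of norm inequalities and is
      therefore stable under absolutely convergent series ([chain_series]).

    - If [P >= 0] is of the form [A S'] or [S' A] with [A] decaying, then
      [<P u_n, u_n> <= C (rho n)^2], and by Cauchy-Schwarz for the form of [P],
      [|<P u_m, u_n>| <= C rho_n rho_m]. So every operator in the Mercer set of [A] has
      a kernel of the same kind ([decaying_mercer_type]).

    It remains to find [S] and [U]. Let [f m] be a total sequence of [L2 mu], and
    orthogonalize the sequence [f 0, H^* f 0, K^* f 0, f 1, H^* f 1, ...] to a basis
    [e n] ([adapted_basis]). Then [e n] is orthogonal to [f m], [H^* f m] and [K^* f m]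
    as soon as [3 m + 2 < n]. With [U e_n = u_n] and
    [S g = \sum_m s_m <g, f m> U (f m)], the vector [S H e_n] involves only the weights
    [s_m] with [3 m + 2 >= n], and so do [<S g, u_n>] and [S K e_n]; positive weights
    [s_m] that are small compared with [rho (3 m + 2)^2] make everything decay, and [S]
    is injective because [<S g, U g> = \sum_m s_m |<g, f m>|^2]. *)

Set Implicit Arguments.
Unset Strict Implicit.
Unset Printing Implicit Defensive.

Import Order.TTheory GRing.Theory Num.Theory.
Import numFieldNormedType.Exports.
Import Normc.

Local Open Scope classical_set_scope.
Local Open Scope ring_scope.
Local Open Scope complex_scope.

(* Inside ring expressions the postfix star is [Num.conj], elsewhere [conjc]; a
   prefix notation fixes the former. *)
Local Notation cj z := (Num.conj z).

(** * Real-valued norms and limits *)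

Section real_norm.
Context {R : realType}.
Implicit Types E : normedModType R[i].

(** Norms of these normed modules are complex numbers; [nrm] is the same
    number as a real, on which estimates are made. *)
Definition nrm {E} (v : E) : R := complex.Re `|v|.

Lemma nrmE {E} (v : E) : `|v| = (nrm v)%:C.
Proof.
rewrite /nrm; have := normr_ge0 v; case: (`|v|) => a b.
by rewrite lecE/= => /andP[/eqP -> _].
Qed.

Lemma nrm_ge0 {E} (v : E) : 0 <= nrm v.
Proof. by have := normr_ge0 v; rewrite nrmE lecE/= => /andP[]. Qed.

Lemma nrm0 {E} : nrm (0 : E) = 0.
Proof. by rewrite /nrm normr0. Qed.

Lemma nrm_eq0 {E} (v : E) : nrm v = 0 -> v = 0.
Proof. by move=> v0; apply: normr0_eq0; rewrite nrmE v0. Qed.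

Lemma nrmN {E} (v : E) : nrm (- v) = nrm v.
Proof. by rewrite /nrm normrN. Qed.

Lemma nrmB {E} (v w : E) : nrm (v - w) = nrm (w - v).
Proof. by rewrite -nrmN opprB. Qed.

Lemma nrmD {E} (v w : E) : nrm (v + w) <= nrm v + nrm w.
Proof.
by have := ler_normD v w; rewrite !nrmE -rmorphD/= lecR.
Qed.

Lemma nrmZ {E} (a : R[i]) (v : E) : nrm (a *: v) = normc a * nrm v.
Proof. by rewrite /nrm normrZ normr_normc nrmE -rmorphM. Qed.

Lemma nrm_sum {E} (I : Type) (r : seq I) (P : pred I) (v : I -> E) :
  nrm (\sum_(i <- r | P i) v i) <= \sum_(i <- r | P i) nrm (v i).
Proof.
elim/big_ind2 : _ => [|x y x' y' xy xy'|//]; first by rewrite nrm0.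
by rewrite (le_trans (nrmD _ _))// lerD.
Qed.

Lemma nrmC (z : R[i]) : nrm z = normc z.
Proof. by rewrite /nrm normr_normc. Qed.

Lemma cvg_nrmP {E} T (F : set_system T) {FF : Filter F} (f : T -> E) (l : E) :
  f @ F --> l <->
  forall e : R, 0 < e -> \forall x \near F, nrm (l - f x) < e.
Proof.
split=> [/cvgrPdist_lt h e e0|h].
  have := h e%:C; rewrite ltcR => /(_ e0); apply: filterS => x.
  by rewrite nrmE ltcR.
apply/cvgrPdist_lt => -[e e'] /=; rewrite ltcE/= => /andP[/eqP e'0 e0].
by have := h _ e0; apply: filterS => x; rewrite nrmE ltcE/= e'0 eqxx.
Qed.

Lemma cvgn_nrmP {E} (x_ : nat -> E) (l : E) :
  x_ @ \oo --> l <->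
  forall e : R, 0 < e -> exists N, forall n, (N <= n)%N -> nrm (l - x_ n) < e.
Proof.
rewrite cvg_nrmP; split=> h e e0; have := h e e0.
  by move=> [N _ hN]; exists N => n Nn; exact: hN.
by move=> [N hN]; exists N.
Qed.

Lemma le_nrm_lim {E} (x_ : nat -> E) (l : E) (b : R) :
  x_ @ \oo --> l -> (forall n, nrm (x_ n) <= b) -> nrm l <= b.
Proof.
move=> /cvgn_nrmP xl xb; apply/ler_addgt0Pr => e e0.
have [N /(_ N (leqnn N)) hN] := xl _ e0.
rewrite -(subrK (x_ N) l) (le_trans (nrmD _ _))// addrC lerD//.
exact: ltW.
Qed.

Lemma cvgn_nrm_squeeze {E} (x_ : nat -> E) (l : E) (b : nat -> R) :
  (forall n, nrm (l - x_ n) <= b n) -> b @ \oo --> (0 : R) -> x_ @ \oo --> l.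
Proof.
move=> xb /cvgrPdist_lt b0; apply/cvg_nrmP => e e0.
have := b0 _ e0; apply: filterS => n; rewrite sub0r normrN.
by move=> /(le_lt_trans (ler_norm _)) /(le_lt_trans (xb n)).
Qed.

Lemma ler_Re_normc (w : R[i]) : `|complex.Re w| <= normc w.
Proof.
by case: w => a b /=; rewrite -sqrtr_sqr ler_wsqrtr// lerDl sqr_ge0.
Qed.

Lemma ler_Im_normc (w : R[i]) : `|complex.Im w| <= normc w.
Proof.
by case: w => a b /=; rewrite -sqrtr_sqr ler_wsqrtr// lerDr sqr_ge0.
Qed.

Lemma cvgn_ReIm (z_ : nat -> R[i]) (z : R[i]) :
  z_ @ \oo --> z <->
  (fun n => complex.Re (z_ n)) @ \oo --> complex.Re z /\
  (fun n => complex.Im (z_ n)) @ \oo --> complex.Im z.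
Proof.
split=> [/cvg_nrmP h|[/cvgrPdist_lt hR /cvgrPdist_lt hI]].
  by split; apply/cvgrPdist_lt => e e0; have := h e e0; apply: filterS => n;
    rewrite nrmC -raddfB; apply: le_lt_trans;
    first [exact: ler_Re_normc | exact: ler_Im_normc].
apply/cvg_nrmP => e e0.
have e20 : 0 < e / 2 by rewrite divr_gt0.
apply: filterS2 (hR _ e20) (hI _ e20) => n; rewrite -!raddfB nrmC.
move: (z - z_ n) => w hR' hI'; rewrite [w]complexE.
rewrite (le_lt_trans (le_normcD _ _))// normcM.
have -> : normc 'i = 1 :> R by rewrite /= expr0n/= add0r expr1n sqrtr1.
have nC (c : R) : normc c%:C = `|c| by rewrite /= expr0n addr0 sqrtr_sqr.
by rewrite mul1r !nC (splitr e) ltrD.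
Qed.

End real_norm.

(** * Series and linear maps in normed modules *)

Section series.
Context {R : realType}.

(** Convergence of a series of nonnegative terms, said without a limit, so
    that the bound can be carried along. *)
Definition summable_by (b : nat -> R) (K : R) :=
  forall N, \sum_(n < N) b n <= K.

Definition psum (E : normedModType R[i]) (v : nat -> E) (N : nat) : E :=
  \sum_(n < N) v n.

(** Completeness in the only form that sums of function series need; scalars
    and [L2] share it, so that one lemma serves both. *)
Definition abs_complete (E : normedModType R[i]) :=
  forall v : nat -> E, (exists K, summable_by (fun n => nrm (v n)) K) ->
  exists x : E, psum v @ \oo --> x.

Lemma summable_tail (b : nat -> R) K : (forall n, 0 <= b n) -> summable_by b K ->
  exists2 t : nat -> R, t @ \oo --> (0 : R) &
    forall M N, (M <= N)%N -> \sum_(M <= n < N) b n <= t M.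
Proof.
move=> b0 bK.
pose S N := \sum_(n < N) b n.
have Sinc : nondecreasing_seq S.
  apply/nondecreasing_seqP => n; rewrite /S big_ord_recr/= lerDl//.
have Scvg : cvgn S.
  apply: nondecreasing_is_cvgn => //; exists K => _ [n _ <-]; exact: bK.
exists (fun M => limn S - S M).
  rewrite -[X in _ --> X](subrr (limn S)); apply: cvgB => //.
  exact: cvg_cst.
move=> M N MN; rewrite lerBrDr.
have <- : S N = \sum_(M <= n < N) b n + S M.
  rewrite /S -(big_mkord xpredT b) -(big_mkord xpredT b) addrC.
  by rewrite -big_cat_nat//=.
exact: nondecreasing_cvgn_le.
Qed.

Lemma abs_complete_C : abs_complete R[i].
Proof.
move=> z [K zK].
have rcvg (f : nat -> R) : (forall n, `|f n| <= nrm (z n)) ->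
    exists l : R, (fun N => \sum_(n < N) f n) @ \oo --> l.
  move=> fz; exists (limn (fun N => \sum_(n < N) f n)).
  have : cvgn [normed series f].
    apply: nondecreasing_is_cvgn.
      by apply: nondecreasing_series => n _ _; exact: normr_ge0.
    exists K => _ [n _ <-] /=; rewrite /series/= big_mkord.
    by apply: le_trans (zK n); exact: ler_sum.
  move=> /normed_cvg; rewrite (_ : series f = (fun N => \sum_(n < N) f n))//.
  by apply/funext => N; rewrite /series/= big_mkord.
have [|a ha] := rcvg (fun n => complex.Re (z n)).
  by move=> n; rewrite nrmC; exact: ler_Re_normc.
have [|b hb] := rcvg (fun n => complex.Im (z n)).
  by move=> n; rewrite nrmC; exact: ler_Im_normc.
exists (a +i* b); apply/cvgn_ReIm; split => /=.
  by under eq_fun do rewrite /psum raddf_sum.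
by under eq_fun do rewrite /psum raddf_sum.
Qed.

Lemma psumD (E : normedModType R[i]) (v w : nat -> E) (x y : E) :
  psum v @ \oo --> x -> psum w @ \oo --> y ->
  psum (fun n => v n + w n) @ \oo --> x + y.
Proof.
move=> hx hy; rewrite (_ : psum _ = psum v \+ psum w); first exact: cvgD.
by apply/funext => N; rewrite /psum big_split.
Qed.

Lemma psumZ (E : normedModType R[i]) (a : R[i]) (v : nat -> E) (x : E) :
  psum v @ \oo --> x -> psum (fun n => a *: v n) @ \oo --> a *: x.
Proof.
move=> hx; rewrite (_ : psum _ = (fun N => a *: psum v N)); first exact: cvgZl_tmp.
by apply/funext => N; rewrite /psum scaler_sumr.
Qed.

Lemma nrm_cvg_unique (E : normedModType R[i]) (x_ : nat -> E) (x y : E) :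
  x_ @ \oo --> x -> x_ @ \oo --> y -> x = y.
Proof. by move=> hx hy; apply: (cvg_unique _ hx hy). Qed.

Lemma lin_additive (E F : normedModType R[i]) (A : E -> F) : linear A ->
  [/\ A 0 = 0, forall v w, A (v + w) = A v + A w,
      forall v w, A (v - w) = A v - A w, forall a v, A (a *: v) = a *: A v &
      forall n (v : 'I_n -> E), A (\sum_i v i) = \sum_i A (v i)].
Proof.
move=> Al.
have A0 : A 0 = 0.
  by have := Al (-1) 0 0; rewrite scaler0 addr0 scaleN1r addNr.
have AD v w : A (v + w) = A v + A w by have := Al 1 v w; rewrite !scale1r.
have AZ a v : A (a *: v) = a *: A v by have := Al a v 0; rewrite A0 !addr0.
split=> // [v w|n v]; first by rewrite AD -(scaleN1r w) AZ scaleN1r.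
by elim/big_ind2 : _ => // _ u _ w <- <-.
Qed.

Lemma bounded_nrm (E F : normedModType R[i]) (A : E -> F) : bounded_op A ->
  exists2 M : R, 0 <= M & forall v, nrm (A v) <= M * nrm v.
Proof.
move=> [_ [M hM]]; exists `|M| => // v.
have := hM v; rewrite !nrmE -rmorphM/= lecR => /le_trans; apply.
by rewrite ler_wpM2r ?nrm_ge0// ler_norm.
Qed.

Lemma psum_bounded (E F : normedModType R[i]) (A : E -> F) (v : nat -> E) (x : E) :
  bounded_op A -> psum v @ \oo --> x -> psum (fun n => A (v n)) @ \oo --> A x.
Proof.
move=> Ab /cvgn_nrmP vx; have [M M0 hM] := bounded_nrm Ab.
have M1 : 0 < 1 + M by rewrite ltr_pwDl.
apply/cvgn_nrmP => e e0.
have [N hN] := vx (e / (1 + M)) (divr_gt0 e0 M1).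
exists N => n Nn; have [_ _ AB _ AS] := lin_additive Ab.1.
rewrite {1}/psum -AS -AB (le_lt_trans (hM _))//.
have := hN n Nn; rewrite ltr_pdivlMr// => /(le_lt_trans _); apply.
by rewrite mulrC ler_wpM2l ?nrm_ge0// lerDr.
Qed.

End series.

(** * Integrals of complex functions *)

Section complex_integral.
Context d (T : measurableType d) (R : realType).
Variable mu : {measure set T -> \bar R}.
Implicit Types f g : T -> R[i].

Lemma cmeasurable_conj f : cmeasurable f -> cmeasurable (fun x => cj (f x)).
Proof.
move=> [rf jf]; split.
  rewrite (_ : (fun _ => _) = (fun x => complex.Re (f x)))//.
  by apply/funext => x/=; case: (f x).
rewrite (_ : (fun _ => _) = (fun x => - complex.Im (f x))).
  exact: measurable_funN.
by apply/funext => x/=; case: (f x).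
Qed.

Lemma normc_conj (z : R[i]) : normc (cj z) = normc z.
Proof. by case: z => a b /=; rewrite sqrrN. Qed.

Lemma cintegrable_dom f (h : T -> R) : cmeasurable f ->
  mu.-integrable setT (EFin \o h) -> (forall x, normc (f x) <= h x) ->
  cintegrable mu f.
Proof.
move=> [rf jf] ih fh; split; apply: (le_integrable measurableT _ _ ih).
- exact/measurable_EFinP.
- move=> x _ /=; rewrite lee_fin (le_trans (ler_Re_normc _))//.
  by rewrite (le_trans (fh x))// ler_norm.
- exact/measurable_EFinP.
- move=> x _ /=; rewrite lee_fin (le_trans (ler_Im_normc _))//.
  by rewrite (le_trans (fh x))// ler_norm.
Qed.

Lemma sqint_cmeasurable f : f \in sqint mu -> cmeasurable f.
Proof. by case/sqintP. Qed.

Lemma integrable_normc2 f : f \in sqint mu ->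
  mu.-integrable setT (fun x => ((normc (f x)) ^+ 2)%:E).
Proof.
move=> /sqintP[mf sf]; apply/integrableP; split.
  by apply/measurable_EFinP/measurable_funX/measurable_normc.
by under eq_integral do rewrite gee0_abs ?lee_fin ?sqr_ge0//.
Qed.

(** [|f g| <= |f|^2 + |g|^2]. *)
Lemma cintegrableM f g : f \in sqint mu -> g \in sqint mu ->
  cintegrable mu (fun x => f x * g x).
Proof.
move=> sf sg.
apply: (@cintegrable_dom _ (fun x => normc (f x) ^+ 2 + normc (g x) ^+ 2)).
- by apply: cmeasurableM; exact: sqint_cmeasurable.
- rewrite (_ : _ \o _ =
      (fun x => (normc (f x) ^+ 2)%:E + (normc (g x) ^+ 2)%:E)%E)//.
  by apply: integrableD => //; exact: integrable_normc2.
- move=> x; rewrite normcM.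
  have := normc_ge0 (f x); have := normc_ge0 (g x).
  move: (normc (f x)) (normc (g x)) => a b; nra.
Qed.

Lemma sqint_conj f : f \in sqint mu -> (fun x => cj (f x)) \in sqint mu.
Proof.
move=> /sqintP[mf sf]; apply/sqintP; split; first exact: cmeasurable_conj.
by under eq_integral do rewrite normc_conj.
Qed.

Lemma cintegralD f g : cintegrable mu f -> cintegrable mu g ->
  cintegral mu (fun x => f x + g x) = cintegral mu f + cintegral mu g.
Proof.
move=> [rf jf] [rg jg]; rewrite /cintegral.
have D (u v : T -> R) : mu.-integrable setT (EFin \o u) ->
    mu.-integrable setT (EFin \o v) ->
    \int[mu]_x (u x + v x) = \int[mu]_x u x + \int[mu]_x v x.
  by move=> iu iv; rewrite RintegralD.
rewrite [RHS](_ : _ = (\int[mu]_x complex.Re (f x) + \int[mu]_x complex.Re (g x))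
  +i* (\int[mu]_x complex.Im (f x) + \int[mu]_x complex.Im (g x)))//.
by rewrite -!D//; congr (_ +i* _); apply: eq_Rintegral => x _; rewrite raddfD.
Qed.

Lemma cintegralZ (a : R[i]) f : cintegrable mu f ->
  cintegral mu (fun x => a * f x) = a * cintegral mu f.
Proof.
case: a => a b [rf jf]; rewrite /cintegral/=.
have iZ (c : R) (u : T -> R) : mu.-integrable setT (EFin \o u) ->
    mu.-integrable setT (EFin \o (fun x => c * u x)).
  move=> iu; rewrite (_ : _ \o _ = (fun x => c%:E * (u x)%:E)%E)//.
  exact: integrableZl.
rewrite [RHS](_ : _ =
  (a * \int[mu]_x complex.Re (f x) - b * \int[mu]_x complex.Im (f x)) +i*
  (a * \int[mu]_x complex.Im (f x) + b * \int[mu]_x complex.Re (f x)))//.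
rewrite -!RintegralZl// -RintegralB//; [|exact: iZ|exact: iZ].
rewrite -RintegralD//; [|exact: iZ|exact: iZ].
by congr (_ +i* _); apply: eq_Rintegral => x _; case: (f x).
Qed.

Lemma cintegral_conj f : cintegrable mu f ->
  cintegral mu (fun x => cj (f x)) = cj (cintegral mu f).
Proof.
move=> [_ jf]; rewrite /cintegral /=; congr (_ +i* _).
  by apply: eq_Rintegral => x _; case: (f x).
rewrite -mulN1r -RintegralZl//.
by apply: eq_Rintegral => x _; case: (f x) => u v; rewrite mulN1r.
Qed.

Lemma eq_ae_cintegral f g : cmeasurable f -> cmeasurable g ->
  {ae mu, forall x, f x = g x} -> cintegral mu f = cintegral mu g.
Proof.
move=> [rf jf] [rg jg] fg; rewrite /cintegral.
by congr (_ +i* _); congr fine; apply: ae_eq_integral => //;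
  try (by apply/measurable_EFinP); apply: filterS fg => x -> _.
Qed.

End complex_integral.

(** * The inner product of L2 *)

Section inner_product.
Context d (T : measurableType d) (R : realType).
Variable mu : {measure set T -> \bar R}.
Implicit Types f g h : L2 mu.

Lemma L2_cmeasurable f : cmeasurable f.
Proof. exact: sqint_cmeasurable (L2_sqint f). Qed.

Lemma nrm_l2norm f : nrm f = l2norm mu f.
Proof. by []. Qed.

Lemma cintegrable_inner f g : cintegrable mu (fun x => f x * cj (g x)).
Proof.
exact: (cintegrableM (L2_sqint f) (sqint_conj (L2_sqint g))).
Qed.

Lemma cmeasurable_inner f g : cmeasurable (fun x => f x * cj (g x)).
Proof.
by apply: cmeasurableM; [|apply: cmeasurable_conj]; exact: L2_cmeasurable.
Qed.

Lemma innerDl f g h : inner (f + g) h = inner f h + inner g h.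
Proof.
rewrite -cintegralD; [|exact: cintegrable_inner..].
apply: eq_ae_cintegral; first exact: cmeasurable_inner.
  by apply: cmeasurableD; exact: cmeasurable_inner.
by apply: filterS (L2D f g) => x ->; rewrite mulrDl.
Qed.

Lemma innerZl (a : R[i]) f g : inner (a *: f) g = a * inner f g.
Proof.
rewrite -cintegralZ; last exact: cintegrable_inner.
apply: eq_ae_cintegral; first exact: cmeasurable_inner.
  apply: cmeasurableM; [exact: cmeasurable_cst|exact: cmeasurable_inner].
by apply: filterS (L2Z a f) => x ->; rewrite mulrA.
Qed.

Lemma realC_morph :
  [/\ forall a b : R, (a + b)%:C = a%:C + b%:C,
      forall a b : R, (a - b)%:C = a%:C - b%:C,
      forall a b : R, (a * b)%:C = a%:C * b%:C &
      forall (a : R) n, (a ^+ n)%:C = a%:C ^+ n].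
Proof.
split=> *; [exact: (rmorphD (real_complex R))|exact: (rmorphB (real_complex R))|
  exact: (rmorphM (real_complex R))|exact: (rmorphXn (real_complex R))].
Qed.

Lemma cj_real (a : R) : cj a%:C = a%:C.
Proof. exact: conjc_real. Qed.

Lemma conjc_conj (z w : R[i]) : cj (z * cj w) = w * cj z.
Proof.
by apply/eqP; case: z => a b; case: w => a' b'; rewrite eq_complex/=;
  apply/andP; split; apply/eqP; ring.
Qed.

Lemma inner_conj f g : cj (inner f g) = inner g f.
Proof.
rewrite /inner -cintegral_conj; last exact: cintegrable_inner.
by congr cintegral; apply/funext => x; rewrite conjc_conj.
Qed.

Lemma innerDr f g h : inner f (g + h) = inner f g + inner f h.
Proof. by rewrite -inner_conj innerDl rmorphD/= !inner_conj. Qed.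

Lemma innerZr (a : R[i]) f g : inner f (a *: g) = cj a * inner f g.
Proof. by rewrite -inner_conj innerZl rmorphM/= !inner_conj. Qed.

Lemma inner0l f : inner 0 f = 0.
Proof. by rewrite -(scale0r 0) innerZl mul0r. Qed.

Lemma inner0r f : inner f 0 = 0.
Proof. by rewrite -inner_conj inner0l rmorph0. Qed.

Lemma innerNl f g : inner (- f) g = - inner f g.
Proof. by rewrite -scaleN1r innerZl mulN1r. Qed.

Lemma innerNr f g : inner f (- g) = - inner f g.
Proof. by rewrite -inner_conj innerNl rmorphN/= inner_conj. Qed.

Lemma innerBl f g h : inner (f - g) h = inner f h - inner g h.
Proof. by rewrite innerDl innerNl. Qed.

Lemma innerBr f g h : inner f (g - h) = inner f g - inner f h.
Proof. by rewrite innerDr innerNr. Qed.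

Lemma inner_suml (I : Type) (r : seq I) (P : pred I) (v : I -> L2 mu) f :
  inner (\sum_(i <- r | P i) v i) f = \sum_(i <- r | P i) inner (v i) f.
Proof.
elim/big_ind2 : _ => [|x y x' y' <- <-|//]; first exact: inner0l.
exact: innerDl.
Qed.

Lemma inner_sumr (I : Type) (r : seq I) (P : pred I) (v : I -> L2 mu) f :
  inner f (\sum_(i <- r | P i) v i) = \sum_(i <- r | P i) inner f (v i).
Proof.
elim/big_ind2 : _ => [|x y x' y' <- <-|//]; first exact: inner0r.
exact: innerDr.
Qed.

Lemma inner_nrm f : inner f f = (nrm f ^+ 2)%:C.
Proof. by rewrite inner_norm nrmE -rmorphXn. Qed.

Lemma mulc_conj (z : R[i]) : z * cj z = (normc z ^+ 2)%:C.
Proof.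
rewrite normc_sqr; case: z => a b; apply/eqP; rewrite eq_complex/=.
by apply/andP; split; apply/eqP; ring.
Qed.

Lemma normc_real (a : R) : normc a%:C = `|a|.
Proof. by rewrite /= expr0n addr0 sqrtr_sqr. Qed.

(** The square expanded here is [nrm (|f|^2 g - <g, f> f)], which involves no
    division. *)
Lemma cauchy_schwarz f g : normc (inner f g) <= nrm f * nrm g.
Proof.
have [f0|fN0] := eqVneq (nrm f) 0.
  by rewrite (nrm_eq0 f0) inner0l normc0 nrm0 mul0r.
set a := (nrm f ^+ 2)%:C; set b := inner g f.
have : inner (a *: g - b *: f) (a *: g - b *: f) =
    ((nrm f ^+ 4) * nrm g ^+ 2 - nrm f ^+ 2 * normc b ^+ 2)%:C.
  rewrite innerBl !innerBr !innerZl !innerZr -(inner_conj g f) !inner_nrm -/b.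
  have -> : cj a = a by exact: cj_real.
  have Eb : b * cj b = (normc b ^+ 2)%:C by exact: mulc_conj.
  have [_ CB CM _] := realC_morph.
  rewrite -/a CB (CM (nrm f ^+ 4)) (CM (nrm f ^+ 2)) -Eb -/a.
  have -> : (nrm f ^+ 4)%:C = a * a by rewrite -CM -exprD.
  ring.
rewrite inner_nrm => /complexI E.
have : 0 <= nrm f ^+ 4 * nrm g ^+ 2 - nrm f ^+ 2 * normc b ^+ 2.
  by rewrite -E sqr_ge0.
have -> : normc (inner f g) = normc b by rewrite -inner_conj normc_conj.
rewrite (_ : _ - _ = nrm f ^+ 2 * ((nrm f * nrm g) ^+ 2 - normc b ^+ 2)); last ring.
rewrite pmulr_rge0; last by rewrite exprn_even_gt0.
rewrite subr_ge0 ler_sqr ?nnegrE ?normc_ge0// mulr_ge0// nrm_ge0//.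
Qed.

Lemma cvg_innerl (f_ : nat -> L2 mu) f g : f_ @ \oo --> f ->
  (fun n => inner (f_ n) g) @ \oo --> inner f g.
Proof.
move=> /cvgn_nrmP h; apply/cvgn_nrmP => e e0.
have g1 : 0 < 1 + nrm g by rewrite ltr_pwDl// nrm_ge0.
have [N hN] := h _ (divr_gt0 e0 g1); exists N => n /hN.
rewrite -innerBl nrmC ltr_pdivlMr// => /(le_lt_trans _); apply.
rewrite (le_trans (cauchy_schwarz _ _))// ler_wpM2l ?nrm_ge0//.
by rewrite lerDr.
Qed.

Lemma cvg_innerr (f_ : nat -> L2 mu) f g : f_ @ \oo --> f ->
  (fun n => inner g (f_ n)) @ \oo --> inner g f.
Proof.
move=> /cvgn_nrmP h; apply/cvgn_nrmP => e e0.
have g1 : 0 < 1 + nrm g by rewrite ltr_pwDl// nrm_ge0.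
have [N hN] := h _ (divr_gt0 e0 g1); exists N => n /hN.
rewrite -innerBr nrmC ltr_pdivlMr// => /(le_lt_trans _); apply.
rewrite (le_trans (cauchy_schwarz _ _))// mulrC ler_wpM2l ?nrm_ge0//.
by rewrite lerDr.
Qed.

(** Polarization: a form that is real on the diagonal is Hermitian. *)
Lemma positive_herm (P : L2 mu -> L2 mu) f g :
  linear P -> (forall h, 0 <= inner (P h) h) ->
  inner (P g) f = cj (inner (P f) g).
Proof.
move=> /lin_additive[_ PD _ PZ _] P0.
have Preal h : cj (inner (P h) h) = inner (P h) h.
  have := P0 h; case: (inner (P h) h) => a b; rewrite lecE/= => /andP[/eqP -> _].
  exact: cj_real.
have H1 := Preal (f + g); have H2 := Preal (f + 'i *: g).
have Hf := Preal f; have Hg := Preal g.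
move: H1 H2; rewrite !PD !PZ !innerDl !innerDr !innerZl !innerZr.
move: Hf Hg; move: (inner (P f) f) (inner (P g) g) => p q.
move: (inner (P f) g) (inner (P g) f) => [a b] [a' b'].
move: p q => [p p'] [q q'].
move=> /eqP + /eqP + /eqP + /eqP; rewrite !eq_complex/=.
move=> /andP[_ /eqP h1] /andP[_ /eqP h2] /andP[_ /eqP h3] /andP[_ /eqP h4].
by apply/eqP; rewrite eq_complex/=; apply/andP; split; apply/eqP; lra.
Qed.

Lemma positive_ReE (P : L2 mu -> L2 mu) f : (forall h, 0 <= inner (P h) h) ->
  inner (P f) f = (normc (inner (P f) f))%:C.
Proof. by move=> /(_ f) P0; rewrite -normr_normc ger0_norm. Qed.

(** Cauchy-Schwarz for the form of a positive operator; [a] and [b] are only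
    bounds, so that no division by a vanishing diagonal entry occurs. *)
Lemma positive_offdiag (P : L2 mu -> L2 mu) f g (a b : R) :
  linear P -> (forall h, 0 <= inner (P h) h) -> 0 < a -> 0 < b ->
  normc (inner (P f) f) <= a ^+ 2 -> normc (inner (P g) g) <= b ^+ 2 ->
  normc (inner (P f) g) <= a * b.
Proof.
move=> Pl P0 a0 b0 Pf Pg; set z := inner (P f) g.
have [->|z0] := eqVneq z 0; first by rewrite normc0 mulr_ge0// ltW.
set r := normc z.
have r0 : 0 < r.
  rewrite lt_neqAle normc_ge0 andbT eq_sym; apply/eqP => /eq0_normc.
  by move/eqP; rewrite (negbTE z0).
(* the phase of z, so that the cross terms equal - 2 a b r *)
pose w := - (r^-1)%:C * z.
have := P0 (b%:C *: f + (a%:C * w) *: g).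
have [_ PD _ PZ _] := lin_additive Pl.
rewrite !PD !PZ !innerDl !innerDr !innerZl !innerZr.
rewrite (positive_herm f g Pl P0) -/z (positive_ReE f P0) (positive_ReE g P0).
move: Pf Pg; move: (normc (inner (P f) f)) (normc (inner (P g) g)) => p q pa qb.
have Ew : w * cj w = 1.
  rewrite /w rmorphM rmorphN/= cj_real mulrACA mulrNN mulc_conj -/r.
  by rewrite -!rmorphM/= -expr2 -exprMn mulVf ?gt_eqF// expr1n.
have Ez : cj w * z = - r%:C.
  rewrite /w rmorphM rmorphN/= cj_real !mulNr -mulrA (mulrC (cj z)) mulc_conj.
  by rewrite -/r -rmorphM/= expr2 mulrA mulVf ?gt_eqF// mul1r.
have Ez' : w * cj z = - r%:C.
  by rewrite -[w]conjCK -rmorphM/= Ez rmorphN/= cj_real.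
clearbody w; rewrite !rmorphM/= !cj_real.
rewrite (_ : _ + _ = (b ^+ 2 * p + a ^+ 2 * q - 2 * (a * b * r))%:C).
  rewrite lecE/= eqxx/= => h.
  have {}h : 2 * (a * b * r) <= 2 * (a * b) * (a * b).
    have : b ^+ 2 * p <= b ^+ 2 * a ^+ 2 by rewrite ler_wpM2l ?sqr_ge0.
    have : a ^+ 2 * q <= a ^+ 2 * b ^+ 2 by rewrite ler_wpM2l ?sqr_ge0.
    nra.
  have ab : 0 < 2 * (a * b) by rewrite !mulr_gt0.
  by rewrite -(ler_pM2l ab) -mulrA.
transitivity (b%:C * b%:C * p%:C + b%:C * a%:C * (cj w * z)
   + b%:C * a%:C * (w * cj z) + a%:C * a%:C * (w * cj w) * q%:C); first ring.
have [CD CB CM CX] := realC_morph.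
by rewrite Ew Ez Ez' !(CB, CD, CM, CX); ring.
Qed.

End inner_product.

(** * Completeness of L2 *)

Section complex_limit.
Context d (T : measurableType d) (R : realType).
Implicit Types z : nat -> T -> R[i].

(** The limit of a sequence of functions where it exists. Upper limits make it
    measurable without first isolating the set of convergence. *)
Definition clim z (x : T) : R[i] :=
  fine (limn_esup (fun n => (complex.Re (z n x))%:E)) +i*
  fine (limn_esup (fun n => (complex.Im (z n x))%:E)).

Lemma cmeasurable_clim z : (forall n, cmeasurable (z n)) ->
  cmeasurable (clim z).
Proof.
move=> mz; split; apply: (measurableT_comp (fine_measurable measurableT)) => //;
  apply: measurable_fun_limn_esup => n; apply/measurable_EFinP;
  by have [] := mz n.
Qed.

Lemma climE z x (l : R[i]) : z ^~ x @ \oo --> l -> clim z x = l.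
Proof.
move=> /cvgn_ReIm[hR hI].
have h (u : nat -> R) (a : R) : u @ \oo --> a ->
    fine (limn_esup (fun n => (u n)%:E)) = a.
  move=> ua; have /cvg_limn_einf_sup[_ ->//] : (u n)%:E @[n --> \oo] --> a%:E.
  by apply: cvg_EFin => //; exact: nearW.
by rewrite /clim (h _ _ hR) (h _ _ hI); case: (l).
Qed.

End complex_limit.

Lemma cmeasurableB d (T : measurableType d) (R : realType) (f g : T -> R[i]) :
  cmeasurable f -> cmeasurable g -> cmeasurable (fun x => f x - g x).
Proof.
move=> mf mg; rewrite (_ : (fun _ => _) = (fun x => f x + (-1) * g x)).
  by apply: cmeasurableD => //; apply: cmeasurableM => //; exact: cmeasurable_cst.
by apply/funext => x; rewrite mulN1r.
Qed.

Section L2_complete.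
Context d (T : measurableType d) (R : realType).
Variable mu : {measure set T -> \bar R}.
Implicit Types f g h : L2 mu.

Lemma L2N f : {ae mu, forall x, (- f : L2 mu) x = - f x}.
Proof.
by rewrite -scaleN1r; apply: filterS (L2Z (-1) f) => x ->; rewrite mulN1r.
Qed.

Lemma L2B f g : {ae mu, forall x, (f - g : L2 mu) x = f x - g x}.
Proof. by apply: filterS2 (L2D f (- g)) (L2N g) => x -> ->. Qed.

Lemma L2_0 : {ae mu, forall x, (0 : L2 mu) x = 0}.
Proof. by have := L2_ae_pi (0 : sqfun mu); rewrite piE. Qed.

Lemma L2_psum (v : nat -> L2 mu) : {ae mu, forall x, forall N,
  (psum v N : L2 mu) x = \sum_(n < N) v n x}.
Proof.
apply: ae_foralln => N; elim: N => [|N IH].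
  rewrite /psum big_ord0; apply: filterS L2_0 => x ->; by rewrite big_ord0.
rewrite /psum big_ord_recr/=.
apply: filterS2 IH (L2D (\sum_(n < N) v n) (v N)) => x E ->.
by rewrite big_ord_recr/= -E.
Qed.

Lemma integral_nrm f : (\int[mu]_x ((normc (f x)) ^+ 2)%:E = (nrm f ^+ 2)%:E)%E.
Proof.
rewrite nrm_l2norm /l2norm sqr_sqrtr; last first.
  by apply: Rintegral_ge0 => x _; exact: sqr_ge0.
rewrite /Rintegral fineK// ge0_fin_numE.
  by have /sqintP[] := L2_sqint f.
by apply: integral_ge0 => x _; rewrite lee_fin sqr_ge0.
Qed.

Lemma emeasurable_normc2 (f : T -> R[i]) : cmeasurable f ->
  measurable_fun setT (fun x => ((normc (f x)) ^+ 2)%:E).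
Proof. by move=> mf; apply/measurable_EFinP/measurable_funX/measurable_normc. Qed.

Lemma integral_nrmB f g :
  (\int[mu]_x ((normc (f x - g x)) ^+ 2)%:E = (nrm (f - g) ^+ 2)%:E)%E.
Proof.
rewrite -integral_nrm; apply: ae_eq_integral => //.
- by apply: emeasurable_normc2; apply: cmeasurableB; exact: L2_cmeasurable.
- exact/emeasurable_normc2/L2_cmeasurable.
- by apply: filterS (L2B f g) => x ->.
Qed.

(** Riesz-Fischer for series: the majorant is controlled by monotone
    convergence, the remainder by Fatou. *)
Lemma L2_abs_series (v : nat -> L2 mu) K : summable_by (fun n => nrm (v n)) K ->
  exists2 f : L2 mu, psum v @ \oo --> f &
    {ae mu, forall x, psum (fun n => v n x) @ \oo --> f x}.
Proof.
move=> vK.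
have K0 : 0 <= K by have := vK 0%N; rewrite big_ord0.
pose a n (x : T) : R[i] := (normc (v n x))%:C.
have sa n : a n \in sqint mu.
  apply/sqintP; split.
    split; last exact: measurable_cst.
    exact: (measurable_normc (L2_cmeasurable (v n))).
  under eq_integral do rewrite normc_real ger0_norm ?normc_ge0//.
  by have /sqintP[] := L2_sqint (v n).
have la n : l2norm mu (a n) = nrm (v n).
  rewrite nrm_l2norm; congr Num.sqrt; apply: eq_Rintegral => x _.
  by rewrite normc_real ger0_norm ?normc_ge0.
pose g N x := \sum_(n < N) normc (v n x).
have g0 N x : 0 <= g N x by apply: sumr_ge0 => n _; exact: normc_ge0.
have SgE N : \sum_(n < N) a n = (fun x => (g N x)%:C).
  elim: N => [|N IH].
    by apply/funext => x; rewrite /g !big_ord0.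
  rewrite big_ord_recr/= IH; apply/funext => x.
  by rewrite /g big_ord_recr/= rmorphD.
have sS N : \sum_(n < N) a n \in sqint mu by apply: rpred_sum.
have lS N : l2norm mu (\sum_(n < N) a n) <= K.
  apply: le_trans (vK N); elim: N => [|N IH].
    rewrite !big_ord0 /l2norm.
    rewrite (_ : \int[mu]_x _ = 0) ?sqrtr0// /Rintegral.
    under eq_integral do rewrite normc0 expr0n/=.
    by rewrite integral0.
  rewrite !big_ord_recr/= (le_trans (ler_l2normD _ _))//; first exact: sS.
  by rewrite la lerD.
have ig N : (\int[mu]_x ((g N x) ^+ 2)%:E <= (K ^+ 2)%:E)%E.
  have /sqintP[_ fin] := sS N.
  have : l2norm mu (\sum_(n < N) a n) ^+ 2 <= K ^+ 2.
    by rewrite ler_sqr ?nnegrE ?l2norm_ge0.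
  rewrite /l2norm sqr_sqrtr; last first.
    by apply: Rintegral_ge0 => x _; exact: sqr_ge0.
  rewrite -lee_fin /Rintegral fineK; last first.
    rewrite ge0_fin_numE//.
    by apply: integral_ge0 => x _; rewrite lee_fin sqr_ge0.
  by rewrite SgE; under eq_integral do rewrite normc_real ger0_norm//.
have mg N : measurable_fun setT (g N).
  by apply: measurable_sum => n; exact/measurable_normc/L2_cmeasurable.
pose G x := limn (fun N => ((g N x) ^+ 2)%:E).
have ndg x : nondecreasing_seq (g^~ x).
  by apply/nondecreasing_seqP => N; rewrite /g big_ord_recr/= lerDl normc_ge0.
have ndg2 x : {homo (fun N => ((g N x) ^+ 2)%:E) : m n / (m <= n)%N >-> (m <= n)%E}.
  by move=> m n mn; rewrite lee_fin ler_sqr ?nnegrE//; exact: ndg.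
have mg2 N : measurable_fun setT (fun x => ((g N x) ^+ 2)%:E).
  exact/measurable_EFinP/measurable_funX.
have iG : mu.-integrable setT G.
  apply/integrableP; split.
    apply: (emeasurable_fun_cvg _ _ mg2) => x _.
    by apply: ereal_nondecreasing_is_cvgn; exact: ndg2.
  under eq_integral => x _.
    rewrite gee0_abs; last first.
      apply: lime_ge; first by apply: ereal_nondecreasing_is_cvgn; exact: ndg2.
      by apply: nearW => N; rewrite lee_fin sqr_ge0.
    over.
  rewrite monotone_convergence//; last by move=> n x _; rewrite lee_fin sqr_ge0.
  apply: (@le_lt_trans _ _ (K ^+ 2)%:E); last exact: ltry.
  apply: lime_le; last by apply: nearW => N; exact: ig.
  apply: ereal_nondecreasing_is_cvgn => m n mn; apply: ge0_le_integral => //.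
  - by move=> x _; rewrite lee_fin sqr_ge0.
  - by move=> x _; exact: ndg2.
pose s N x := (psum v N : L2 mu) x.
have ms N : cmeasurable (s N) by exact: L2_cmeasurable.
have cvs : {ae mu, forall x, psum (fun n => v n x) @ \oo --> clim s x /\
    s ^~ x @ \oo --> clim s x}.
  apply: filterS2 (integrable_ae measurableT iG) (L2_psum v) => x /(_ I) Gx sx.
  have [l hl] : exists l : R[i], psum (fun n => v n x) @ \oo --> l.
    apply: abs_complete_C; exists (1 + fine (G x)) => N.
    under eq_bigr do rewrite nrmC.
    have : ((g N x ^+ 2)%:E <= G x)%E.
      apply: lime_ge; first by apply: ereal_nondecreasing_is_cvgn; exact: ndg2.
      by exists N => // m /= Nm; exact: ndg2.
    rewrite -{1}(fineK Gx) lee_fin -/(g N x); have := sqr_ge0 (g N x - 1).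
    have := g0 N x; move: (g N x) (fine (G x)) => p q.
    by rewrite sqrrB1 => *; nra.
  have hs : s ^~ x @ \oo --> l.
    rewrite (_ : s ^~ x = psum (fun n => v n x))//.
    by apply/funext => N; rewrite /s sx.
  by rewrite (climE hs).
have [t t0 ht] := summable_tail (fun n => nrm_ge0 (v n)) vK.
have tail M : (\int[mu]_x ((normc (clim s x - s M x)) ^+ 2)%:E <= ((t M) ^+ 2)%:E)%E.
  have tM : 0 <= t M by have := ht M M (leqnn M); rewrite big_geq.
  pose u n x := ((normc (s (M + n)%N x - s M x)) ^+ 2)%:E.
  have mB n m : cmeasurable (fun x => s n x - s m x).
    exact: cmeasurableB.
  have mu' n : measurable_fun setT (u n) by exact: emeasurable_normc2.
  have iu n : (\int[mu]_x u n x <= (t M ^+ 2)%:E)%E.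
    rewrite integral_nrmB lee_fin ler_sqr ?nnegrE ?nrm_ge0//.
    apply: le_trans (ht M (M + n)%N (leq_addr _ _)).
    rewrite /psum -(big_mkord xpredT v) -(big_mkord xpredT v).
    rewrite (@big_cat_nat _ _ _ M)//= ?leq_addr//.
    rewrite [X in nrm (X - _)]addrC addrK.
    exact: nrm_sum.
  have -> : (\int[mu]_x ((normc (clim s x - s M x)) ^+ 2)%:E =
             \int[mu]_x limn_einf (u^~ x))%E.
    apply: ae_eq_integral => //.
    - apply: emeasurable_normc2.
      by apply: cmeasurableB => //; exact: cmeasurable_clim.
    - rewrite (_ : (fun _ => _) = (fun x => - limn_esup (fun n => - u n x))%E).
        apply: measurableT_comp => //; apply: measurable_fun_limn_esup => n.
        exact: measurableT_comp.
      apply/funext => x; rewrite -[X in limn_esup X]/(-%E \o (u^~ x)).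
      by rewrite limn_esupN oppeK.
    - apply: filterS cvs => x [_ sx] _.
      have /cvg_limn_einf_sup[-> _//] :
        u ^~ x @ \oo --> ((normc (clim s x - s M x)) ^+ 2)%:E.
      apply: cvg_EFin; first exact: nearW.
      suff hn : (fun n => normc (s (M + n)%N x - s M x)) @ \oo -->
          normc (clim s x - s M x).
        exact: (cvgM hn hn).
      have : (fun n => s (M + n)%N x - s M x) @ \oo --> clim s x - s M x.
        apply: cvgB; last exact: cvg_cst.
        apply/cvgn_nrmP => e e0; have /cvgn_nrmP/(_ _ e0)[N hN] := sx.
        by exists N => n Nn; apply: hN; rewrite (leq_trans Nn)// leq_addl.
      move=> /cvgn_nrmP h; apply/cvgrPdist_lt => e e0.
      have [N hN] := h _ e0; exists N => // n /= /hN; apply: le_lt_trans.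
      rewrite -!nrmC ler_norml; apply/andP; split.
        rewrite lerNl opprB lerBlDr nrmB; apply: le_trans (nrmD _ _).
        by rewrite subrK.
      rewrite lerBlDr; apply: le_trans (nrmD _ _).
      by rewrite subrK.
  apply: le_trans (fatou _ measurableT mu' _) _.
    by move=> n x _; rewrite lee_fin sqr_ge0.
  rewrite limn_einf_lim; apply: lime_le; first exact: is_cvg_einfs.
  apply: nearW => n; apply: le_trans (iu n).
  by apply: ereal_inf_lbound; exists n => /=.
have sl : clim s \in sqint mu.
  apply/sqintP; split; first exact: cmeasurable_clim.
  apply: le_lt_trans (ltry (t 0%N ^+ 2)); apply: le_trans (tail 0%N).
  rewrite le_eqVlt; apply/orP; left; apply/eqP; apply: ae_eq_integral => //.
  - exact/emeasurable_normc2/cmeasurable_clim.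
  - apply: emeasurable_normc2.
    by apply: cmeasurableB => //; exact: cmeasurable_clim.
  - by apply: filterS L2_0 => x x0 _; rewrite /s /psum big_ord0 x0 subr0.
exists (toL2 sl); last first.
  by apply: filterS2 cvs (toL2E sl) => x [hx _] ->.
apply: (cvgn_nrm_squeeze _ t0) => M.
have tM : 0 <= t M by have := ht M M (leqnn M); rewrite big_geq.
rewrite -(@ler_sqr R) ?nnegrE ?nrm_ge0// -lee_fin -integral_nrmB.
apply: le_trans (tail M).
rewrite le_eqVlt; apply/orP; left; apply/eqP; apply: ae_eq_integral => //.
- apply: emeasurable_normc2.
  by apply: cmeasurableB => //; exact: L2_cmeasurable.
- apply: emeasurable_normc2.
  by apply: cmeasurableB => //; exact: cmeasurable_clim.
- by apply: filterS (toL2E sl) => x ->.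
Qed.

End L2_complete.

(** * Orthonormal bases and unitary operators *)

Section orthonormal_series.
Context d (T : measurableType d) (R : realType).
Variable mu : {measure set T -> \bar R}.
Implicit Types f g h : L2 mu.
Implicit Types e : nat -> L2 mu.

Lemma abs_complete_L2 : abs_complete (L2 mu).
Proof. by move=> v [K /L2_abs_series[f hf _]]; exists f. Qed.

Lemma geo_half N : \sum_(n < N) (2^-1 : R) ^+ n <= 2.
Proof.
suff -> : \sum_(n < N) (2^-1 : R) ^+ n = 2 - 2 * 2^-1 ^+ N.
  by rewrite gerBl mulr_ge0// exprn_ge0.
elim: N => [|N IH]; first by rewrite big_ord0 expr0 mulr1 subrr.
by rewrite big_ord_recr/= IH exprS mulrA mulfV//; lra.
Qed.

(** A subsequence with geometrically small increments is an absolutely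
    convergent series. *)
Lemma L2_cauchy (F : nat -> L2 mu) :
  (forall e : R, 0 < e -> exists N, forall n, (N <= n)%N -> nrm (F n - F N) < e) ->
  exists f : L2 mu, F @ \oo --> f.
Proof.
move=> cF.
have h0 k : 0 < (2^-1 : R) ^+ k by rewrite exprn_gt0.
have /choice[m hm] : forall k, exists N, forall n, (N <= n)%N ->
    nrm (F n - F N) < 2^-1 ^+ k by move=> k; exact: cF.
pose v k : L2 mu := if k is k'.+1 then F (m k'.+1) - F (m k') else F (m 0%N).
have vE k : psum v k.+1 = F (m k).
  elim: k => [|k IH]; first by rewrite /psum big_ord_recr/= big_ord0 add0r.
  by rewrite /psum big_ord_recr/= -[X in X + _]/(psum v k.+1) IH addrC subrK.
have nv k : nrm (v k.+1) <= 2 * 2^-1 ^+ k.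
  pose n := maxn (m k) (m k.+1); rewrite /v -(subrK (F n) (F (m k.+1))) -addrA.
  rewrite (le_trans (nrmD _ _))// mulr_natl mulr2n lerD//.
    rewrite nrmB ltW// (lt_le_trans (hm _ _ (leq_maxr _ _)))//.
    by rewrite exprS ler_piMl// ?exprn_ge0// invf_le1// ler1n.
  by rewrite ltW// hm// leq_maxl.
have [f hf] : exists f : L2 mu, psum v @ \oo --> f.
  apply: abs_complete_L2; exists (nrm (v 0%N) + 4) => -[|N].
    by rewrite big_ord0 addr_ge0// nrm_ge0.
  rewrite big_ord_recl/= lerD2l.
  apply: (@le_trans _ _ (\sum_(k < N) 2 * 2^-1 ^+ k)).
    by apply: ler_sum => k _; exact: nv.
  by rewrite -mulr_sumr; have := geo_half N; lra.
exists f; apply/cvgn_nrmP => e e0.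
have e20 : 0 < e / 2 by rewrite divr_gt0.
have e40 : 0 < e / 4 by rewrite divr_gt0.
have /cvgn_nrmP/(_ _ e20)[N hN] := hf.
have [K _ hK] : \forall k \near \oo, (2^-1 : R) ^+ k < e / 4.
  have : (fun k => (2^-1 : R) ^+ k) @ \oo --> (0 : R).
    by apply: cvg_expr; rewrite ger0_norm// invf_lt1// ltr1n.
  move=> /cvgrPdist_lt/(_ _ e40); apply: filterS => k.
  by rewrite sub0r normrN ger0_norm// ltW.
pose k := maxn N K; exists (m k) => n mn.
rewrite -(subrK (F (m k)) f) -addrA (le_lt_trans (nrmD _ _))//.
rewrite (splitr e) ltrD//.
  by rewrite -vE; apply: hN; rewrite (leq_trans (leq_maxl N K))// leqnSn.
rewrite nrmB (lt_trans (hm _ _ mn))// (lt_trans (hK _ (leq_maxr N K)))//.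
by lra.
Qed.

Definition orthonormal_system e := forall i j, inner (e i) (e j) = (i == j)%:R.

Definition total_system e := forall f, (forall n, inner f (e n) = 0) -> f = 0.

Section one_system.
Variables (e : nat -> L2 mu) (eo : orthonormal_system e).

Lemma nrm_orthonormal n : nrm (e n) = 1.
Proof.
have := eo n n; rewrite eqxx inner_nrm => /complexI/eqP.
by rewrite sqrp_eq1 ?nrm_ge0// => /eqP.
Qed.

Lemma inner_osum (c : nat -> R[i]) N k :
  inner (\sum_(n < N) c n *: e n) (e k) = if (k < N)%N then c k else 0.
Proof.
elim: N => [|N IH]; first by rewrite big_ord0 inner0l.
rewrite big_ord_recr/= innerDl IH innerZl eo ltnS.
by case: (ltngtP N k) => [_|_|->] /=; rewrite ?mulr0 ?mulr1 ?addr0 ?add0r.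
Qed.

Lemma nrm_osum (c : nat -> R[i]) M N :
  nrm (\sum_(M <= n < N) c n *: e n) ^+ 2 = \sum_(M <= n < N) normc (c n) ^+ 2.
Proof.
apply: complexI; rewrite -inner_nrm inner_suml.
have [_ _ _ CX] := @realC_morph R.
rewrite (raddf_sum (real_complex R)); apply: eq_big_nat => i iMN.
rewrite innerZl inner_sumr (bigD1_seq i)/= ?iota_uniq ?mem_index_iota//.
rewrite big1 ?addr0 => [|j ji].
  by rewrite innerZr eo eqxx mulr1 mulc_conj.
by rewrite innerZr eo eq_sym (negbTE ji) mulr0.
Qed.

Lemma bessel f N : \sum_(n < N) normc (inner f (e n)) ^+ 2 <= nrm f ^+ 2.
Proof.
pose s := \sum_(n < N) inner f (e n) *: e n.
have sE : inner s s = (\sum_(n < N) normc (inner f (e n)) ^+ 2)%:C.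
  by rewrite inner_nrm /s -(big_mkord xpredT (fun n => inner f (e n) *: e n))
    nrm_osum big_mkord.
have fs : inner f s = inner s s.
  rewrite sE (raddf_sum (real_complex R)) inner_sumr; apply: eq_bigr => n _.
  by rewrite innerZr mulrC mulc_conj.
have sf : inner s f = inner s s by rewrite -inner_conj fs inner_conj.
have : inner (f - s) (f - s) = (nrm f ^+ 2)%:C - inner s s.
  by rewrite innerBl !innerBr fs sf subrr subr0 inner_nrm.
rewrite sE inner_nrm -(rmorphB (real_complex R)) => /complexI E.
by rewrite -subr_ge0 -E sqr_ge0.
Qed.

Lemma ortho_series (c : nat -> R[i]) K :
  summable_by (fun n => normc (c n) ^+ 2) K ->
  exists2 f : L2 mu, psum (fun n => c n *: e n) @ \oo --> f &
    forall n, inner f (e n) = c n.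
Proof.
move=> cK; have [t t0 ht] := summable_tail (fun n => sqr_ge0 _) cK.
have [f hf] : exists f : L2 mu, psum (fun n => c n *: e n) @ \oo --> f.
  apply: L2_cauchy => x x0.
  have x20 : 0 < x ^+ 2 by rewrite exprn_gt0.
  have /cvgrPdist_lt/(_ _ x20)[N _ hN] := t0.
  exists N => n Nn; rewrite -(@ltr_sqr R) ?nnegrE ?nrm_ge0 ?ltW//.
  rewrite /psum -!(big_mkord xpredT (fun n => c n *: e n)).
  rewrite (@big_cat_nat _ _ _ N)//= [X in nrm (X - _)]addrC addrK nrm_osum.
  rewrite (le_lt_trans (ht _ _ Nn))// (le_lt_trans (ler_norm _))//.
  by have := hN _ (leqnn N); rewrite sub0r normrN.
exists f => // k; apply: (nrm_cvg_unique (cvg_innerl hf)).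
apply/cvgn_nrmP => x x0; exists k.+1 => n kn.
by rewrite inner_osum kn subrr nrm0.
Qed.

Hypothesis et : total_system e.

Lemma total_inj f g : (forall n, inner f (e n) = inner g (e n)) -> f = g.
Proof.
by move=> fg; apply/eqP; rewrite -subr_eq0; apply/eqP/et => n;
  rewrite innerBl fg subrr.
Qed.

Lemma expansion f : psum (fun n => inner f (e n) *: e n) @ \oo --> f.
Proof.
have [g hg ge] := @ortho_series (fun n => inner f (e n)) _ (bessel f).
by rewrite -[X in _ --> X](total_inj ge).
Qed.

Lemma parseval f g :
  psum (fun n => inner f (e n) * cj (inner g (e n))) @ \oo --> inner f g.
Proof.
have := cvg_innerl (g := g) (expansion (f := f)).
apply: cvg_trans; apply: near_eq_cvg.
apply: nearW => N; rewrite inner_suml; apply: eq_bigr => n _.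
by rewrite innerZl -(inner_conj g).
Qed.

End one_system.

End orthonormal_series.

Section transport.
Context d d' (S : measurableType d) (T : measurableType d') (R : realType).
Variables (mu : {measure set S -> \bar R}) (nu : {measure set T -> \bar R}).
Variables (e : nat -> L2 mu) (u : nat -> L2 nu).
Hypotheses (eo : orthonormal_system e) (uo : orthonormal_system u).
Hypotheses (et : total_system e) (ut : total_system u).

(** By Bessel, the coefficients in one basis are square-summable, hence those
    of a vector in the other basis. *)
Lemma transport_exists : exists U : L2 mu -> L2 nu,
  forall f n, inner (U f) (u n) = inner f (e n).
Proof.
suff /choice[U UE] : forall f : L2 mu, exists g : L2 nu,
  forall n, inner g (u n) = inner f (e n) by exists U.
move=> f.
have [g _ gE] := @ortho_series _ _ _ _ _ uo (fun n => inner f (e n)) _ (bessel eo f).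
by exists g.
Qed.

Lemma transport_linear (U : L2 mu -> L2 nu) :
  (forall f n, inner (U f) (u n) = inner f (e n)) -> linear U.
Proof.
move=> UE a f g; apply: (total_inj ut) => n.
by rewrite innerDl innerZl !UE innerDl innerZl.
Qed.

Lemma transport_inner (U : L2 mu -> L2 nu) f g :
  (forall f n, inner (U f) (u n) = inner f (e n)) ->
  inner (U f) (U g) = inner f g.
Proof.
move=> UE; apply: nrm_cvg_unique (parseval uo ut (f := U f) (g := U g)) _.
by under [psum _]eq_fun do under eq_bigr do rewrite !UE; exact: parseval.
Qed.

End transport.

(** * Orthogonalization *)

Section gram_schmidt.
Context d (T : measurableType d) (R : realType).
Variable mu : {measure set T -> \bar R}.
Implicit Types f : L2 mu.

(** No finite family is total; this is what lets the orthogonalization below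
    go on for ever. *)
Definition infinite_dim := forall n (e : nat -> L2 mu),
  exists2 f : L2 mu, f != 0 & forall j, (j < n)%N -> inner f (e j) = 0.

(** More orthogonal vectors than linear conditions: a nonzero combination of
    the [b i] lies in the kernel of the matrix of the conditions. *)
Lemma infinite_dim_orthogonal (b : nat -> L2 mu) :
  (forall i j, i != j -> inner (b i) (b j) = 0) -> (forall i, b i != 0) ->
  infinite_dim.
Proof.
move=> bo b0 n e.
pose M : 'M[R[i]]_(n.+1, n) := \matrix_(i, j) inner (b i) (e j).
have : kermx M != 0.
  rewrite kermx_eq0 -row_leq_rank -ltnNge (leq_ltn_trans (rank_leq_col M))//.
move=> /rowV0Pn[v /sub_kermxP vM v0].
exists (\sum_i v 0 i *: b i).
  apply: contra_neq v0 => s0; apply/rowP => i; rewrite mxE.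
  have /(congr1 (fun f => inner f (b i))) := s0.
  rewrite inner0l inner_suml (bigD1 i)//= big1 ?addr0 => [|j ji].
    rewrite innerZl inner_nrm => /eqP; rewrite mulf_eq0 => /orP[/eqP//|].
    move=> /eqP/complexI/eqP; rewrite expf_eq0/= => /eqP/nrm_eq0 bi0.
    by have := b0 i; rewrite bi0 eqxx.
  by rewrite innerZl bo ?mulr0// (inj_eq val_inj).
move=> j jn; rewrite inner_suml.
have := congr1 (fun A : 'rV[R[i]]_n => A 0 (Ordinal jn)) vM.
rewrite [LHS]mxE [RHS]mxE => E; rewrite -[RHS]E.
by apply: eq_bigr => i _; rewrite innerZl mxE.
Qed.

Definition residual (s : seq (L2 mu)) f := f - \sum_(x <- s) inner f x *: x.

Lemma residual_mkseq (e : nat -> L2 mu) n f :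
  residual (mkseq e n) f = f - \sum_(i < n) inner f (e i) *: e i.
Proof.
by rewrite /residual big_map -{1}(subn0 n) big_mkord.
Qed.

Definition is_subspace (V : L2 mu -> Prop) :=
  V 0 /\ forall (a : R[i]) f h, V f -> V h -> V (a *: f + h).

(** Vectors of [g] that depend on the preceding ones are skipped, so that [e n]
    comes from some [g k] with [k >= n]; this is why it is orthogonal to all
    earlier [g k]. *)
Lemma gram_schmidt (g : nat -> L2 mu) (V : L2 mu -> Prop) :
  total_system g -> infinite_dim -> is_subspace V -> (forall k, V (g k)) ->
  exists e : nat -> L2 mu, [/\ orthonormal_system e, total_system e,
    forall k n, (k < n)%N -> inner (g k) (e n) = 0 & forall n, V (e n)].
Proof.
move=> gt inf [V0 VD] Vg.
have step (s : seq (L2 mu)) : exists x : L2 mu,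
    (exists k, residual s (g k) != 0) ->
    exists k, [/\ residual s (g k) != 0,
      forall k', (k' < k)%N -> residual s (g k') = 0 &
      x = ((nrm (residual s (g k)))^-1)%:C *: residual s (g k)].
  have [ex|nex] := pselect (exists k, residual s (g k) != 0); last by exists 0.
  case: (ex_minnP ex) => k rk kmin.
  exists (((nrm (residual s (g k)))^-1)%:C *: residual s (g k)) => _.
  exists k; split=> // k' k'k; apply/eqP; apply: contraLR k'k => /kmin.
  by rewrite -leqNgt.
have {step}/choice[F HF] := step.
pose S := fix S n := if n is n'.+1 then rcons (S n') (F (S n')) else [::].
pose e n := F (S n).
have SE n : S n = mkseq e n by elim: n => // n IH; rewrite mkseqS -IH.
pose r n f := f - \sum_(i < n) inner f (e i) *: e i.
have rE n f : residual (S n) f = r n f by rewrite SE residual_mkseq.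
have rS n f : r n.+1 f = r n f - inner f (e n) *: e n.
  by rewrite /r big_ord_recr/= opprD addrA.
have r0 n f : r n f = 0 -> f = \sum_(i < n) inner f (e i) *: e i.
  by move=> /eqP; rewrite subr_eq0 => /eqP.
have rnz n : exists k, residual (S n) (g k) != 0.
  apply: contrapT => nex; have [f f0 fe] := inf n e.
  move/eqP: f0; apply; apply: gt => k; rewrite (r0 n (g k)).
    rewrite inner_sumr big1// => i _; by rewrite innerZr fe ?mulr0.
  by rewrite -rE; apply/eqP/negPn/negP => h; apply: nex; exists k.
have {HF} He n : exists k, [/\ residual (S n) (g k) != 0,
    forall k', (k' < k)%N -> residual (S n) (g k') = 0 &
    e n = ((nrm (residual (S n) (g k)))^-1)%:C *: residual (S n) (g k)].
  exact: HF (rnz n).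
have r_perp n : (forall i j, (i < n)%N -> (j < n)%N ->
      inner (e i) (e j) = (i == j)%:R) ->
    forall f j, (j < n)%N -> inner (r n f) (e j) = 0.
  move=> on f j jn; rewrite innerBl inner_suml (bigD1 (Ordinal jn))//= big1.
    by rewrite innerZl on// eqxx mulr1 addr0 subrr.
  move=> i ij; rewrite innerZl on//.
  by move: ij; rewrite -(inj_eq val_inj)/= => /negbTE ->; rewrite mulr0.
have eo n : forall i j, (i < n)%N -> (j < n)%N -> inner (e i) (e j) = (i == j)%:R.
  elim: n => // n IH.
  have enE : inner (e n) (e n) = 1.
    have [k [rk _ ->]] := He n.
    have nr : nrm (residual (S n) (g k)) != 0.
      by apply: contra_neq rk; exact: nrm_eq0.
    have [_ _ CM _] := @realC_morph R.
    rewrite innerZl innerZr cj_real inner_nrm -!CM.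
    by rewrite expr2 mulKf// mulVf.
  have en j : (j < n)%N -> inner (e n) (e j) = 0.
    move=> jn; have [k [_ _ ->]] := He n; rewrite rE innerZl.
    by rewrite (r_perp n IH)// mulr0.
  move=> i j; rewrite ltnS leq_eqVlt => /predU1P[->|i_n];
    rewrite ltnS leq_eqVlt => /predU1P[->|j_n].
  - by rewrite eqxx enE.
  - by rewrite en// gtn_eqF.
  - by rewrite -inner_conj en// rmorph0 ltn_eqF.
  - exact: IH.
have eon : orthonormal_system e.
  by move=> i j; apply: (eo (maxn i j).+1); rewrite ltnS ?leq_maxl ?leq_maxr.
have rK n : forall k, (k < n)%N -> r n (g k) = 0.
  elim: n => // n IH k; rewrite ltnS leq_eqVlt => /predU1P[->|kn]; last first.
    rewrite rS IH// (r0 n (g k) (IH k kn)) inner_suml big1 ?scale0r ?subr0//.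
    by move=> i _; rewrite innerZl eon (ltn_eqF (ltn_ord i)) mulr0.
  rewrite rS; have [k0 [rk0 k0min en]] := He n.
  have nk0 : (n <= k0)%N.
    rewrite leqNgt; apply/negP => /IH; rewrite -rE => h.
    by rewrite h eqxx in rk0.
  have gne : inner (g n) (e n) = inner (r n (g n)) (e n).
    rewrite innerBl inner_suml big1 ?subr0// => i _.
    by rewrite innerZl eon (ltn_eqF (ltn_ord i)) mulr0.
  move: nk0; rewrite leq_eqVlt => /predU1P[nk0|/k0min]; last first.
    by rewrite gne rE => ->; rewrite inner0l scale0r subrr.
  have ern : r n (g n) = (nrm (r n (g n)))%:C *: e n.
    have nr : nrm (residual (S n) (g k0)) != 0.
      by apply: contra_neq rk0; exact: nrm_eq0.
    have [_ _ CM _] := @realC_morph R.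
    move: nr en; rewrite -nk0 rE => nr ->.
    by rewrite scalerA -CM mulfV// scale1r.
  rewrite gne {1}ern {2}ern innerZl eon eqxx mulr1.
  exact: subrr.
have Ve n : V (e n).
  have VZ a f : V f -> V (a *: f).
    by move=> Vf; have := VD a _ _ Vf V0; rewrite addr0.
  have VN f h : V f -> V h -> V (f - h).
    by move=> Vf Vh; have := VD (-1) _ _ Vh Vf; rewrite scaleN1r addrC.
  have Vr : forall n, (forall i, (i < n)%N -> V (e i)) -> forall f, V f -> V (r n f).
    move=> m Vm f Vf; apply: VN => //.
    elim/big_ind : _ => [//|x y Vx Vy|i _]; last by apply: VZ; exact: Vm.
    by have := VD 1 _ _ Vx Vy; rewrite scale1r.
  have : forall m i, (i < m)%N -> V (e i).
    elim=> // m IH i; rewrite ltnS leq_eqVlt => /predU1P[->|]; last exact: IH.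
    by have [k [_ _ ->]] := He m; apply: VZ; rewrite rE; exact: Vr.
  by move=> /(_ n.+1 n (leqnn _)).
exists e; split=> // [f fe|k n kn].
  apply: gt => k; rewrite (r0 k.+1 (g k)) ?rK//.
  by rewrite inner_sumr big1// => i _; rewrite innerZr fe mulr0.
rewrite (r0 n (g k)) ?rK// inner_suml big1// => i _.
by rewrite innerZl eon (ltn_eqF (ltn_ord i)) mulr0.
Qed.

End gram_schmidt.

(** * Total sequences in L2 of a separable measure *)

Section indicators.
Context d (T : measurableType d) (R : realType).
Variable mu : {measure set T -> \bar R}.
Implicit Types (f : L2 mu) (A B D E : set T).

Lemma cmeasurable_indic D : measurable D ->
  cmeasurable (fun x => (\1_D x : R)%:C).
Proof. by move=> mD; split; [exact: measurable_indic|exact: measurable_cst]. Qed.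

Lemma ae_zero_on (h : T -> R[i]) D : measurable D -> cmeasurable h ->
  cintegrable mu (fun x => h x * (\1_D x)%:C) ->
  (forall E, measurable E -> E `<=` D ->
    cintegral mu (fun x => h x * (\1_E x)%:C) = 0) ->
  {ae mu, forall x, D x -> h x = 0}.
Proof.
move=> mD [mR mI] [iR iI] h0.
have real (u : T -> R) : measurable_fun setT u ->
    mu.-integrable setT (fun x => (u x * \1_D x)%:E) ->
    (forall E, measurable E -> E `<=` D -> \int[mu]_x (u x * \1_E x) = 0) ->
    {ae mu, forall x, D x -> u x = 0}.
  move=> mu' iu u0.
  have patchE E : (fun x => (u x * \1_E x)%:E) = (EFin \o u) \_ E.
    by apply/funext => x; rewrite patchE indicE; case: (x \in E);
      rewrite /= ?mulr1 ?mulr0.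
  have iD : mu.-integrable D (EFin \o u).
    by apply/(integrable_mkcond _ mD); rewrite -patchE.
  have Du : ae_eq mu D (EFin \o u) (cst 0%E).
    apply: integral_ae_eq => // E ED mE.
    rewrite integral0 integral_mkcond -patchE.
    have fin : (\int[mu]_x (u x * \1_E x)%:E)%E \is a fin_num.
      rewrite patchE -integral_mkcond; apply: integrable_fin_num => //.
      exact: integrableS iD.
    by rewrite -(fineK fin) -[fine _]/(\int[mu]_x (u x * \1_E x)) u0.
  by apply: filterS Du => x Dux Dx; have [] := Dux Dx.
have ReE E x : complex.Re (h x * (\1_E x)%:C) = complex.Re (h x) * \1_E x.
  by case: (h x) => a b /=; rewrite mulr0 subr0.
have ImE E x : complex.Im (h x * (\1_E x)%:C) = complex.Im (h x) * \1_E x.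
  by case: (h x) => a b /=; rewrite mulr0 add0r.
have hR : {ae mu, forall x, D x -> complex.Re (h x) = 0}.
  apply: real => //; first by under eq_fun do rewrite -ReE.
  move=> E mE ED; have := congr1 (@complex.Re R) (h0 E mE ED).
  by move=> /= <-; apply: eq_Rintegral => x _; rewrite ReE.
have hI : {ae mu, forall x, D x -> complex.Im (h x) = 0}.
  apply: real => //; first by under eq_fun do rewrite -ImE.
  move=> E mE ED; have := congr1 (@complex.Im R) (h0 E mE ED).
  by move=> /= <-; apply: eq_Rintegral => x _; rewrite ImE.
apply: filterS2 hR hI => x hRx hIx Dx.
by rewrite [h x]complexE hRx// hIx// mulr0 addr0.
Qed.

Lemma indic_L2 B : measurable B -> (mu B < +oo)%E ->
  exists2 f : L2 mu, {ae mu, forall x, f x = (\1_B x)%:C} &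
    nrm f ^+ 2 = fine (mu B).
Proof.
move=> mB fB.
have E x : normc ((\1_B x : R)%:C) ^+ 2 = \1_B x.
  rewrite normc_real indicE.
  by case: (x \in B); rewrite ?normr0 ?normr1 ?expr0n ?expr1n.
have iE : (\int[mu]_x (normc ((\1_B x : R)%:C) ^+ 2)%:E = mu B)%E.
  by under eq_integral do rewrite E; rewrite integral_indic// setIT.
have sB : (fun x => (\1_B x : R)%:C) \in sqint mu.
  by apply/sqintP; split; [exact: cmeasurable_indic|rewrite iE].
exists (toL2 sB); first exact: toL2E.
rewrite -[LHS]/(fine (_%:E)) -integral_nrm; congr fine; rewrite -iE.
apply: ae_eq_integral => //.
- exact/emeasurable_normc2/L2_cmeasurable.
- exact/emeasurable_normc2/cmeasurable_indic.
- by apply: filterS (toL2E sB) => x ->.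
Qed.

Lemma inner_indic f (b : L2 mu) B : measurable B ->
  {ae mu, forall x, b x = (\1_B x)%:C} ->
  inner f b = cintegral mu (fun x => f x * (\1_B x)%:C).
Proof.
move=> mB bE; apply: eq_ae_cintegral; first exact: cmeasurable_inner.
  by apply: cmeasurableM; [exact: L2_cmeasurable|exact: cmeasurable_indic].
by apply: filterS bE => x ->; rewrite cj_real.
Qed.

Lemma disjoint_infinite_dim (B : nat -> set T) :
  (forall n, measurable (B n)) -> (forall n, (0 < mu (B n) < +oo)%E) ->
  (forall i j, i != j -> B i `&` B j = set0) -> infinite_dim mu.
Proof.
move=> mB muB Bij.
have /choice[b bE] : forall n, exists b : L2 mu,
    {ae mu, forall x, b x = (\1_(B n) x)%:C} /\ b != 0.
  move=> n; have /andP[B0 Bfin] := muB n; have [b bE nb] := indic_L2 (mB n) Bfin.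
  exists b; split=> //; apply/eqP => b0; move: nb; rewrite b0 nrm0 expr0n/=.
  by move/esym/eqP; rewrite gt_eqF// fine_gt0// B0 Bfin.
apply: (@infinite_dim_orthogonal _ _ _ _ b) => [i j ij|i]; last by case: (bE i).
rewrite (inner_indic _ (mB j) (bE j).1).
rewrite (@eq_ae_cintegral _ _ _ _ _ (fun=> 0)).
- by rewrite /cintegral /Rintegral/= !integral0.
- by apply: cmeasurableM; [exact: L2_cmeasurable|exact: cmeasurable_indic].
- exact: cmeasurable_cst.
apply: filterS (bE i).1 => x ->; rewrite !indicE.
case: (boolP (x \in B i)) => [xi|]; last by rewrite mul0r.
case: (boolP (x \in B j)) => [xj|]; last by rewrite mulr0.
have : (B i `&` B j) x by split; exact: set_mem.
by rewrite Bij.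
Qed.

End indicators.

Section sigma_finite_space.
Context d (Y : measurableType d) (R : realType).
Variable mu : {sigma_finite_measure set Y -> \bar R}.

(** Nonatomicity gives sets of ever smaller positive measure inside one
    another; the successive differences are disjoint and not negligible. *)
Lemma nonatomic_infinite_dim : nonatomic mu -> (0 < mu setT)%E -> infinite_dim mu.
Proof.
move=> na muT.
have [F FT mF] := sigma_finiteT mu.
pose P A := measurable A /\ (0 < mu A < +oo)%E.
have [A0 PA0] : exists A, P A.
  apply: contrapT => nP.
  have : {ae mu, forall x, forall n, ~ F n x}.
    apply: ae_foralln => n; have [mFn fFn] := mF n.
    exists (F n); split=> //; last by move=> x /= /contrapT.
    apply: contrapT => Fn0; apply: nP; exists (F n); split=> //.
    by rewrite fFn andbT lt0e measure_ge0 andbT; exact/eqP.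
  case=> N [mN N0 subN]; suff NT : N = setT by move: muT; rewrite -NT N0 ltxx.
  apply/seteqP; split=> // x _; apply: subN => /= nF.
  have [n _ Fnx] : (\bigcup_n F n) x by rewrite -FT.
  exact: nF Fnx.
have /choice[N NP] : forall A, exists B, P A -> [/\ P B, B `<=` A & (mu B < mu A)%E].
  move=> A; have [[mA /andP[A0' Af]]|nPA] := pselect (P A); last by exists set0.
  have [B [mB BA B0 BmA]] := na A mA A0'; exists B => _; split=> //; split=> //.
  by rewrite B0 (lt_trans BmA).
pose A n := iter n N A0.
have PA n : P (A n) by elim: n => // n IH; have [] := NP _ IH.
have SA n : A n.+1 `<=` A n by have [] := NP _ (PA n).
have SA' m n : (m <= n)%N -> A n `<=` A m.
  move=> mn; rewrite -(subnK mn).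
  elim: (n - m)%N => [|k IH]; first exact: subset_refl.
  by rewrite addSn; apply: subset_trans IH; exact: SA.
apply: (@disjoint_infinite_dim _ _ _ mu (fun n => A n `\` A n.+1)).
- by move=> n; apply: measurableD; [case: (PA n)|case: (PA n.+1)].
- move=> n; have [mA /andP[A0' Af]] := PA n; have [mA1 /andP[A10 A1f]] := PA n.+1.
  have [_ _ AA] := NP _ (PA n).
  rewrite measureD// setIidr; last exact: SA.
  rewrite sube_gt0 AA/=; apply: le_lt_trans Af.
  by rewrite leeBlDr ?leeDl// ge0_fin_numE.
- move=> i j; wlog ij : i j / (i < j)%N => [h|_].
    rewrite neq_ltn => /orP[ij|ji]; first by apply: h; rewrite ?ltn_eqF.
    by rewrite setIC; apply: h; rewrite ?ltn_eqF.
  by apply/seteqP; split=> // x [[_ nAi] [Aj _]]; apply: nAi; exact: (SA' i.+1 j).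
Qed.

Lemma L2_eq0_indic (f : L2 mu) :
  (forall B, measurable B -> (mu B < +oo)%E -> forall b : L2 mu,
    {ae mu, forall x, b x = (\1_B x)%:C} -> inner f b = 0) -> f = 0.
Proof.
move=> f0; have [F FT mF] := sigma_finiteT mu.
have fF n : {ae mu, forall x, F n x -> f x = 0}.
  have [mFn fFn] := mF n; apply: ae_zero_on => //; first exact: L2_cmeasurable.
    have [b bE _] := indic_L2 mFn fFn.
    have sB : (fun x => (\1_(F n) x : R)%:C) \in sqint mu.
      apply/sqintP; split; first exact: cmeasurable_indic.
      have /sqintP[_] := L2_sqint b; apply: le_lt_trans.
      rewrite le_eqVlt; apply/orP; left; apply/eqP; apply: ae_eq_integral => //.
      - exact/emeasurable_normc2/cmeasurable_indic.
      - exact/emeasurable_normc2/L2_cmeasurable.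
      - by apply: filterS bE => x ->.
    exact: cintegrableM (L2_sqint f) sB.
  move=> E mE EF; have fE : (mu E < +oo)%E.
    by apply: le_lt_trans fFn; apply: le_measure => //; rewrite inE.
  have [b bE _] := indic_L2 mE fE; rewrite -(inner_indic f mE bE).
  exact: f0 bE.
apply/L2P; have /ae_foralln fF' := fF; apply: filterS2 fF' (L2_0 mu) => x fFx ->.
have : (\bigcup_n F n) x by rewrite -FT.
by move=> [n _ Fnx]; exact: (fFx n).
Qed.

(** The distance in [L2] between two indicators is the square root of the
    measure of the symmetric difference, so a vector orthogonal to the indicators
    of a dense sequence of sets is orthogonal to all of them. *)
Lemma separable_total : separable_measure mu ->
  exists f : nat -> L2 mu, total_system f.
Proof.
move=> [A [mA dA]].
have /choice[f fE] : forall n, exists f : L2 mu, (mu (A n) < +oo)%E ->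
    {ae mu, forall x, f x = (\1_(A n) x)%:C}.
  move=> n; have [fA|nfA] := pselect (mu (A n) < +oo)%E; last by exists 0.
  by have [f fE _] := indic_L2 (mA n) fA; exists f.
exists f => g gf; apply: L2_eq0_indic => B mB fB b bE.
apply: eq0_normc; apply/eqP; rewrite eq_le normc_ge0 andbT.
apply/ler_addgt0Pr => e e0; rewrite add0r.
pose c := (e / (1 + nrm g)) ^+ 2.
have g1 : 0 < 1 + nrm g by rewrite ltr_pwDl// nrm_ge0.
have c0 : 0 < c by rewrite exprn_gt0// divr_gt0.
have [n hn] := dA B mB fB c c0.
have mD : measurable ((B `\` A n) `|` (A n `\` B)).
  by apply: measurableU; exact: measurableD.
have fA : (mu (A n) < +oo)%E.
  have mAB : measurable (B `|` (A n `\` B)).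
    by apply: measurableU => //; exact: measurableD.
  apply: (@le_lt_trans _ _ (mu (B `|` (A n `\` B)))).
    apply: le_measure; rewrite ?inE//.
    by move=> x Ax; have [Bx|nBx] := pselect (B x); [left|right].
  apply: le_lt_trans (measureU2 _ _ _) _ => //; first exact: measurableD.
  rewrite lte_add_pinfty//; apply: le_lt_trans (lt_trans hn (ltry _)).
  by apply: le_measure; rewrite ?inE//; exact: measurableD.
rewrite -[inner g b]subr0 -(gf n) -innerBr.
rewrite (le_trans (cauchy_schwarz _ _))//.
suff h : nrm (b - f n) <= e / (1 + nrm g).
  apply: (@le_trans _ _ ((1 + nrm g) * (e / (1 + nrm g)))).
    by rewrite ler_pM ?nrm_ge0// lerDr.
  by rewrite mulrCA mulfV ?gt_eqF// mulr1.
rewrite -(@ler_sqr R) ?nnegrE ?nrm_ge0//; last first.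
  by apply: divr_ge0; exact: ltW.
rewrite -/c -lee_fin -integral_nrm (le_trans _ (ltW hn))//.
rewrite le_eqVlt; apply/orP; left; apply/eqP.
rewrite -[in RHS](setIT (_ `|` _)) -integral_indic//.
apply: ae_eq_integral => //.
- exact/emeasurable_normc2/L2_cmeasurable.
- exact/measurable_EFinP/measurable_indic.
- apply: filterS3 (L2B b (f n)) bE (fE n fA) => x -> -> -> _; congr EFin.
  rewrite -(rmorphB (real_complex R)) normc_real !indicE in_setU !in_setD.
  by case: (x \in B); case: (x \in A n); rewrite /= ?subrr ?subr0 ?sub0r
    ?normrN ?normr1 ?normr0 ?expr1n ?expr0n.
Qed.

End sigma_finite_space.

(** * Logistic functions *)

(** The functions [logistic' * q(logistic)], for polynomials [q], are stable under
    differentiation, because [logistic' = logistic (1 - logistic)], and all of them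
    are dominated by [logistic'], which is integrable and vanishes at infinity. *)
Section logistic.
Context {R : realType}.
Implicit Types (x s t : R) (q : {poly R}).

Definition logistic x : R := (1 + expR (- x))^-1.

Definition logistic' x : R := logistic x * (1 - logistic x).

Lemma logistic_den_gt0 x : 0 < 1 + expR (- x).
Proof. by rewrite addr_gt0// expR_gt0. Qed.

Lemma logistic_gt0 x : 0 < logistic x.
Proof. by rewrite invr_gt0 logistic_den_gt0. Qed.

Lemma logistic_lt1 x : logistic x < 1.
Proof. by rewrite invf_lt1 ?logistic_den_gt0// ltrDl expR_gt0. Qed.

Lemma logistic'_gt0 x : 0 < logistic' x.
Proof. by rewrite mulr_gt0 ?logistic_gt0// subr_gt0 logistic_lt1. Qed.

Lemma logistic'_le1 x : logistic' x <= 1.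
Proof.
have := logistic_gt0 x; have := logistic_lt1 x; rewrite /logistic'; nra.
Qed.

Lemma is_derive_logistic x : is_derive x 1 logistic (logistic' x).
Proof.
have d0 := lt0r_neq0 (logistic_den_gt0 x).
have h : is_derive x 1 (fun y : R => 1 + expR (- y)) (- expR (- x)).
  have -> : (fun y : R => 1 + expR (- y)) = cst 1 + (expR \o -%R) by [].
  by apply: is_derive_eq; rewrite add0r mulrN1.
have := @is_deriveV _ (fun y : R => 1 + expR (- y)) x _ _ d0 h.
rewrite -/logistic scalerN -scaleNr opprK /GRing.scale/=.
rewrite (_ : _ * _ = logistic' x)// /logistic' /logistic; by field.
Qed.

(** [logistic' x] is the inverse of [2 + e^x + e^-x], and [e^|x| >= 1 + x^2 / 2]. *)
Lemma logistic'_decay x : logistic' x <= 4 * (oneDsqr x)^-1.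
Proof.
have e0 := expR_gt0 x; have eN0 := expR_gt0 (- x).
have eE : expR x * expR (- x) = 1 by rewrite -expRD subrr expR0.
have d0 := lt0r_neq0 (logistic_den_gt0 x).
have E : logistic' x = (2 + expR x + expR (- x))^-1.
  have n0 : 2 + expR x + expR (- x) != 0 by rewrite gt_eqF// !addr_gt0.
  apply: (mulIf n0); rewrite mulVf// /logistic' /logistic.
  apply: (mulIf d0); apply: (mulIf d0).
  have -> : (1 + expR (- x))^-1 * (1 - (1 + expR (- x))^-1) *
    (2 + expR x + expR (- x)) * (1 + expR (- x)) * (1 + expR (- x)) =
    expR (- x) * (2 + expR x + expR (- x)) by field.
  by rewrite !mulrDr (mulrC _ (expR x)) eE; ring.
rewrite E -[4]invrK -invfM lef_pV2 ?posrE; last 2 first.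
- by rewrite !addr_gt0.
- by rewrite mulr_gt0// ?invr_gt0// (lt_le_trans ltr01 (oneDsqr_ge1 x)).
have exp2 (y : R) : 0 <= y -> 1 + y ^+ 2 / 2 <= expR y.
  by move=> y0; exact: (@expR_ge1Dxn _ y 1 y0).
have : 1 + x ^+ 2 / 2 <= expR x + expR (- x).
  have [x0|x0] := leP 0 x; first by have := exp2 x x0; lra.
  by have := exp2 (- x); rewrite sqrrN oppr_ge0 => /(_ (ltW x0)); lra.
rewrite /oneDsqr; have := sqr_ge0 x; move: (expR x) (expR (- x)) => a b; lra.
Qed.

Lemma continuous_logistic : continuous logistic.
Proof.
by move=> x; apply/differentiable_continuous/derivable1_diffP;
  have [] := is_derive_logistic x.
Qed.

Lemma continuous_logistic' : continuous logistic'.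
Proof.
move=> x; apply: cvgM; first exact: continuous_logistic.
by apply: cvgB; [exact: cvg_cst|exact: continuous_logistic].
Qed.

Lemma integral_logistic'_lty :
  (\int[@lebesgue_measure R]_x (logistic' x)%:E < +oo)%E.
Proof.
have mo : measurable_fun [set: R] (fun x => (oneDsqr x)^-1 : R).
  by apply: continuous_measurable_fun; exact: continuous_oneDsqrV.
have ml : measurable_fun [set: R] logistic'.
  by apply: continuous_measurable_fun; exact: continuous_logistic'.
apply: (@le_lt_trans _ _ (\int[lebesgue_measure]_x (4 * (oneDsqr x)^-1)%:E)%E).
  apply: ge0_le_integral => //.
  - by move=> x _; rewrite lee_fin ltW// logistic'_gt0.
  - exact/measurable_EFinP.
  - by apply/measurable_EFinP; apply: measurable_funM.
  - by move=> x _; rewrite lee_fin logistic'_decay.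
under eq_integral do rewrite EFinM.
have o0 x : 0 <= (oneDsqr x)^-1 by rewrite invr_ge0 (le_trans _ (oneDsqr_ge1 x)).
rewrite ge0_integralZl//; last exact/measurable_EFinP.
rewrite lte_mul_pinfty// ge0_symfun_integralT//; last 2 first.
- exact: continuous_oneDsqrV.
- by move=> x; rewrite /= /oneDsqr sqrrN.
rewrite -set_itvcy integral0y_oneDsqr -EFinM; exact: ltry.
Qed.

Lemma is_derive_horner q x : is_derive x 1 (fun y => q.[logistic y])
  (q^`().[logistic x] * logistic' x).
Proof.
have H := is_derive_logistic x.
rewrite (_ : (fun _ => _) = horner q \o logistic)//.
exact: is_derive1_comp.
Qed.

(** The polynomial that encodes the derivative of the function encoded by [q]. *)
Definition dpoly q : {poly R} := (1 - 'X *+ 2) * q + 'X * (1 - 'X) * q^`().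

Definition lfun q x : R := logistic' x * q.[logistic x].

Lemma is_derive_lfun q x : is_derive x 1 (lfun q) (lfun (dpoly q) x).
Proof.
have H := is_derive_horner ('X * (1 - 'X) * q) x.
rewrite (_ : lfun q = fun y => ('X * (1 - 'X) * q).[logistic y]); last first.
  by apply/funext => y; rewrite /lfun /logistic' !hornerE.
apply: is_derive_eq; rewrite /lfun mulrC; congr (_ * _).
by rewrite !derivM derivB derivX derivC /dpoly !hornerE; ring.
Qed.

Definition bpoly q : R := \sum_(i < size q) `|q`_i|.

Lemma bpoly_ge0 q : 0 <= bpoly q.
Proof. by apply: sumr_ge0. Qed.

Lemma horner_bound q x : `|q.[logistic x]| <= bpoly q.
Proof.
rewrite horner_coef (le_trans (ler_norm_sum _ _ _))//; apply: ler_sum => i _.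
rewrite normrM normrX ler_piMr// exprn_ile1// ?normr_ge0//.
by rewrite ger0_norm ltW// ?logistic_gt0// logistic_lt1.
Qed.

Lemma lfun_bound q x : `|lfun q x| <= bpoly q * logistic' x.
Proof.
rewrite normrM mulrC (gtr0_norm (logistic'_gt0 x)).
by rewrite ler_wpM2r ?horner_bound// ltW// logistic'_gt0.
Qed.

Lemma mean_value (f df : R -> R) s t : (forall x, is_derive x 1 f (df x)) ->
  exists2 c, `|c - s| <= `|t - s| & f t - f s = df c * (t - s).
Proof.
move=> fd; have cf (a b : R) : {within `[a, b], continuous f}.
  apply: continuous_in_subspaceT => x _.
  by apply/differentiable_continuous/derivable1_diffP; have [] := fd x.
have [st|ts] := leP s t.
  have [c] := MVT_segment st (fun x _ => fd x) (cf s t).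
  rewrite in_itv/= => /andP[sc ct] E; exists c => //.
  by rewrite !ger0_norm ?subr_ge0// lerD2r.
have [c] := MVT_segment (ltW ts) (fun x _ => fd x) (cf t s).
rewrite in_itv/= => /andP[tc cs] E; exists c.
  by rewrite !ler0_norm ?subr_le0 ?(ltW ts)// !opprB lerD2l lerN2.
by rewrite -[LHS]opprB E -mulrN opprB.
Qed.

End logistic.

Section chains.
Context {R : realType}.

(** Quantitative form of smoothness with all derivatives vanishing at infinity.
    Unlike the qualitative notion, it passes to absolutely convergent series
    with no uniformity argument. *)
Definition chain (E : normedModType R[i]) (B : nat -> R) (D : nat -> R -> E) :=
  forall i, [/\ forall s : R, nrm (D i s) <= B i * logistic' s,
    forall s t : R, nrm (D i t - D i s) <= B i * `|t - s| &
    forall s h : R, nrm (D i (s + h) - D i s - h%:C *: D i.+1 s) <= B i * h ^+ 2].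

Definition lchain (q : {poly R}) (i : nat) (x : R) : R[i] :=
  (lfun (iter i dpoly q) x)%:C.

(** The mean value theorem, used twice for the second-order bound. *)
Lemma chain_lfun q : exists B, chain B (lchain q).
Proof.
pose p i := iter i dpoly q.
exists (fun i => bpoly (p i) + bpoly (p i.+1) + bpoly (p i.+2)) => i.
have b0 j : 0 <= bpoly (p j) by exact: bpoly_ge0.
have lip j s t : `|lfun (p j) t - lfun (p j) s| <= bpoly (p j.+1) * `|t - s|.
  have [c _ ->] := mean_value s t (is_derive_lfun (p j)).
  rewrite normrM ler_wpM2r// (le_trans (lfun_bound _ _))//.
  by rewrite ler_piMr ?logistic'_le1//; exact: (b0 j.+1).
split=> [s|s t|s h].
- rewrite nrmC normc_real (le_trans (lfun_bound _ _))// -/(p i).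
  by rewrite ler_wpM2r ?(ltW (logistic'_gt0 s))// -addrA lerDl addr_ge0.
- rewrite nrmC -(rmorphB (real_complex R)) normc_real (le_trans (lip i s t))//.
  by rewrite ler_wpM2r// addrAC lerDr addr_ge0.
- rewrite nrmC -[h%:C *: _]/(h%:C * lchain q i.+1 s) /lchain.
  rewrite -(rmorphM (real_complex R)) -!(rmorphB (real_complex R)) normc_real.
  have [c cs] := mean_value s (s + h) (is_derive_lfun (p i)).
  rewrite /p/= -/(p i) -/(p i.+1) => ->.
  rewrite addrAC subrr add0r in cs *.
  rewrite (mulrC h) -mulrBl normrM.
  apply: (@le_trans _ _ (bpoly (p i.+2) * `|h| * `|h|)).
    rewrite ler_wpM2r// (le_trans (lip i.+1 s c))// ler_wpM2l//.
  rewrite -mulrA -expr2 real_normK ?num_real// ler_wpM2r ?sqr_ge0//.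
  by have := b0 i; have := b0 i.+1; rewrite /p/=; lra.
Qed.


End chains.

(** * Functions with zero logistic moments *)

Section moments.
Context {R : realType}.
Local Notation leb := (@lebesgue_measure R).

Lemma bernoulli_ge (x : R) m : 0 <= x <= 1 -> 1 - m%:R * x <= (1 - x) ^+ m.
Proof.
move=> /andP[x0 x1]; elim: m => [|m IH]; first by rewrite mul0r subr0 expr0.
rewrite exprS -natr1.
have h : (1 - x) * (1 - m%:R * x) <= (1 - x) * (1 - x) ^+ m.
  by rewrite ler_wpM2l// subr_ge0.
apply: le_trans h; have m0 : (0 : R) <= m%:R by [].
have := sqr_ge0 x; nra.
Qed.

Lemma bernoulli_le (x : R) m : 0 <= x <= 1 ->
  (1 - x) ^+ m * (1 + m%:R * x) <= 1.
Proof.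
move=> /andP[x0 x1]; elim: m => [|m IH]; first by rewrite mul0r addr0 expr0 mulr1.
apply: le_trans IH; rewrite exprSr -mulrA ler_wpM2l ?exprn_ge0 ?subr_ge0//.
rewrite -natr1; have m0 : (0 : R) <= m%:R by [].
have := sqr_ge0 x; nra.
Qed.

Definition threshold (t : R) n := (Num.truncn (t ^- n)).+1.

(** The exponent [t^-n] makes [(1 - u^n)^m] tend to [1] below [t] and to [0]
    above [t]. *)
Lemma cvg_threshold (t u : R) : 0 < t < 1 -> 0 < u < 1 -> u != t ->
  (fun n => (1 - u ^+ n) ^+ threshold t n) @ \oo --> ((u < t)%R%:R : R).
Proof.
move=> /andP[t0 t1] /andP[u0 u1] ut.
have un n : 0 <= u ^+ n <= 1 by rewrite exprn_ge0 ?exprn_ile1 ?ltW.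
have tn n : 0 < t ^- n by rewrite invr_gt0 exprn_gt0.
have m1 n : t ^- n <= (threshold t n)%:R by rewrite ltW// truncnS_gt.
have m2 n : (threshold t n)%:R <= t ^- n + 1.
  by rewrite /threshold -natr1 lerD2r// truncn_le// ltW.
have le1 n : (1 - u ^+ n) ^+ threshold t n <= 1.
  by have /andP[? ?] := un n; rewrite exprn_ile1 ?subr_ge0// gerBl.
have ge0 n : 0 <= (1 - u ^+ n) ^+ threshold t n.
  by have /andP[? ?] := un n; rewrite exprn_ge0 ?subr_ge0.
have [ut'|] := ltP u t; last rewrite le_eqVlt eq_sym (negbTE ut)/= => tu.
  apply: (@squeeze_cvgr _ _ _ _ (fun n => 1 - ((u / t) ^+ n + u ^+ n)) (cst 1)).
  - apply: nearW => n; rewrite le1 andbT (le_trans _ (bernoulli_ge _ (un n)))//.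
    rewrite lerD2l lerN2 expr_div_n (le_trans (ler_wpM2r _ (m2 n)))//.
      by case/andP: (un n).
    by rewrite mulrDl mul1r mulrC.
  - rewrite -[X in _ --> X]subr0; apply: cvgB; first exact: cvg_cst.
    rewrite -[X in _ --> X]addr0; apply: cvgD; apply: cvg_expr.
      by rewrite ger0_norm ?divr_ge0 ?ltW// ltr_pdivrMr// mul1r.
    by rewrite gtr0_norm.
  - exact: cvg_cst.
apply: (@squeeze_cvgr _ _ _ _ (cst 0) (fun n => (t / u) ^+ n)).
- apply: nearW => n; rewrite ge0/=.
  have up : 0 < u ^+ n by rewrite exprn_gt0.
  have := bernoulli_le (threshold t n) (un n).
  have : (t ^- n) * u ^+ n <= 1 + (threshold t n)%:R * u ^+ n.
    by rewrite (le_trans (ler_wpM2r (ltW up) (m1 n)))// lerDr.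
  have tu0 : 0 < (t ^- n) * u ^+ n by rewrite mulr_gt0.
  move=> h1 h2; rewrite expr_div_n -[t ^+ n]invrK -invfM -[leRHS]mul1r.
  rewrite ler_pdivlMr//; apply: le_trans h2.
  by rewrite ler_wpM2l.
- exact: cvg_cst.
- by apply: cvg_expr; rewrite ger0_norm ?divr_ge0 ?ltW// ltr_pdivrMr// mul1r.
Qed.

Lemma logistic_lt (x y : R) : (logistic x < logistic y) = (x < y).
Proof.
rewrite /logistic ltf_pV2 ?posrE ?logistic_den_gt0// ltrD2l ltr_expR.
by rewrite ltrN2.
Qed.

Lemma logistic_inj : injective (@logistic R).
Proof.
by move=> x y xy; case: (ltgtP x y) => //; rewrite -logistic_lt xy ltxx.
Qed.

Lemma measurable_logistic : measurable_fun [set: R] logistic.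
Proof. by apply: continuous_measurable_fun; exact: continuous_logistic. Qed.

Section zero_moments.
Variable h : R -> R.
Hypothesis ih : leb.-integrable setT (EFin \o h).

Let mh : measurable_fun [set: R] h.
Proof. by apply/measurable_EFinP; exact: measurable_int ih. Qed.

Lemma integrable_bounded_mul (w : R -> R) (M : R) : measurable_fun [set: R] w ->
  (forall x, `|w x| <= M) -> leb.-integrable setT (EFin \o (fun x => h x * w x)).
Proof.
move=> mw wM.
have iM : leb.-integrable setT (EFin \o (fun x => M * h x)).
  rewrite (_ : _ \o _ = (fun x => M%:E * (h x)%:E)%E)//; exact: integrableZl.
apply: (le_integrable measurableT _ _ iM).
  by apply/measurable_EFinP; apply: measurable_funM.
move=> x _ /=; rewrite lee_fin !normrM mulrC ler_wpM2r//.
by rewrite (le_trans (wM x))// ler_norm.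
Qed.

Hypothesis h0 : forall k, \int[leb]_x (h x * logistic x ^+ k) = 0.

Let sum_moments (c : nat -> R) n :
  \int[leb]_x (h x * (\sum_(i < n) c i * logistic x ^+ i)) = 0.
Proof.
have lg1 k x : `|logistic x ^+ k| <= 1 :> R.
  rewrite normrX exprn_ile1// gtr0_norm ?logistic_gt0//.
  exact/ltW/logistic_lt1.
have mlg k : measurable_fun [set: R] (fun x => logistic x ^+ k).
  by apply: measurable_funX; exact: measurable_logistic.
elim: n => [|n IH].
  under eq_Rintegral do rewrite big_ord0 mulr0.
  by rewrite /Rintegral integral0.
under eq_Rintegral do rewrite big_ord_recr/= mulrDr.
rewrite RintegralD//.
- rewrite IH add0r; under eq_Rintegral do rewrite mulrCA.
  rewrite RintegralZl ?h0 ?mulr0//.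
  exact: (integrable_bounded_mul (mlg n) (lg1 n)).
- apply: (@integrable_bounded_mul _ (\sum_(i < n) `|c i|)).
    by apply: measurable_sum => i; apply: measurable_funM => //; exact: mlg.
  move=> x; rewrite (le_trans (ler_norm_sum _ _ _))//; apply: ler_sum => i _.
  by rewrite normrM ler_piMr.
- apply: (@integrable_bounded_mul _ `|c n|).
    by apply: measurable_funM => //; exact: mlg.
  by move=> x; rewrite normrM ler_piMr.
Qed.

Let poly_moments (q : {poly R}) : \int[leb]_x (h x * q.[logistic x]) = 0.
Proof. by under eq_Rintegral do rewrite horner_coef; exact: sum_moments. Qed.

Let half_line (a : R) : \int[leb]_x (h x * \1_(`]-oo, a[) x) = 0.
Proof.
have t01 (x : R) : 0 < logistic x < 1 by rewrite logistic_gt0 logistic_lt1.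
pose q n : {poly R} := (1 - 'X^n) ^+ threshold (logistic a) n.
have qE n x : (q n).[logistic x] =
    (1 - logistic x ^+ n) ^+ threshold (logistic a) n.
  by rewrite /q horner_exp !hornerE.
have mq n : measurable_fun [set: R] (fun x => (q n).[logistic x]).
  under eq_fun do rewrite qE; apply: measurable_funX.
  apply: measurable_funB; first exact: measurable_cst.
  by apply: measurable_funX; exact: measurable_logistic.
pose f_ n (x : R) := (h x * (q n).[logistic x])%:E.
have mI : measurable (`]-oo, a[%classic : set R) by exact: measurable_itv.
have [|||||_ _] := @dominated_convergence _ _ _ leb setT measurableT f_
  (fun x => (h x * \1_(`]-oo, a[) x)%:E) (fun x => `|(h x)%:E|%E).
- by move=> n; have mqn := mq n; apply/measurable_EFinP; apply: measurable_funM.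
- by apply/measurable_EFinP; apply: measurable_funM.
- exists [set a]; split; [exact: measurable_set1|exact: lebesgue_measure_set1|].
  move=> x /= nx; apply: contrapT => /eqP xa; apply: nx => _.
  apply: cvg_EFin; first exact: nearW.
  apply: cvgM; first exact: cvg_cst.
  rewrite /= indicE; under eq_fun do rewrite qE.
  have -> : (x \in `]-oo, a[%classic) = (logistic x < logistic a).
    by rewrite logistic_lt mem_setE in_itv.
  by apply: cvg_threshold => //; rewrite (inj_eq logistic_inj).
- exact: integrable_abse.
- apply: aeW => x n _; rewrite /f_ /= lee_fin normrM ler_piMr//.
  have /andP[l0 l1] := t01 x.
  have ln : 0 <= logistic x ^+ n <= 1 by rewrite exprn_ge0 ?exprn_ile1 ?ltW.
  have /andP[n0 n1] := ln.
  rewrite qE normrX exprn_ile1// ger0_norm ?subr_ge0// gerBl//.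
move=> hc; rewrite /Rintegral.
have c0 : (fun n => \int[leb]_x f_ n x)%E @ \oo --> 0%E.
  apply: cvg_near_cst; apply: nearW => n.
  have := poly_moments (q n); rewrite /Rintegral => E.
  rewrite -[LHS]fineK ?E// integrable_fin_num//.
  apply: (@integrable_bounded_mul _ 1) => // x.
  have /andP[l0 l1] := t01 x.
  have ln : 0 <= logistic x ^+ n <= 1 by rewrite exprn_ge0 ?exprn_ile1 ?ltW.
  have /andP[n0 n1] := ln.
  by rewrite qE normrX exprn_ile1// ger0_norm ?subr_ge0// gerBl.
by rewrite (cvg_unique _ hc c0).
Qed.

(** Polynomials in [logistic] approximate the indicators of half-lines, and
    those generate the Borel sets. *)
Lemma zero_moments E : measurable E -> \int[leb]_x (h x * \1_E x) = 0.
Proof.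
have iE (F : set R) : measurable F ->
    leb.-integrable setT (EFin \o (fun x => h x * \1_F x)).
  move=> mF; apply: (@integrable_bounded_mul _ 1); first exact: measurable_indic.
  by move=> x; rewrite indicE; case: (x \in F); rewrite ?normr0 ?normr1.
have hT : \int[leb]_x h x = 0.
  by rewrite -[RHS](h0 0); apply: eq_Rintegral => x _; rewrite expr0 mulr1.
move=> mE; move: (mE); rewrite RGenInftyO.measurableE; move: {mE} E.
have := @dynkin_induction _ _ (@RGenInftyO.G R)
  (fun E => \int[leb]_x (h x * \1_E x) = 0)
  (@RGenInftyO.measurableE R); apply.
- move=> _ _ [x ->] [y ->]; exists (Num.min x y).
  apply/seteqP; split=> z /=; rewrite !in_itv/= lt_min.
    by move=> [-> ->].
  by move=> /andP[-> ->].
- by under eq_Rintegral do rewrite indicT mulr1.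
- by move=> _ [x ->]; exact: half_line.
- move=> S mS S0.
  have E x : h x * \1_(~` S) x = h x - h x * \1_S x.
    by rewrite !indicE in_setC; case: (x \in S);
      rewrite ?mulr1 ?mulr0 ?subrr ?subr0.
  under eq_Rintegral do rewrite E.
  by rewrite RintegralB//; [rewrite S0 hT subrr|exact: iE].
- move=> F mF tF F0.
  have FP (G : set R) : (fun x => (h x * \1_G x)%:E) = (EFin \o h) \_ G.
    by apply/funext => x; rewrite patchE indicE; case: (x \in G);
      rewrite /= ?mulr1 ?mulr0.
  have iF (G : set R) : measurable G -> leb.-integrable G (EFin \o h).
    by move=> mG; exact: integrableS ih.
  rewrite /Rintegral FP -integral_mkcond integral_bigcup//.
    rewrite eseries0// => n _ _.
    have := F0 n; rewrite /Rintegral FP -integral_mkcond => E'.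
    have fin : (\int[leb]_(x in F n) (EFin \o h) x)%E \is a fin_num.
      by apply: integrable_fin_num; [exact: mF|exact: iF (mF n)].
    by rewrite -(fineK fin) E'.
  by apply: iF; exact: bigcup_measurable.
Qed.

End zero_moments.
End moments.

(** * A basis of smooth functions on the line *)

Section chain_theory.
Context {R : realType}.
Implicit Types E : normedModType R[i].
Local Notation leb := (@lebesgue_measure R).

Lemma chain_ge0 E B (D : nat -> R -> E) i : chain B D -> 0 <= B i.
Proof.
move=> /(_ i)[_ /(_ 0 1)/(le_trans (nrm_ge0 _)) + _].
by rewrite subr0 normr1 mulr1.
Qed.

Lemma chainDZ E (a : R[i]) B B' (D D' : nat -> R -> E) :
  chain B D -> chain B' D' ->
  chain (fun i => normc a * B i + B' i) (fun i s => a *: D i s + D' i s).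
Proof.
move=> hD hD' i; have [d1 d2 d3] := hD i; have [e1 e2 e3] := hD' i.
have comb (x y : E) (b c w : R) : nrm x <= b * w -> nrm y <= c * w ->
    nrm (a *: x + y) <= (normc a * b + c) * w.
  move=> hx hy; rewrite (le_trans (nrmD _ _))// nrmZ mulrDl lerD//.
  by rewrite -mulrA ler_wpM2l// normc_ge0.
split=> [s|s t|s h]; first exact: comb.
  rewrite opprD addrACA -scalerBr; exact: comb.
rewrite (_ : _ - _ - _ = a *: (D i (s + h) - D i s - h%:C *: D i.+1 s) +
  (D' i (s + h) - D' i s - h%:C *: D' i.+1 s)); first exact: comb.
rewrite !scalerBr !scalerDr !scalerA (mulrC a) !opprD !addrA.
by rewrite -!(addrAC _ (- (a *: D i s))) -!(addrAC _ (- (_ *: D i.+1 s))).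
Qed.

Lemma chain_conj B (D : nat -> R -> R[i]) : chain B D ->
  chain B (fun i s => cj (D i s)).
Proof.
have nc (z : R[i]) : nrm (cj z) = nrm z by rewrite !nrmC normc_conj.
move=> hD i; have [d1 d2 d3] := hD i; split=> [s|s t|s h].
- by rewrite nc.
- by rewrite -rmorphB/= nc.
- rewrite -[h%:C *: _]/(h%:C * _) -(cj_real h) -rmorphM/= -!rmorphB/= nc.
  exact: d3.
Qed.

Lemma lipschitz_continuous E (f : R -> E) (B : R) :
  (forall s t, nrm (f t - f s) <= B * `|t - s|) -> continuous f.
Proof.
move=> fB x; apply/cvg_nrmP => e e0; apply/nbhs_ballP.
have B1 : 0 < 1 + `|B| by rewrite ltr_pwDl.
exists (e / (1 + `|B|)); first by rewrite /= divr_gt0.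
move=> y /=; rewrite /ball/= ltr_pdivlMr// => xy.
rewrite (le_lt_trans (fB y x))// (le_lt_trans _ xy)// mulrC ler_wpM2l//.
by rewrite (le_trans (ler_norm _))// lerDr.
Qed.

Lemma logistic'_small (e : R) : 0 < e ->
  exists2 M : R, 0 < M & forall x, M < `|x| -> logistic' x < e.
Proof.
move=> e0; exists (4 / e + 1); first by rewrite addr_gt0// divr_gt0.
move=> x Mx; rewrite (le_lt_trans (logistic'_decay x))//.
have o0 : 0 < oneDsqr x by rewrite (lt_le_trans ltr01 (oneDsqr_ge1 x)).
rewrite ltr_pdivrMr// mulrC -ltr_pdivrMr// /oneDsqr.
have d0 : 0 < 4 / e by rewrite divr_gt0.
have -> : x ^+ 2 = `|x| ^+ 2 by rewrite real_normK ?num_real.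
move: Mx d0; move: (4 / e) (`|x|) => p q; nra.
Qed.

Lemma chain_is_sderive E B (D : nat -> R -> E) i : chain B D ->
  is_sderive (D i) (D i.+1).
Proof.
move=> hD s; have Bi := chain_ge0 i hD; have [_ _ d3] := hD i.
apply/cvg_nrmP => e e0.
have B1 : 0 < 1 + B i by rewrite ltr_pwDl.
have de : 0 < e / (1 + B i) by rewrite divr_gt0.
near=> h; have h0 : h != 0 by near: h; exact: nbhs_dnbhs_neq.
have hd : `|h| < e / (1 + B i) by near: h; exact: dnbhs0_lt.
have [_ _ CM _] := @realC_morph R.
have -> : D i.+1 s - h^-1%:C *: (D i (s + h) - D i s) =
    - (h^-1%:C *: (D i (s + h) - D i s - h%:C *: D i.+1 s)).
  by rewrite [in RHS]scalerBr scalerA -CM mulVf// scale1r opprB.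
rewrite nrmN nrmZ normc_real normfV mulrC ltr_pdivrMr ?normr_gt0//.
apply: le_lt_trans (d3 s h) _; rewrite -(real_normK (num_real h)) expr2 mulrA.
rewrite ltr_pM2r ?normr_gt0//; move: hd; rewrite ltr_pdivlMr// mulrC.
by apply: le_lt_trans; rewrite ler_wpM2r// lerDr.
Unshelve. all: by end_near. Qed.

Lemma chain_C0 E B (D : nat -> R -> E) i : chain B D -> C0 (D i).
Proof.
move=> hD; have Bi := chain_ge0 i hD; have [d1 d2 _] := hD i; split.
  exact: lipschitz_continuous d2.
move=> e e0; have B1 : 0 < 1 + B i by rewrite ltr_pwDl.
have [M M0 hM] := logistic'_small (divr_gt0 e0 B1).
exists `[- M, M]%classic; first exact: segment_compact.
move=> x /= xM; rewrite nrmE ltcR (le_lt_trans (d1 x))//.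
have {}xM : M < `|x|.
  rewrite ltNge; apply/negP => xM'; apply: xM.
  by rewrite in_itv/= -ler_norml.
have := hM x xM; rewrite ltr_pdivlMr// mulrC; apply: le_lt_trans.
by rewrite ler_wpM2r ?(ltW (logistic'_gt0 x))// lerDr.
Qed.

Lemma chain_C0_smooth E B (D : nat -> R -> E) : chain B D -> C0_smooth (D 0%N).
Proof.
move=> hD; exists D; split=> // i; [exact: chain_is_sderive hD|exact: chain_C0 hD].
Qed.

Lemma chain_cmeasurable B (D : nat -> R -> R[i]) i : chain B D ->
  cmeasurable (D i : measurableTypeR R -> R[i]).
Proof.
move=> hD; have [_ d2 _] := hD i.
have real (u : R[i] -> R) : (forall z w, u (z - w) = u z - u w) ->
    (forall z, `|u z| <= normc z) -> measurable_fun [set: R] (u \o D i).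
  move=> uB un; apply: continuous_measurable_fun => x.
  apply/cvgrPdist_lt => e e0.
  have cD : D i y @[y --> (x : R)] --> D i x := lipschitz_continuous d2 (x := x).
  have /cvg_nrmP/(_ _ e0) := cD.
  apply: filterS => y; apply: le_lt_trans.
  by rewrite /= -uB nrmC.
split; apply: real => *; rewrite ?raddfB//;
  by [exact: ler_Re_normc|exact: ler_Im_normc].
Qed.

Lemma integral_scaled_logistic' (b : R) :
  (\int[leb]_x (b ^+ 2 * logistic' x)%:E < +oo)%E.
Proof.
have ml : measurable_fun [set: R] (fun x => logistic' x).
  by apply: continuous_measurable_fun; exact: continuous_logistic'.
under eq_integral do rewrite EFinM.
have -> : (\int[leb]_x ((b ^+ 2)%:E * (logistic' x)%:E) =
    (b ^+ 2)%:E * \int[leb]_x (logistic' x)%:E)%E.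
  apply: ge0_integralZl => //; first exact/measurable_EFinP.
    by move=> x _; rewrite lee_fin ltW// logistic'_gt0.
  by rewrite lee_fin sqr_ge0.
rewrite lte_mul_pinfty ?lee_fin ?sqr_ge0//; exact: integral_logistic'_lty.
Qed.

Lemma chain_sqint B (D : nat -> R -> R[i]) i : chain B D ->
  (D i : measurableTypeR R -> R[i]) \in sqint leb.
Proof.
move=> hD; have Bi := chain_ge0 i hD; have [d1 _ _] := hD i.
have mD := chain_cmeasurable i hD.
have ml : measurable_fun [set: R] (fun x => logistic' x).
  by apply: continuous_measurable_fun; exact: continuous_logistic'.
have l0 x : 0 <= logistic' x :> R by exact/ltW/logistic'_gt0.
apply/sqintP; split=> //.
apply: (@le_lt_trans _ _ (\int[leb]_x (B i ^+ 2 * logistic' x)%:E)%E).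
  apply: ge0_le_integral => //.
  - by move=> x _; rewrite lee_fin sqr_ge0.
  - exact: emeasurable_normc2.
  - by apply/measurable_EFinP; apply: measurable_funM.
  - move=> x _; rewrite lee_fin (@le_trans _ _ ((B i * logistic' x) ^+ 2))//.
      rewrite ler_sqr ?nnegrE ?normc_ge0 ?(mulr_ge0 Bi (l0 x))//.
      by have := d1 x; rewrite nrmC.
    rewrite exprMn ler_wpM2l ?sqr_ge0// expr2 ler_piMr//.
    exact: logistic'_le1.
exact: integral_scaled_logistic'.
Qed.

Definition smooth_class (f : L2 leb) := exists B D,
  chain B D /\ {ae leb, forall x, f x = D 0%N x}.

Lemma subspace_smooth_class : is_subspace smooth_class.
Proof.
split.
  exists (fun=> 0), (fun _ _ => 0); split; last exact: L2_0.
  move=> i; split=> *; rewrite ?subrr ?scaler0 ?subr0 nrm0 mul0r//.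
move=> a f g [B [D [hD fD]]] [B' [D' [hD' gD]]].
eexists _, _; split; first exact: (chainDZ a hD hD').
have E1 := L2D (a *: f) g; have E2 := L2Z a f.
near=> x; rewrite (near E1 x)// (near E2 x)// (near fD x)// (near gD x)//.
Unshelve. all: by end_near. Qed.

(** Orthogonality of [f] to [logistic' * logistic^k] for all [k] says that
    [f * logistic'] has zero moments. *)
Lemma smooth_total : exists2 g : nat -> L2 leb,
  total_system g & forall k, smooth_class (g k).
Proof.
have /choice[g gP] : forall k, exists g : L2 leb,
    {ae leb, forall x, g x = lchain 'X^k 0 x}.
  move=> k; have [B hB] := chain_lfun ('X^k : {poly R}).
  by exists (toL2 (chain_sqint 0 hB)); exact: toL2E.
exists g => [f fg|k]; last first.
  have [B hB] := chain_lfun ('X^k : {poly R}).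
  by exists B, (lchain 'X^k); split.
have [B hB] := chain_lfun (1 : {poly R}).
pose w (x : R) : R[i] := (logistic' x)%:C.
have wE : w = lchain 1 0.
  by apply/funext => x; rewrite /lchain/= /lfun hornerE mulr1.
have sw : (w : measurableTypeR R -> R[i]) \in sqint leb.
  by rewrite wE; exact: chain_sqint.
have ifw : cintegrable leb (fun x => f x * w x).
  exact: cintegrableM (L2_sqint f) sw.
have mf := L2_cmeasurable f.
have mw := sqint_cmeasurable sw.
have mfw : cmeasurable (fun x => f x * w x) by exact: cmeasurableM.
have mom k : cintegral leb (fun x => f x * w x * (logistic x ^+ k)%:C) = 0.
  rewrite -(fg k) /inner; apply: eq_ae_cintegral.
  - apply: cmeasurableM => //; split; last exact: measurable_cst.
    by apply: measurable_funX; exact: measurable_logistic.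
  - exact: cmeasurable_inner.
  - apply: filterS (gP k) => x ->.
    have [_ _ CM _] := @realC_morph R.
    by rewrite cj_real /lchain/= /lfun hornerXn CM mulrA.
have ReC (z : R[i]) (c : R) : complex.Re (z * c%:C) = complex.Re z * c.
  by case: z => a b /=; rewrite mulr0 subr0.
have ImC (z : R[i]) (c : R) : complex.Im (z * c%:C) = complex.Im z * c.
  by case: z => a b /=; rewrite mulr0 add0r.
have [iR iI] := ifw.
have fw0 : {ae leb, forall x, setT x -> f x * w x = 0}.
  apply: ae_zero_on => //.
    rewrite (_ : (fun _ => _) = (fun x => f x * w x))//.
    by apply/funext => x; rewrite indicT mulr1.
  move=> E mE _; apply/eqP; rewrite eq_complex/=; apply/andP; split; apply/eqP.
    under eq_Rintegral do rewrite ReC.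
    apply: zero_moments => // k.
    have /(congr1 (@complex.Re R))/= <- := mom k.
    by apply: eq_Rintegral => x _; rewrite [RHS]ReC.
  under eq_Rintegral do rewrite ImC.
  apply: zero_moments => // k.
  have /(congr1 (@complex.Im R))/= <- := mom k.
  by apply: eq_Rintegral => x _; rewrite [RHS]ImC.
apply/L2P; apply: filterS2 fw0 (L2_0 leb) => x /(_ I)/eqP fwx ->.
move: fwx; rewrite mulf_eq0 => /orP[/eqP//|].
rewrite /w => /eqP/complexI/eqP; by rewrite gt_eqF// logistic'_gt0.
Qed.

Lemma lebesgue_infinite_dim : infinite_dim leb.
Proof.
apply: (@disjoint_infinite_dim _ _ _ leb (fun n => `[n%:R, n.+1%:R[%classic)).
- by move=> n; exact: measurable_itv.
- move=> n; suff F : (0 < lebesgue_measure [set` `[n%:R : R, n.+1%:R[%R] < +oo)%E.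
    exact: F.
  rewrite lebesgue_measure_itv/= lte_fin ltr_nat leqnn -EFinB.
  by rewrite -natr1 addrAC subrr add0r lte01 ltry.
- move=> i j; wlog ij : i j / (i < j)%N => [h|_].
    rewrite neq_ltn => /orP[ij|ji]; first by apply: h; rewrite ?ltn_eqF.
    by rewrite setIC; apply: h; rewrite ?ltn_eqF.
  apply/seteqP; split=> // x []/=; rewrite !in_itv/= => /andP[_ xi] /andP[jx _].
  have := le_lt_trans jx xi; rewrite ltr_nat ltnS leqNgt ij//.
Qed.

Lemma smooth_basis : exists (u : nat -> L2 leb) (B : nat -> nat -> R)
    (D : nat -> nat -> R -> R[i]),
  [/\ orthonormal_system u, total_system u, forall n, chain (B n) (D n) &
      forall n, {ae leb, forall x, u n x = D n 0%N x}].
Proof.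
have [g gt gs] := smooth_total.
have [u [uo ut _ us]] :=
  gram_schmidt gt lebesgue_infinite_dim subspace_smooth_class gs.
have /choice[B hB] := us; have /choice[D hD] := hB.
by exists u, B, D; split=> // n; have [] := hD n.
Qed.

End chain_theory.

(** * Series of smooth functions *)

Section chain_series.
Context {R : realType}.
Implicit Types E : normedModType R[i].

(** Each of the three bounds of a chain is an inequality between norms of linear
    expressions, so it holds for partial sums and passes to the limit. *)
Lemma chain_series E (Bc : nat -> nat -> R) (c : nat -> nat -> R -> R[i])
    (v : nat -> E) (b : nat -> R) :
  abs_complete E -> (forall m, chain (Bc m) (c m)) ->
  (forall i, summable_by (fun m => Bc m i * nrm (v m)) (b i)) ->
  exists2 F : nat -> R -> E, chain b F &
    forall i s, psum (fun m => c m i s *: v m) @ \oo --> F i s.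
Proof.
move=> cE hc hb.
have bound i (w : nat -> R[i]) (r : R) (x : E) : 0 <= r ->
    (forall m, nrm (w m) <= Bc m i * r) ->
    psum (fun m => w m *: v m) @ \oo --> x -> nrm x <= b i * r.
  move=> r0 hw hx; apply: le_nrm_lim hx _ => N.
  rewrite (le_trans (nrm_sum _ _ _))//.
  apply: (@le_trans _ _ ((\sum_(m < N) Bc m i * nrm (v m)) * r)).
    rewrite mulr_suml; apply: ler_sum => m _.
    by rewrite nrmZ mulrAC ler_wpM2r ?nrm_ge0// -nrmC.
  by rewrite ler_wpM2r//; exact: hb.
have l0 s : 0 <= logistic' s :> R by exact/ltW/logistic'_gt0.
have /choice[F hF] : forall i, exists Fi : R -> E,
    forall s, psum (fun m => c m i s *: v m) @ \oo --> Fi s.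
  move=> i; suff /choice[Fi hFi] : forall s, exists x : E,
    psum (fun m => c m i s *: v m) @ \oo --> x by exists Fi.
  move=> s; apply: cE; exists (b i * logistic' s) => N.
  apply: (@le_trans _ _ ((\sum_(m < N) Bc m i * nrm (v m)) * logistic' s)).
    rewrite mulr_suml; apply: ler_sum => m _.
    have [d1 _ _] := hc m i.
    by rewrite nrmZ mulrAC ler_wpM2r ?nrm_ge0// -nrmC.
  by rewrite ler_wpM2r//; exact: hb.
exists F => // i; split=> [s|s t|s h].
- apply: (bound _ (fun m => c m i s)) => // m; by have [] := hc m i.
- apply: (bound _ (fun m => c m i t - c m i s)) => // [m|].
    by have [] := hc m i.
  have := psumD (hF i t) (psumZ (a := -1) (hF i s)); rewrite scaleN1r.
  by under eq_fun do rewrite scaleN1r -scalerBl.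
- apply: (bound _ (fun m => c m i (s + h) - c m i s - h%:C * c m i.+1 s)).
  + exact: sqr_ge0.
  + by move=> m; have [] := hc m i.
  have := psumD (psumD (hF i (s + h)) (psumZ (a := -1) (hF i s)))
    (psumZ (a := - h%:C) (hF i.+1 s)).
  rewrite scaleN1r scaleNr.
  by under eq_fun do rewrite scaleN1r -scalerBl scaleNr scalerA -scalerBl.
Qed.

(** [rho n] is divided by the sum of the bounds [B k i] with [k, i <= n], so that
    for a fixed order [i] all terms from [n = i] on are at most [2^-n]. *)
Lemma weights (B : nat -> nat -> R) : (forall n i, 0 <= B n i) ->
  exists (rho kap : nat -> R), [/\ forall n, 0 < rho n,
    forall m n, (m <= n)%N -> rho n <= rho m,
    forall i, summable_by (fun n => B n i * rho n) (kap i) &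
    summable_by rho 2].
Proof.
move=> B0.
pose S n := 1 + \sum_(k < n.+1) \sum_(i < n.+1) B k i.
have sB m : 0 <= \sum_(k < m) \sum_(i < m) B k i.
  by apply: sumr_ge0 => k _; apply: sumr_ge0.
have S1 n : 1 <= S n by rewrite lerDl.
have S0 n : 0 < S n by exact: lt_le_trans (S1 n).
have BS n i : (i <= n)%N -> B n i <= S n.
  move=> ni; rewrite /S big_ord_recr/=.
  rewrite (bigD1 (inord i : 'I_n.+1))//= inordK ?ltnS//.
  have : 0 <= \sum_(k < n) \sum_(j < n.+1) B k j.
    by apply: sumr_ge0 => k _; exact: sumr_ge0.
  have : 0 <= \sum_(j < n.+1 | j != inord i) B n j by exact: sumr_ge0.
  lra.
have Smon n : S n <= S n.+1.
  rewrite /S lerD2l [leRHS]big_ord_recr/= -[leLHS]addr0 lerD//; last exact: sumr_ge0.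
  by apply: ler_sum => k _; rewrite [leRHS]big_ord_recr/= lerDl.
pose rho n := (2^-1 : R) ^+ n / S n.
have h0 n : 0 < (2^-1 : R) ^+ n by rewrite exprn_gt0.
have rho0 n : 0 < rho n by rewrite divr_gt0.
have rhoh n : rho n <= 2^-1 ^+ n by rewrite ler_pdivrMr// ler_peMr// ltW.
exists rho, (fun i => \sum_(n < i) B n i * rho n + 2); split=> //.
- move=> m n mn; rewrite -(subnK mn); elim: (n - m)%N => [//|k IH].
  rewrite addSn; apply: le_trans IH.
  apply: ler_pM; rewrite ?invr_ge0 ?(ltW (h0 _)) ?(ltW (S0 _))//.
    by rewrite exprS ler_piMl ?(ltW (h0 _))// invf_le1// ler1n.
  by rewrite lef_pV2 ?posrE.
- move=> i N; have [Ni|iN] := leqP N i.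
    rewrite -(subnKC Ni) big_split_ord/= -addrA lerDl addr_ge0//.
    by apply: sumr_ge0 => k _; rewrite mulr_ge0// ltW.
  rewrite -(subnKC (ltnW iN)) big_split_ord/= lerD2l.
  apply: le_trans (geo_half R (N - i)); apply: ler_sum => k _.
  have : B (i + k)%N i * rho (i + k)%N <= 2^-1 ^+ (i + k).
    rewrite mulrCA ler_piMr ?(ltW (h0 _))// ler_pdivrMr// mul1r BS ?leq_addr//.
  move/le_trans; apply; rewrite exprD ler_piMl ?(ltW (h0 _))//.
  by rewrite exprn_ile1// invf_le1// ler1n.
- move=> N; apply: le_trans (geo_half R N); apply: ler_sum => k _; exact: rhoh.
Qed.

End chain_series.

(** * Smooth kernels and operators of Mercer type *)

Lemma cmeasurable_comp d1 d2 (T1 : measurableType d1) (T2 : measurableType d2)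
    (R : realType) (f : T2 -> R[i]) (g : T1 -> T2) :
  cmeasurable f -> measurable_fun setT g -> cmeasurable (fun x => f (g x)).
Proof.
move=> [mR mI] mg; split.
  exact: (measurableT_comp mR mg).
exact: (measurableT_comp mI mg).
Qed.

Lemma psum_conj (R : realType) (z : nat -> R[i]) (l : R[i]) :
  psum z @ \oo --> l -> psum (fun n => cj (z n)) @ \oo --> cj l.
Proof.
move=> /cvgn_nrmP h; apply/cvgn_nrmP => e /h[N hN]; exists N => n /hN.
by rewrite /psum -(rmorph_sum Num.conj) -rmorphB/= !nrmC normc_conj.
Qed.

Section kernels.
Context {R : realType}.
Local Notation leb := (@lebesgue_measure R).
Variables (u : nat -> L2 leb) (B : nat -> nat -> R) (D : nat -> nat -> R -> R[i]).
Variables (rho kap : nat -> R).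
Hypotheses (uo : orthonormal_system u) (ut : total_system u).
Hypothesis hD : forall n, chain (B n) (D n).
Hypothesis uD : forall n, {ae leb, forall x, u n x = D n 0%N x}.
Hypothesis rho0 : forall n, 0 < rho n.
Hypothesis hkap : forall i, summable_by (fun n => B n i * rho n) (kap i).
Hypothesis hrho : summable_by rho 2.
Implicit Types (A P : L2 leb -> L2 leb) (G : R * R -> R[i]).

Definition coef A n m : R[i] := inner (A (u m)) (u n).

Definition matrix_bound A (C : R) := 0 <= C /\
  forall n m, normc (coef A n m) <= C * (rho n * rho m).

(** [c m] is the continuous representative of [A (u m)]. *)
Definition kernel_of A G := exists c : nat -> R -> R[i],
  (forall m s, psum (fun n => D n 0%N s *: coef A n m) @ \oo --> c m s) /\
  forall s y, psum (fun m => c m s * cj (D m 0%N y)) @ \oo --> G (s, y).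

Lemma kernel_ofB A A' G G' (lam : R[i]) : linear A -> linear A' ->
  kernel_of A G -> kernel_of A' G' ->
  kernel_of (fun f => A f - lam *: A' f) (fun z => G z - lam * G' z).
Proof.
move=> Al A'l [c [hc hG]] [c' [hc' hG']].
exists (fun m s => c m s - lam * c' m s); split=> [m s|s y].
  have := psumD (hc m s) (psumZ (a := - lam) (hc' m s)).
  rewrite scaleNr; apply: cvg_trans; apply: near_eq_cvg; apply: nearW => N.
  apply: eq_bigr => n _; rewrite /coef innerBl innerZl.
  by rewrite scaleNr scalerBr scalerA mulrC -scalerA.
have := psumD (hG s y) (psumZ (a := - lam) (hG' s y)).
rewrite scaleNr; apply: cvg_trans; apply: near_eq_cvg; apply: nearW => N.
apply: eq_bigr => m _.
by rewrite -[- lam *: _]/(- lam * _) mulNr mulrBl mulrA.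
Qed.

Let l0 (s : R) : 0 <= logistic' s. Proof. exact/ltW/logistic'_gt0. Qed.

Section one_operator.
Variables (A : L2 leb -> L2 leb) (C : R).
Hypotheses (Ab : bounded_op A) (AC : matrix_bound A C).

Let Cge0 : 0 <= C. Proof. by case: AC. Qed.

Let kap0 i : 0 <= kap i.
Proof. by have := hkap i 0; rewrite big_ord0. Qed.

Let B0 n i : 0 <= B n i. Proof. exact: chain_ge0 (hD n). Qed.

Lemma columns : exists c : nat -> nat -> R -> R[i],
  (forall m, chain (fun i => kap i * (C * rho m)) (c m)) /\
  forall m i s, psum (fun n => D n i s *: coef A n m) @ \oo --> c m i s.
Proof.
suff /choice[c hc] : forall m, exists c : nat -> R -> R[i],
    chain (fun i => kap i * (C * rho m)) c /\
    forall i s, psum (fun n => D n i s *: coef A n m) @ \oo --> c i s.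
  by exists c; split=> [m|m]; [case: (hc m)|case: (hc m)].
move=> m; have [|c h1 h2] := @chain_series _ _ B D (fun n => coef A n m)
  (fun i => kap i * (C * rho m)) (@abs_complete_C R) hD.
  move=> i N; apply: (@le_trans _ _ ((\sum_(n < N) B n i * rho n) * (C * rho m))).
    rewrite mulr_suml; apply: ler_sum => n _.
    rewrite -mulrA ler_wpM2l// nrmC mulrCA.
    by have [_] := AC.
  by rewrite ler_wpM2r ?mulr_ge0 ?(ltW (rho0 m))//; exact: hkap.
by exists c.
Qed.

Lemma ae_abs_series (v : nat -> L2 leb) (f : L2 leb) (K : R) :
  psum v @ \oo --> f -> summable_by (fun n => nrm (v n)) K ->
  {ae leb, forall x, psum (fun n => v n x) @ \oo --> f x}.
Proof.
by move=> vf /L2_abs_series[g vg]; rewrite (nrm_cvg_unique vf vg).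
Qed.

Variables (c : nat -> nat -> R -> R[i]).
Hypothesis hc : forall m, chain (fun i => kap i * (C * rho m)) (c m).
Hypothesis hcA : forall m i s,
  psum (fun n => D n i s *: coef A n m) @ \oo --> c m i s.

Lemma nrm_column m : nrm (A (u m)) <= 2 * (C * rho m) /\
  {ae leb, forall s, A (u m) s = c m 0%N s}.
Proof.
have ex : psum (fun n => coef A n m *: u n) @ \oo --> A (u m).
  exact: (expansion uo ut (f := A (u m))).
have sm N : \sum_(n < N) nrm (coef A n m *: u n) <= 2 * (C * rho m).
  apply: (@le_trans _ _ ((\sum_(n < N) rho n) * (C * rho m))).
    rewrite mulr_suml; apply: ler_sum => n _.
    rewrite nrmZ (nrm_orthonormal uo) mulr1 mulrCA; by have [_] := AC.
  by rewrite ler_wpM2r ?mulr_ge0 ?(ltW (rho0 m)).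
split.
  by apply: le_nrm_lim ex _ => N; rewrite (le_trans (nrm_sum _ _ _)).
have E1 := ae_abs_series ex sm.
have /ae_foralln E2 : forall n, {ae leb, forall x,
    (coef A n m *: u n : L2 leb) x = D n 0%N x *: coef A n m}.
  by move=> n; apply: filterS2 (L2Z (coef A n m) (u n)) (uD n) => x -> ->;
    rewrite mulrC.
apply: filterS2 E1 E2 => x hx Ex.
have E : (fun n => (coef A n m *: u n : L2 leb) x) =
  (fun n => D n 0%N x *: coef A n m) by apply/funext => n; exact: Ex.
by rewrite E in hx; exact: nrm_cvg_unique hx (@hcA m 0%N x).
Qed.

(** The same double series is a chain in each variable: in [s] with the values
    at [y] as coefficients, and conversely. *)
Lemma row_chain j (y : R) : exists2 F : nat -> R -> R[i],
  chain (fun i => kap i * (C * (kap j * logistic' y))) F &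
  forall i s, psum (fun m => c m i s * cj (D m j y)) @ \oo --> F i s.
Proof.
apply: (@chain_series _ _ (fun m i => kap i * (C * rho m)) c
  (fun m => cj (D m j y))) => //; first exact: abs_complete_C.
move=> i N.
apply: (@le_trans _ _ (\sum_(m < N) (B m j * rho m) * (kap i * (C * logistic' y)))).
  apply: ler_sum => m _; rewrite nrmC normc_conj -nrmC.
  have [/(_ y) d1 _ _] := hD m j.
  rewrite [leRHS](_ : _ = kap i * (C * rho m) * (B m j * logistic' y)); last ring.
  by rewrite ler_wpM2l// !mulr_ge0 ?(ltW (rho0 m)).
rewrite -mulr_suml.
rewrite [leRHS](_ : _ = kap j * (kap i * (C * logistic' y))); last ring.
by rewrite (ler_wpM2r (mulr_ge0 (kap0 i) (mulr_ge0 Cge0 (l0 y))))//; exact: hkap.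
Qed.

Lemma col_chain i (s : R) : exists2 F : nat -> R -> R[i],
  chain (fun j => kap j * (C * (kap i * logistic' s))) F &
  forall j y, psum (fun m => c m i s * cj (D m j y)) @ \oo --> F j y.
Proof.
have := @chain_series _ R[i] B (fun m j y => cj (D m j y)) (fun m => c m i s)
  (fun j => kap j * (C * (kap i * logistic' s))) (@abs_complete_C R).
move=> [|j N|F hF FE]; first by move=> m; exact: chain_conj.
  apply: (@le_trans _ _ (\sum_(m < N) (B m j * rho m) * (C * (kap i * logistic' s)))).
    apply: ler_sum => m _; have [/(_ s) d1 _ _] := hc m i.
    rewrite [leRHS](_ : _ = B m j * (kap i * (C * rho m) * logistic' s)); last ring.
    by rewrite ler_wpM2l.
  rewrite -mulr_suml.
  by rewrite (ler_wpM2r (mulr_ge0 Cge0 (mulr_ge0 (kap0 i) (l0 s))))//; exact: hkap.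
exists F => // j y; have := FE j y; apply: cvg_trans; apply: near_eq_cvg.
by apply: nearW => N; apply: eq_bigr => m _; rewrite mulrC.
Qed.

Variable G : nat -> nat -> R * R -> R[i].
Hypothesis hG : forall i j s y,
  psum (fun m => c m i s * cj (D m j y)) @ \oo --> G i j (s, y).

Lemma G_row j y :
  chain (fun i => kap i * (C * (kap j * logistic' y))) (fun i s => G i j (s, y)).
Proof.
have [F hF FE] := row_chain j y.
rewrite (_ : (fun i s => G i j (s, y)) = F)//.
apply/funext => i; apply/funext => s.
exact: nrm_cvg_unique (@hG i j s y) (FE i s).
Qed.

Lemma G_col i s :
  chain (fun j => kap j * (C * (kap i * logistic' s))) (fun j y => G i j (s, y)).
Proof.
have [F hF FE] := col_chain i s.
rewrite (_ : (fun j y => G i j (s, y)) = F)//.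
apply/funext => j; apply/funext => y.
exact: nrm_cvg_unique (@hG i j s y) (FE j y).
Qed.

Lemma C0_G i j : C0 (G i j).
Proof.
pose L := kap i * (C * kap j).
have L0 : 0 <= L by rewrite !mulr_ge0.
have L1 : 0 < 1 + L by rewrite ltr_pwDl.
split.
  move=> [s y]; apply/cvg_nrmP => e e0.
  have d0 : 0 < e / (2 * (1 + L)) by rewrite divr_gt0// mulr_gt0.
  exists (ball s (e / (2 * (1 + L))), ball y (e / (2 * (1 + L)))).
    by split; exact: nbhsx_ballx.
  move=> [s' y'] [/=]; rewrite /ball/= => hs hy.
  have [_ /(_ s' s) h1 _] := G_row j y i.
  have [_ /(_ y' y) h2 _] := G_col i s' j.
  rewrite -(subrK (G i j (s', y)) (G i j (s, y))) -addrA.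
  rewrite (le_lt_trans (nrmD _ _))// (splitr e).
  have aux (w : R) (r : R) : r < e / (2 * (1 + L)) -> 0 <= r -> 0 <= w <= L ->
      w * r < e / 2.
    rewrite invfM mulrA => h r0 /andP[w0 wL].
    move: h; rewrite ltr_pdivlMr// => h; apply: le_lt_trans h.
    by rewrite mulrC ler_wpM2l// (le_trans wL)// lerDr.
  apply: ltrD.
    apply: le_lt_trans h1 _; apply: aux => //.
    apply/andP; split.
      exact: mulr_ge0 (kap0 i) (mulr_ge0 Cge0 (mulr_ge0 (kap0 j) (l0 y))).
    by rewrite ler_wpM2l// ler_wpM2l// ler_piMr// logistic'_le1.
  apply: le_lt_trans h2 _; apply: aux => //.
  apply/andP; split.
    exact: mulr_ge0 (kap0 j) (mulr_ge0 Cge0 (mulr_ge0 (kap0 i) (l0 s'))).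
  rewrite [leRHS](_ : _ = kap j * (C * kap i)); last by rewrite /L; ring.
  by rewrite ler_wpM2l// ler_wpM2l// ler_piMr// logistic'_le1.
move=> e e0; have [M M0 hM] := logistic'_small (divr_gt0 e0 L1).
exists (`[- M, M]%classic `*` `[- M, M]%classic).
  by apply: compact_setX; exact: segment_compact.
move=> [s y] /= sy; rewrite nrmE ltcR.
have [/(_ s) h _ _] := G_row j y i; apply: le_lt_trans h _.
rewrite [X in X < _](_ : _ = L * (logistic' s * logistic' y)); last first.
  by rewrite /L; ring.
suff h : logistic' s * logistic' y < e / (1 + L).
  move: h; rewrite ltr_pdivlMr// mulrC; apply: le_lt_trans.
  by rewrite (ler_wpM2r (mulr_ge0 (l0 s) (l0 y)))// lerDr.
have [xM|xM] := ltP M (`|s|).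
  by apply: le_lt_trans (hM s xM); rewrite ler_piMr// logistic'_le1.
have {}xM : M < `|y|.
  rewrite ltNge; apply/negP => yM; apply: sy.
  by rewrite !in_itv/= -!ler_norml.
by apply: le_lt_trans (hM y xM); rewrite ler_piMl// logistic'_le1.
Qed.

(** Partial derivatives of any word depend only on the numbers of letters. *)
Lemma C0_smooth2_G : C0_smooth2 (G 0 0).
Proof.
exists (fun w => G (count_mem false w) (count_mem true w)).
split=> // [w y|w s|w]; last exact: C0_G.
- rewrite /= ?eqxx ?add0n ?add1n.
  exact: (@chain_is_sderive _ _ _ _ _ (@G_row (count_mem true w) y)).
- rewrite /= ?eqxx ?add0n ?add1n.
  exact: (@chain_is_sderive _ _ _ _ _ (@G_col (count_mem false w) s)).
Qed.

Lemma kernel_measurable_G : kernel_measurable leb (G 0 0).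
Proof.
pose z_ N (z : measurableTypeR R * measurableTypeR R) : R[i] :=
  \sum_(m < N) c m 0%N z.1 * cj (D m 0%N z.2).
exists (clim z_).
  apply: cmeasurable_clim => N; rewrite /z_.
  elim: N => [|N IH].
    by under eq_fun do rewrite big_ord0; exact: cmeasurable_cst.
  under eq_fun do rewrite big_ord_recr/=.
  apply: cmeasurableD => //; apply: cmeasurableM.
    apply: (@cmeasurable_comp _ _ _ _ _ (c N 0%N) fst) => //.
    exact: (chain_cmeasurable 0 (hc N)).
  apply: (@cmeasurable_comp _ _ _ _ _ (fun y => cj (D N 0%N y)) snd) => //.
  exact/cmeasurable_conj/(chain_cmeasurable 0 (hD N)).
apply: aeW => -[s y]; rewrite (@climE _ _ _ z_ _ (G 0 0 (s, y)))//.
exact: (@hG 0 0 s y).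
Qed.

(** The square-integrable function [conj (G (s, .))], as a function of [s]. *)
Lemma row_map : exists t : nat -> R -> L2 leb,
  [/\ chain (fun i => kap i * (2 * C)) t,
      forall s, psum (fun m => cj (c m 0%N s) *: u m) @ \oo --> t 0%N s &
      forall s, {ae leb, forall y, t 0%N s y = cj (G 0 0 (s, y))}].
Proof.
have bound i N : \sum_(m < N) kap i * (C * rho m) * nrm (u m) <= kap i * (2 * C).
  rewrite [leLHS](_ : _ = (\sum_(m < N) rho m) * (kap i * C)); last first.
    rewrite mulr_suml; apply: eq_bigr => m _.
    by rewrite (nrm_orthonormal uo) mulr1; ring.
  rewrite [leRHS](_ : _ = 2 * (kap i * C)); last by ring.
  by rewrite ler_wpM2r ?mulr_ge0.
have [t ht tE] := @chain_series _ _ _ _ u _ (@abs_complete_L2 _ _ _ leb)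
  (fun m => chain_conj (hc m)) bound.
exists t; split=> // s.
have [K hK] : exists K, summable_by (fun m => nrm (cj (c m 0%N s) *: u m)) K.
  exists (kap 0 * (2 * C) * logistic' s) => N.
  apply: (@le_trans _ _ ((\sum_(m < N) kap 0 * (C * rho m) * nrm (u m)) * logistic' s)).
    rewrite mulr_suml; apply: ler_sum => m _.
    have [/(_ s) d1 _ _] := hc m 0%N.
    by rewrite nrmZ normc_conj mulrAC ler_wpM2r ?nrm_ge0// -nrmC.
  by rewrite (ler_wpM2r (l0 s))//; exact: bound.
have E1 := ae_abs_series (tE 0%N s) hK.
have /ae_foralln E2 : forall m, {ae leb, forall y,
    (cj (c m 0%N s) *: u m : L2 leb) y = cj (c m 0%N s * cj (D m 0%N y))}.
  move=> m; apply: filterS2 (L2Z (cj (c m 0%N s)) (u m)) (uD m) => y -> ->.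
  by rewrite rmorphM/= conjCK.
apply: filterS2 E1 E2 => y h E.
have E' : (fun m => (cj (c m 0%N s) *: u m : L2 leb) y) =
  (fun m => cj (c m 0%N s * cj (D m 0%N y))) by apply/funext => m; exact: E.
rewrite E' in h; apply: nrm_cvg_unique h _; exact: psum_conj (@hG 0 0 s y).
Qed.

(** The square-integrable function [G (., y)], as a function of [y]. *)
Lemma col_map : exists t : nat -> R -> L2 leb,
  chain (fun i => kap i * (2 * C)) t /\
  forall y, {ae leb, forall s, t 0%N y s = G 0 0 (s, y)}.
Proof.
have bound i N : \sum_(m < N) B m i * nrm (A (u m)) <= kap i * (2 * C).
  apply: (@le_trans _ _ ((\sum_(m < N) B m i * rho m) * (2 * C))).
    rewrite mulr_suml; apply: ler_sum => m _; rewrite -mulrA ler_wpM2l//.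
    by have [h _] := nrm_column m; rewrite mulrCA (mulrC (rho m)).
  by rewrite ler_wpM2r ?mulr_ge0//; exact: hkap.
have [t ht tE] := @chain_series _ _ _ _ (fun m => A (u m)) _
  (@abs_complete_L2 _ _ _ leb) (fun m => chain_conj (hD m)) bound.
exists t; split=> // y.
have [K hK] : exists K, summable_by (fun m => nrm (cj (D m 0%N y) *: A (u m))) K.
  exists (kap 0 * (2 * C) * logistic' y) => N.
  apply: (@le_trans _ _ ((\sum_(m < N) B m 0%N * nrm (A (u m))) * logistic' y)).
    rewrite mulr_suml; apply: ler_sum => m _.
    have [/(_ y) d1 _ _] := hD m 0%N.
    by rewrite nrmZ normc_conj mulrAC ler_wpM2r ?nrm_ge0// -nrmC.
  by rewrite (ler_wpM2r (l0 y))//; exact: bound.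
have E1 := ae_abs_series (tE 0%N y) hK.
have /ae_foralln E2 : forall m, {ae leb, forall s,
    (cj (D m 0%N y) *: A (u m) : L2 leb) s = c m 0%N s * cj (D m 0%N y)}.
  move=> m; have [_ h] := nrm_column m.
  by apply: filterS2 (L2Z (cj (D m 0%N y)) (A (u m))) h => s -> ->; rewrite mulrC.
apply: filterS2 E1 E2 => s h E.
have E' : (fun m => (cj (D m 0%N y) *: A (u m) : L2 leb) s) =
  (fun m => c m 0%N s * cj (D m 0%N y)) by apply/funext => m; exact: E.
by rewrite E' in h; exact: nrm_cvg_unique h (@hG 0 0 s y).
Qed.

Lemma sqint_row s : (fun y : measurableTypeR R => G 0 0 (s, y)) \in sqint leb.
Proof. exact: (chain_sqint 0 (@G_col 0 s)). Qed.

Lemma Kinfty_G : Kinfty (G 0 0).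
Proof.
split.
- split; first exact: kernel_measurable_G.
  apply: aeW => x; split; first by have /sqintP[] := sqint_row x.
  by have /sqintP[] := chain_sqint 0 (@G_row 0 x).
- exact: C0_smooth2_G.
- have [t [ht _ tG]] := row_map; exists (t 0%N) => //; exact: chain_C0_smooth ht.
- have [t [ht tG]] := col_map; exists (t 0%N) => //; exact: chain_C0_smooth ht.
Qed.

Lemma hilbert_schmidt_G : hilbert_schmidt (G 0 0).
Proof.
split; first exact: kernel_measurable_G.
have [t [ht _ tG]] := row_map.
have [d1 d2 _] := ht 0%N; set b := kap 0 * (2 * C) in d1 d2.
have b0 : 0 <= b by rewrite !mulr_ge0.
under eq_integral => x _.
  rewrite (_ : (\int[_]_y _)%E = (nrm (t 0%N x) ^+ 2)%:E); last first.
    rewrite -integral_nrm; apply: ae_eq_integral => //.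
    - exact/emeasurable_normc2/sqint_cmeasurable/sqint_row.
    - exact/emeasurable_normc2/L2_cmeasurable.
    - by apply: filterS (tG x) => y -> _; rewrite normc_conj.
  over.
have cn : continuous (fun x => nrm (t 0%N x)).
  move=> x; have ct := lipschitz_continuous d2 (x := x).
  apply/cvgrPdist_lt => e e0; have /cvg_nrmP/(_ _ e0) := ct.
  apply: filterS => y; apply: le_lt_trans.
  rewrite ler_norml; apply/andP; split.
    rewrite lerNl opprB lerBlDr nrmB; apply: le_trans (nrmD _ _).
    by rewrite subrK.
  by rewrite lerBlDr; apply: le_trans (nrmD _ _); rewrite subrK.
have mn : measurable_fun [set: R] (fun x => nrm (t 0%N x)).
  exact: continuous_measurable_fun.
have ml : measurable_fun [set: R] (fun x => logistic' x).
  by apply: continuous_measurable_fun; exact: continuous_logistic'.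
apply: (@le_lt_trans _ _ (\int[leb]_x (b ^+ 2 * logistic' x)%:E)%E).
  apply: ge0_le_integral => //.
  - by move=> x _; rewrite lee_fin sqr_ge0.
  - by apply/measurable_EFinP; apply: measurable_funX.
  - by apply/measurable_EFinP; apply: measurable_funM.
  - move=> x _; rewrite lee_fin (@le_trans _ _ ((b * logistic' x) ^+ 2))//.
      by rewrite ler_sqr ?nnegrE ?nrm_ge0 ?(mulr_ge0 b0 (l0 x)).
    rewrite exprMn ler_wpM2l ?sqr_ge0// expr2 ler_piMr//.
    exact: logistic'_le1.
exact: integral_scaled_logistic'.
Qed.

Lemma induces_G : induces leb (G 0 0) A.
Proof.
split; first exact: kernel_measurable_G.
move=> f; have [t [_ tE tG]] := row_map.
have ex := psum_bounded Ab (expansion uo ut (f := f)).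
have [_ _ _ AZ _] := lin_additive Ab.1.
have sm N : \sum_(m < N) nrm (A (inner f (u m) *: u m)) <= 2 * (nrm f * (2 * C)).
  apply: (@le_trans _ _ ((\sum_(m < N) rho m) * (nrm f * (2 * C)))).
    rewrite mulr_suml; apply: ler_sum => m _; rewrite AZ nrmZ.
    rewrite [leRHS](_ : _ = nrm f * (2 * (C * rho m))); last ring.
    apply: ler_pM; rewrite ?normc_ge0 ?nrm_ge0//; last by case: (nrm_column m).
    by have := cauchy_schwarz f (u m); rewrite (nrm_orthonormal uo) mulr1.
  by rewrite ler_wpM2r ?mulr_ge0 ?nrm_ge0.
have E1 := ae_abs_series ex sm.
have /ae_foralln E2 : forall m, {ae leb, forall s,
    A (inner f (u m) *: u m) s = inner f (cj (c m 0%N s) *: u m)}.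
  move=> m; have [_ h] := nrm_column m; rewrite AZ.
  by apply: filterS2 (L2Z (inner f (u m)) (A (u m))) h => s -> ->;
    rewrite innerZr conjCK mulrC.
apply: filterS2 E1 E2 => s h E.
have sG := sqint_row s; split; first exact: cintegrableM sG (L2_sqint f).
have -> : A f s = inner f (t 0%N s).
  have E' : (fun m => A (inner f (u m) *: u m) s) =
    (fun m => inner f (cj (c m 0%N s) *: u m)) by apply/funext => m; exact: E.
  rewrite E' in h; apply: nrm_cvg_unique h _.
  have := cvg_innerr (g := f) (tE s); apply: cvg_trans; apply: near_eq_cvg.
  by apply: nearW => N; rewrite /psum inner_sumr.
apply: eq_ae_cintegral; first exact: cmeasurable_inner.
  by apply: cmeasurableM; [exact: sqint_cmeasurable sG|exact: L2_cmeasurable].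
by apply: filterS (tG s) => y ->; rewrite conjCK mulrC.
Qed.

End one_operator.
Lemma kernel_family A C : matrix_bound A C ->
  exists (c : nat -> nat -> R -> R[i]) (G : nat -> nat -> R * R -> R[i]),
  [/\ forall m, chain (fun i => kap i * (C * rho m)) (c m),
      forall m i s, psum (fun n => D n i s *: coef A n m) @ \oo --> c m i s &
      forall i j s y, psum (fun m => c m i s * cj (D m j y)) @ \oo --> G i j (s, y)].
Proof.
move=> AC; have [c [hc hcA]] := columns AC; exists c.
have /choice[G hG] : forall i, exists Gi : nat -> R * R -> R[i], forall j s y,
    psum (fun m => c m i s * cj (D m j y)) @ \oo --> Gi j (s, y).
  move=> i; have /choice[Gi hGi] : forall j, exists Gij : R * R -> R[i],
      forall s y, psum (fun m => c m i s * cj (D m j y)) @ \oo --> Gij (s, y).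
    move=> j; have /choice[Gij hGij] : forall z : R * R, exists w : R[i],
        psum (fun m => c m i z.1 * cj (D m j z.2)) @ \oo --> w.
      move=> [s y]; have [F _ hF] := row_chain AC hc j y.
      by exists (F i s); exact: (hF i s).
    by exists Gij => s y; exact: (hGij (s, y)).
  by exists Gi.
by exists G.
Qed.

Lemma kernel_of_exists A C : matrix_bound A C -> exists G, kernel_of A G.
Proof.
move=> AC; have [c [G [_ hcA hG]]] := kernel_family AC.
exists (G 0%N 0%N), (fun m => c m 0%N); split=> [m s|s y].
  exact: (hcA m 0%N s).
exact: (hG 0%N 0%N s y).
Qed.

(** For the integral formula, expand [f]: almost everywhere
    [A f = \sum_m <f, u m> c m], which is the inner product of [f] with the
    conjugate of the row of the kernel. *)
Lemma kernel_of_Kinfty A C G : bounded_op A -> matrix_bound A C ->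
  kernel_of A G -> [/\ hilbert_schmidt G, Kinfty G & induces leb G A].
Proof.
move=> Ab AC [c' [hc' hG']]; have [c [F [hc hcA hF]]] := kernel_family AC.
have cE m : c' m = c m 0%N.
  by apply/funext => s; exact: nrm_cvg_unique (hc' m s) (hcA m 0%N s).
have -> : G = F 0%N 0%N.
  apply/funext => -[s y]; apply: nrm_cvg_unique (hG' s y) _.
  have -> : (fun m => c' m s * cj (D m 0%N y)) =
      (fun m => c m 0%N s * cj (D m 0%N y)) by apply/funext => m; rewrite cE.
  exact: (hF 0%N 0%N s y).
split; [exact: (hilbert_schmidt_G AC hc hF)|exact: (Kinfty_G AC hc hcA hF)|].
exact: (induces_G Ab AC hc hcA hF).
Qed.

(** Both [A] and its adjoint shrink the basis; the second bound says so for the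
    adjoint without naming it. The square leaves room for the geometric mean of a
    row bound and a column bound. *)
Definition decaying A := exists2 C : R, 0 <= C & forall n,
  nrm (A (u n)) <= C * rho n ^+ 2 /\
  forall f, normc (inner (A f) (u n)) <= C * rho n ^+ 2 * nrm f.

Lemma decayingB A A' (lam : R[i]) : decaying A -> decaying A' ->
  decaying (fun f => A f - lam *: A' f).
Proof.
move=> [C C0 hC] [C' C'0 hC'].
exists (C + normc lam * C') => [|n]; first by rewrite addr_ge0 ?mulr_ge0 ?normc_ge0.
have [a1 a2] := hC n; have [b1 b2] := hC' n; split=> [|f].
  rewrite (le_trans (nrmD _ _))// nrmN nrmZ mulrDl lerD//.
  by rewrite -mulrA ler_wpM2l ?normc_ge0.
rewrite innerBl innerZl -nrmC (le_trans (nrmD _ _))// nrmN !nrmC normcM.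
rewrite [leRHS](_ : _ = C * rho n ^+ 2 * nrm f +
  normc lam * (C' * rho n ^+ 2 * nrm f)); last by ring.
by rewrite lerD// ler_wpM2l ?normc_ge0.
Qed.

Lemma decaying_matrix A : decaying A -> exists C, matrix_bound A C.
Proof.
move=> [C C0 hC]; exists C; split=> // n m; rewrite /coef.
have [_ /(_ (u m)) h1] := hC n; have [h2 _] := hC m.
rewrite (nrm_orthonormal uo) mulr1 in h1.
have {}h2 : normc (inner (A (u m)) (u n)) <= C * rho m ^+ 2.
  apply: le_trans h2; rewrite (le_trans (cauchy_schwarz _ _))//.
  by rewrite (nrm_orthonormal uo) mulr1.
have rn := rho0 n; have rm := rho0 m.
have [nm|mn] := leP (rho n) (rho m).
  apply: le_trans h1 _; rewrite ler_wpM2l// expr2 ler_wpM2l// ltW//.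
apply: le_trans h2 _; rewrite ler_wpM2l// expr2 ler_wpM2r// ltW//.
Qed.

(** Whether [P = A S] or [P = S A], the diagonal of [P] inherits the decay of
    [A]; positivity carries it to the other entries. *)
Lemma mercer_set_matrix A P : decaying A -> mercer_set A P ->
  exists C, matrix_bound P C.
Proof.
move=> [C C0 hC] [[Pl _] P0 [S /bounded_nrm[M M0 hM] PE]].
have diag n : normc (coef P n n) <= C * M * rho n ^+ 2.
  have [h1 h2] := hC n.
  case: PE => ->; rewrite /coef /=.
    apply: le_trans (h2 (S (u n))) _; rewrite mulrAC.
    rewrite ler_wpM2r ?sqr_ge0// ler_wpM2l// (le_trans (hM _))//.
    by rewrite (nrm_orthonormal uo) mulr1.
  rewrite (le_trans (cauchy_schwarz _ _))// (nrm_orthonormal uo) mulr1.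
  by rewrite (le_trans (hM _))// (mulrC C) -mulrA ler_wpM2l.
pose K := Num.sqrt (C * M + 1).
have CM0 : 0 <= C * M by exact: mulr_ge0.
have K0 : 0 < K by rewrite sqrtr_gt0 ltr_wpDl.
have KE : K ^+ 2 = C * M + 1 by rewrite sqr_sqrtr// addr_ge0.
exists (K ^+ 2); split=> [|n m]; first exact: sqr_ge0.
rewrite [leRHS](_ : _ = (K * rho m) * (K * rho n)); last by ring.
have diagK k : normc (inner (P (u k)) (u k)) <= (K * rho k) ^+ 2.
  apply: le_trans (diag k) _; rewrite exprMn KE ler_wpM2r ?sqr_ge0// lerDl//.
by apply: positive_offdiag => //; rewrite mulr_gt0.
Qed.

Theorem decaying_mercer_type A G : bounded_op A -> decaying A -> kernel_of A G ->
  hilbert_schmidt G /\ mercer_type G.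
Proof.
move=> Ab dA kG; have [C AC] := decaying_matrix dA.
have [hs Ki ind] := kernel_of_Kinfty Ab AC kG.
split=> //; split=> //; exists A; split=> // P PA.
have [C' PC] := mercer_set_matrix dA PA; have [Q kQ] := kernel_of_exists PC.
have [Pb _ _] := PA; have [_ KQ iQ] := kernel_of_Kinfty Pb PC kQ.
by exists Q.
Qed.

End kernels.

(** * Injective smoothing operators *)

Section multiplication_operator.
Context d (T : measurableType d) (R : realType).
Variable mu : {measure set T -> \bar R}.

Lemma multiplication_op (H : T -> R[i]) (M : R) : cmeasurable H ->
  (forall y, normc (H y) <= M) ->
  exists2 A : L2 mu -> L2 mu, bounded_op A &
    forall f : L2 mu, {ae mu, forall x, A f x = H x * f x}.
Proof.
move=> mH HM.
have le2 (f : L2 mu) x : normc (H x * f x) ^+ 2 <= M ^+ 2 * normc (f x) ^+ 2.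
  rewrite normcM exprMn ler_wpM2r ?sqr_ge0// ler_sqr ?nnegrE ?normc_ge0//.
  exact: le_trans (normc_ge0 _) (HM x).
have mHf (f : L2 mu) : cmeasurable (fun x => H x * f x).
  by apply: cmeasurableM => //; exact: L2_cmeasurable.
have int (f : L2 mu) : (\int[mu]_x (normc (H x * f x) ^+ 2)%:E <=
    (M ^+ 2 * nrm f ^+ 2)%:E)%E.
  rewrite EFinM -integral_nrm -ge0_integralZl//.
  - apply: ge0_le_integral => //.
    + by move=> x _; rewrite lee_fin sqr_ge0.
    + exact: emeasurable_normc2.
    + apply/measurable_EFinP; apply: measurable_funM => //.
      apply: measurable_funX; exact: measurable_normc (L2_cmeasurable f).
    + by move=> x _; rewrite lee_fin.
  - exact: emeasurable_normc2 (L2_cmeasurable f).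
  - by move=> x _; rewrite lee_fin sqr_ge0.
  - by rewrite lee_fin sqr_ge0.
have sHf (f : L2 mu) : (fun x => H x * f x) \in sqint mu.
  by apply/sqintP; split=> //; exact: le_lt_trans (int f) (ltry _).
exists (fun f => toL2 (sHf f)); last by move=> f; exact: toL2E.
split.
  move=> a f g; apply/L2P.
  have E1 := toL2E (sHf (a *: f + g)); have E2 := toL2E (sHf f).
  have E3 := toL2E (sHf g); have E4 := L2D (a *: f) g; have E5 := L2Z a f.
  have E6 := L2D (a *: toL2 (sHf f)) (toL2 (sHf g)).
  have E7 := L2Z a (toL2 (sHf f)).
  near=> x; rewrite (near E1 x)// (near E6 x)// (near E7 x)// (near E2 x)//.
  by rewrite (near E3 x)// (near E4 x)// (near E5 x)//; ring.
exists `|M| => f; rewrite !nrmE -rmorphM/= lecR.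
rewrite -(@ler_sqr R) ?nnegrE ?nrm_ge0 ?mulr_ge0 ?nrm_ge0//.
rewrite exprMn real_normK ?num_real// -lee_fin -integral_nrm.
apply: le_trans (int f); rewrite le_eqVlt; apply/orP; left; apply/eqP.
apply: ae_eq_integral => //.
- exact/emeasurable_normc2/L2_cmeasurable.
- exact: emeasurable_normc2.
- by apply: filterS (toL2E (sHf f)) => x ->.
Unshelve. all: by end_near. Qed.

Lemma multiplication_adjoint (H : T -> R[i]) (A A' : L2 mu -> L2 mu) :
  cmeasurable H ->
  (forall f : L2 mu, {ae mu, forall x, A f x = H x * f x}) ->
  (forall f : L2 mu, {ae mu, forall x, A' f x = cj (H x) * f x}) ->
  forall f g, inner (A f) g = inner f (A' g).
Proof.
move=> mH AE A'E f g; apply: eq_ae_cintegral; try exact: cmeasurable_inner.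
apply: filterS2 (AE f) (A'E g) => x -> ->.
by rewrite rmorphM/= conjCK; ring.
Qed.

End multiplication_operator.

Section bounded_operators.
Context {R : realType}.

Lemma bounded_op_nrm (E F : normedModType R[i]) (A : E -> F) (M : R) :
  linear A -> (forall v, nrm (A v) <= M * nrm v) -> bounded_op A.
Proof.
move=> Al hM; split=> //; exists M => v.
by rewrite !nrmE -rmorphM/= lecR.
Qed.

Lemma linear_comp (E F G : normedModType R[i]) (A : F -> G) (A' : E -> F) :
  linear A -> linear A' -> linear (A \o A').
Proof. by move=> Al A'l a v w; rewrite /= A'l Al. Qed.

Lemma bounded_op_comp (E F G : normedModType R[i]) (A : F -> G) (A' : E -> F) :
  bounded_op A -> bounded_op A' -> bounded_op (A \o A').
Proof.
move=> Ab A'b; have [M M0 hM] := bounded_nrm Ab.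
have [M' M'0 hM'] := bounded_nrm A'b.
apply: (@bounded_op_nrm _ _ _ (M * M')); first exact: linear_comp Ab.1 A'b.1.
by move=> v /=; rewrite (le_trans (hM _))// -mulrA ler_wpM2l.
Qed.

Lemma bounded_opB (E F : normedModType R[i]) (A A' : E -> F) (lam : R[i]) :
  bounded_op A -> bounded_op A' -> bounded_op (fun f => A f - lam *: A' f).
Proof.
move=> Ab A'b; have [M M0 hM] := bounded_nrm Ab.
have [M' M'0 hM'] := bounded_nrm A'b.
apply: (@bounded_op_nrm _ _ _ (M + normc lam * M')).
  move=> a v w; rewrite Ab.1 A'b.1 [in RHS]scalerBr scalerDr !scalerA (mulrC a).
  by rewrite opprD addrACA.
move=> v; rewrite (le_trans (nrmD _ _))// nrmN nrmZ mulrDl lerD//.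
by rewrite -mulrA ler_wpM2l ?normc_ge0.
Qed.

End bounded_operators.

Section smoothing_operator.
Context d d' (S : measurableType d) (T : measurableType d') (R : realType).
Variables (mu : {measure set S -> \bar R}) (nu : {measure set T -> \bar R}).
Variables (f : nat -> L2 mu) (U : L2 mu -> L2 nu) (rho : nat -> R).
Hypothesis ft : total_system f.
Hypothesis Ui : forall g h, inner (U g) (U h) = inner g h.
Hypothesis rho0 : forall n, 0 < rho n.
Hypothesis rho_mon : forall m n, (m <= n)%N -> rho n <= rho m.

(** [f m] and its two images stand at the places [3 m], [3 m + 1] and [3 m + 2] of
    the sequence that is orthogonalized, so [rho (3 m + 2)] is the value that the
    weight must not exceed. *)
Definition smoothing_weight m : R :=
  2^-1 ^+ m * rho (3 * m + 2) ^+ 2 / (1 + nrm (f m) ^+ 2).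

Definition smoothing_term m (g : L2 mu) : L2 nu :=
  ((smoothing_weight m)%:C * inner g (f m)) *: U (f m).

Let nrmU g : nrm (U g) = nrm g.
Proof.
have := Ui g g; rewrite !inner_nrm => /complexI/eqP.
by rewrite eqrXn2 ?nrm_ge0// => /eqP.
Qed.

Lemma smoothing_weight_gt0 m : 0 < smoothing_weight m.
Proof.
by rewrite divr_gt0 ?mulr_gt0 ?exprn_gt0// ltr_pwDl// sqr_ge0.
Qed.

Lemma nrm_smoothing_term m n g (K : R) : 0 <= K -> (n <= 3 * m + 2)%N ->
  normc (inner g (f m)) <= K * nrm (f m) ->
  nrm (smoothing_term m g) <= K * rho n ^+ 2 * 2^-1 ^+ m.
Proof.
move=> K0 nm hg; rewrite nrmZ nrmU normcM normc_real.
rewrite gtr0_norm ?smoothing_weight_gt0//.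
have d0 : 0 < 1 + nrm (f m) ^+ 2 by rewrite ltr_pwDl// sqr_ge0.
have h0 : 0 <= (2^-1 : R) ^+ m by rewrite exprn_ge0.
apply: (@le_trans _ _ (smoothing_weight m * (K * nrm (f m)) * nrm (f m))).
  by rewrite ler_wpM2r ?nrm_ge0// ler_wpM2l// ltW// smoothing_weight_gt0.
rewrite /smoothing_weight.
rewrite [leLHS](_ : _ = (K * 2^-1 ^+ m * rho (3 * m + 2) ^+ 2) *
  (nrm (f m) ^+ 2 / (1 + nrm (f m) ^+ 2))); last by ring.
rewrite [leRHS](_ : _ = (K * 2^-1 ^+ m * rho n ^+ 2) * 1); last by ring.
apply: ler_pM;
  rewrite ?mulr_ge0 ?invr_ge0 ?(ltW d0) ?(ltW (rho0 _)) ?nrm_ge0//.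
  rewrite ler_wpM2l ?mulr_ge0// ler_sqr ?nnegrE ?(ltW (rho0 _))//.
  exact: rho_mon.
by rewrite ler_pdivrMr// mul1r lerDr.
Qed.

Lemma smoothing_exists : exists2 A : L2 mu -> L2 nu, bounded_op A &
  forall g, psum (fun m => smoothing_term m g) @ \oo --> A g.
Proof.
have sm g N : \sum_(m < N) nrm (smoothing_term m g) <= 2 * rho 0 ^+ 2 * nrm g.
  rewrite [leRHS](_ : _ = nrm g * rho 0 ^+ 2 * 2); last by ring.
  apply: (@le_trans _ _ (\sum_(m < N) nrm g * rho 0 ^+ 2 * 2^-1 ^+ m)).
    apply: ler_sum => m _; apply: nrm_smoothing_term; rewrite ?nrm_ge0//.
    exact: cauchy_schwarz.
  by rewrite -mulr_sumr ler_wpM2l ?mulr_ge0 ?nrm_ge0 ?(ltW (rho0 _)) ?geo_half//.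
have /choice[A hA] : forall g, exists h : L2 nu,
    psum (fun m => smoothing_term m g) @ \oo --> h.
  by move=> g; apply: abs_complete_L2; exists (2 * rho 0 ^+ 2 * nrm g); exact: sm.
exists A => //; apply: (@bounded_op_nrm _ _ _ _ (2 * rho 0 ^+ 2)).
  move=> a g h; apply: nrm_cvg_unique (@hA _) _.
  have := psumD (psumZ (a := a) (@hA g)) (@hA h).
  apply: cvg_trans; apply: near_eq_cvg; apply: nearW => N.
  apply: eq_bigr => m _; rewrite /smoothing_term scalerA -scalerDl.
  by rewrite innerDl innerZl; congr (_ *: _); ring.
move=> g; apply: le_nrm_lim (@hA g) _ => N.
by rewrite (le_trans (nrm_sum _ _ _)).
Qed.

Variable A : L2 mu -> L2 nu.
Hypothesis Ab : bounded_op A.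
Hypothesis hA : forall g, psum (fun m => smoothing_term m g) @ \oo --> A g.

(** [<A g, U g>] is the sum of the nonnegative numbers
    [smoothing_weight m * |<g, f m>|^2]. *)
Lemma smoothing_inj g : A g = 0 -> g = 0.
Proof.
move=> Ag0; apply: ft => k.
have := cvg_innerl (g := U g) (@hA g); rewrite Ag0 inner0l => /cvgn_nrmP h.
pose w m := smoothing_weight m * normc (inner g (f m)) ^+ 2.
have w0 m : 0 <= w m by rewrite mulr_ge0 ?sqr_ge0 ?(ltW (smoothing_weight_gt0 m)).
have wE N : inner (psum (fun m => smoothing_term m g) N) (U g) =
    (\sum_(m < N) w m)%:C.
  rewrite /psum inner_suml (raddf_sum (real_complex R)); apply: eq_bigr => m _.
  rewrite innerZl Ui -(inner_conj g) -mulrA mulc_conj.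
  by have [_ _ CM _] := @realC_morph R; rewrite -CM.
have wk0 : w k = 0.
  apply/eqP; rewrite eq_le w0 andbT; apply/ler_addgt0Pr => e e0; rewrite add0r.
  have [N hN] := h e e0.
  have := hN (maxn N k.+1) (leq_maxl _ _).
  rewrite wE sub0r nrmN nrmC normc_real ger0_norm ?sumr_ge0// => /ltW.
  apply: le_trans.
  rewrite (bigD1 (Ordinal (leq_maxr N k.+1)))//= lerDl sumr_ge0//.
apply: eq0_normc; apply/eqP; move/eqP: wk0; rewrite /w mulf_eq0.
by rewrite gt_eqF ?smoothing_weight_gt0//= expf_eq0.
Qed.

(** Only the terms with [n <= 3 m + 2] remain, and their weights are small. *)
Lemma smoothing_small g n (K : R) : 0 <= K ->
  (forall m, normc (inner g (f m)) <= K * nrm (f m)) ->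
  (forall m, (3 * m + 2 < n)%N -> inner g (f m) = 0) ->
  nrm (A g) <= 2 * K * rho n ^+ 2.
Proof.
move=> K0 gK g0; apply: le_nrm_lim (@hA g) _ => N.
rewrite (le_trans (nrm_sum _ _ _))//.
apply: (@le_trans _ _ (\sum_(m < N) K * rho n ^+ 2 * 2^-1 ^+ m)).
  apply: ler_sum => m _; have [nm|mn] := leqP n (3 * m + 2).
    exact: nrm_smoothing_term.
  rewrite /smoothing_term g0// mulr0 scale0r nrm0.
  by rewrite !mulr_ge0 ?(ltW (rho0 _)) ?exprn_ge0.
rewrite -mulr_sumr [leRHS](_ : _ = K * rho n ^+ 2 * 2); last by ring.
by rewrite ler_wpM2l ?mulr_ge0 ?(ltW (rho0 _)) ?geo_half//.
Qed.

Lemma smoothing_small_adjoint g e n : nrm e = 1 ->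
  (forall m, (3 * m < n)%N -> inner (f m) e = 0) ->
  normc (inner (A g) (U e)) <= 2 * rho n ^+ 2 * nrm g.
Proof.
move=> e1 fe; rewrite -nrmC; apply: le_nrm_lim (cvg_innerl (g := U e) (@hA g)) _.
move=> N; rewrite /psum inner_suml (le_trans (nrm_sum _ _ _))//.
apply: (@le_trans _ _ (\sum_(m < N) nrm g * rho n ^+ 2 * 2^-1 ^+ m)).
  apply: ler_sum => m _; have [nm|mn] := leqP n (3 * m); last first.
    rewrite innerZl Ui fe// mulr0 nrm0.
    by rewrite !mulr_ge0 ?nrm_ge0 ?(ltW (rho0 _)) ?exprn_ge0.
  rewrite nrmC (le_trans (cauchy_schwarz _ _))// nrmU e1 mulr1.
  apply: nrm_smoothing_term; rewrite ?nrm_ge0//; last exact: cauchy_schwarz.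
  by rewrite (leq_trans nm)// leq_addr.
rewrite -mulr_sumr [leRHS](_ : _ = nrm g * rho n ^+ 2 * 2); last by ring.
by rewrite ler_wpM2l ?mulr_ge0 ?nrm_ge0 ?(ltW (rho0 _)) ?geo_half//.
Qed.

End smoothing_operator.

(** * Reduction to an equation of the first kind *)

Lemma interleave_spec (T : Type) (a b c : nat -> T) : exists g : nat -> T,
  forall m, [/\ g (3 * m)%N = a m, g (3 * m + 1)%N = b m & g (3 * m + 2)%N = c m].
Proof.
exists (fun k => match (k %% 3)%N with
  0%N => a (k %/ 3)%N | 1%N => b (k %/ 3)%N | _ => c (k %/ 3)%N end) => m.
by rewrite (mulnC 3) modnMl mulnK// !modnMDl !divnMDl//= !addn0.
Qed.

Section adapted_basis.
Context d (Y : measurableType d) (R : realType).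
Variable mu : {measure set Y -> \bar R}.

(** Gram-Schmidt applied to the vectors [f m] interleaved with their images. *)
Lemma adapted_basis (f : nat -> L2 mu) (A' B' : L2 mu -> L2 mu) :
  total_system f -> infinite_dim mu ->
  exists e : nat -> L2 mu, [/\ orthonormal_system e, total_system e,
    forall m n, (3 * m < n)%N -> inner (f m) (e n) = 0,
    forall m n, (3 * m + 2 < n)%N -> inner (A' (f m)) (e n) = 0 &
    forall m n, (3 * m + 2 < n)%N -> inner (B' (f m)) (e n) = 0].
Proof.
move=> ft inf.
have [g gE] := interleave_spec f (A' \o f) (B' \o f).
have gt : total_system g.
  by move=> h h0; apply: ft => m; have [<- _ _] := gE m.
have [e [eo et ge _]] := @gram_schmidt _ _ _ mu g (fun=> True) gt inf
  (conj I (fun _ _ _ _ _ => I)) (fun=> I).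
exists e; split=> // m n mn; have [g0 g1 g2] := gE m.
- by rewrite -g0; exact: ge.
- rewrite -[A' _]/((A' \o f) m) -g1; apply: ge; apply: leq_ltn_trans mn.
  by rewrite leq_add2l.
- by rewrite -[B' _]/((B' \o f) m) -g2; exact: ge.
Qed.

End adapted_basis.

Theorem theorem4 (R : realType) (d : measure_display) (Y : measurableType d)
    (mu : {sigma_finite_measure set Y -> \bar R})
    (mu_complete : measure_is_complete mu)
    (mu_separable : separable_measure mu)
    (mu_nonatomic : nonatomic mu)
    (H : Y -> R[i])
    (H_meas : cmeasurable H)
    (H_bounded : exists M : R, forall y, normc (H y) <= M)
    (K : Y * Y -> R[i])
    (Kop : L2 mu -> L2 mu)
    (Kop_bounded : bounded_op Kop)
    (K_induces : induces mu K Kop)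
    (Kop_biint : bi_integral Kop)
    (H_essran0 : forall e : R, 0 < e ->
      (0 < mu [set y | (normc (H y) < e)%R])%E) :
  exists (U : L2 mu -> L2 (@lebesgue_measure R))
         (w : L2 mu -> L2 (@lebesgue_measure R))
         (Gamma0 Gamma : R * R -> R[i]),
    [/\ unitary U,
        hilbert_schmidt Gamma0 /\ mercer_type Gamma0,
        hilbert_schmidt Gamma /\ mercer_type Gamma,
        forall lam : R[i],
          hilbert_schmidt (fun z => Gamma0 z - lam * Gamma z) /\
          mercer_type (fun z => Gamma0 z - lam * Gamma z) &
        forall (lam : R[i]) (phi psi : L2 mu),
          {ae mu, forall x,
            H x * phi x - lam * cintegral mu (fun y => K (x, y) * phi y)
            = psi x} <->
          {ae (@lebesgue_measure R), forall s,
            cintegral (@lebesgue_measure R)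
              (fun t => (Gamma0 (s, t) - lam * Gamma (s, t)) * U phi t)
            = w psi s}].
Proof.
have muT : (0 < mu setT)%E.
  apply: lt_le_trans (H_essran0 1 ltr01) _; apply: le_measure; rewrite ?inE//.
  have := measurable_normc H_meas measurableT (measurable_itv `]-oo, (1 : R)[).
  by rewrite setTI; congr measurable; apply/seteqP; split=> y /=; rewrite in_itv.
have inf := nonatomic_infinite_dim mu_nonatomic muT.
have [f ft] := separable_total mu_separable.
have [M HM] := H_bounded.
have [Hop Hop_b HopE] := multiplication_op mu H_meas HM.
have cH_meas := cmeasurable_conj H_meas.
have [|Hop' _ Hop'E] := @multiplication_op _ _ _ mu (fun y => cj (H y)) M cH_meas.
  by move=> y; rewrite normc_conj.
have Hadj := multiplication_adjoint H_meas HopE Hop'E.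
have [_ [Kop' [_ Kadj] _]] := Kop_biint.
have [e [eo et fe He Ke]] := adapted_basis Hop' Kop' ft inf.
have [u [B [D [uo ut hD uD]]]] := @smooth_basis R.
have [rho [kap [rho0 rho_mon hkap hrho]]] :=
  weights (fun n i => chain_ge0 i (hD n)).
have [U UE] := transport_exists eo uo.
have [V VE] := transport_exists uo eo.
have Ul : linear U := transport_linear ut UE.
have Vl : linear V := transport_linear et VE.
have Ui g h : inner (U g) (U h) = inner g h by exact: transport_inner UE.
have UV g : U (V g) = g by apply: (total_inj ut) => n; rewrite UE VE.
have VU g : V (U g) = g by apply: (total_inj et) => n; rewrite VE UE.
have Vu n : V (u n) = e n.
  by apply: (total_inj et) => k; rewrite VE uo eo.
have Vn g : nrm (V g) = nrm g.
  have := Ui (V g) (V g); rewrite UV !inner_nrm => /complexI/eqP.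
  by rewrite eqrXn2 ?nrm_ge0// => /eqP.
have Vb : bounded_op V.
  by apply: (@bounded_op_nrm _ _ _ _ 1) => // g; rewrite Vn mul1r.
have [S Sb hS] := smoothing_exists f Ui rho0 rho_mon.
have Sinj := smoothing_inj ft Ui rho0 hS.
(* Left multiplication by the injective [S] makes every bounded [X] decay
   without losing solutions of the equation. *)
pose op (X : L2 mu -> L2 mu) := S \o (X \o V).
have op_b X : bounded_op X -> bounded_op (op X).
  by move=> Xb; apply: bounded_op_comp => //; exact: bounded_op_comp.
have op_dec (X X' : L2 mu -> L2 mu) : bounded_op X ->
    (forall g h, inner (X g) h = inner g (X' h)) ->
    (forall m n, (3 * m + 2 < n)%N -> inner (X' (f m)) (e n) = 0) ->
    decaying u rho (op X).
  move=> /bounded_nrm[N N0 hN] Xadj Xe.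
  exists (2 * N) => [|n]; first by rewrite mulr_ge0.
  split=> [|g].
    apply: (smoothing_small Ui rho0 rho_mon hS N0) => [m|m mn] /=.
      rewrite (le_trans (cauchy_schwarz _ _))// ler_wpM2r ?nrm_ge0//.
      by rewrite (le_trans (hN _))// Vn (nrm_orthonormal uo) mulr1.
    by rewrite Vu Xadj -inner_conj Xe// rmorph0.
  have -> : u n = U (e n) by rewrite -Vu UV.
  apply: le_trans (smoothing_small_adjoint Ui rho0 rho_mon hS _ _ _) _.
  - exact: nrm_orthonormal eo n.
  - by move=> m; exact: fe.
  rewrite /= [leRHS](_ : _ = 2 * rho n ^+ 2 * (N * nrm g)); last by ring.
  rewrite ler_wpM2l ?mulr_ge0 ?(ltW (rho0 _))//.
  by rewrite (le_trans (hN _))// Vn.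
have decH := op_dec _ _ Hop_b Hadj He.
have decK := op_dec _ _ Kop_bounded Kadj Ke.
have [CH mbH] := decaying_matrix uo rho0 decH.
have [CK mbK] := decaying_matrix uo rho0 decK.
have [G0 kG0] := kernel_of_exists hD rho0 hkap mbH.
have [G kG] := kernel_of_exists hD rho0 hkap mbK.
have bH := op_b _ Hop_b; have bK := op_b _ Kop_bounded.
have main := decaying_mercer_type uo ut hD uD rho0 hkap hrho.
have kL lam := kernel_ofB lam bH.1 bK.1 kG0 kG.
have bL lam := bounded_opB lam bH bK.
have dL lam := decayingB lam decH decK.
exists U, S, G0, G; split.
- by split=> // g; exists (V g).
- exact: main bH decH kG0.
- exact: main bK decK kG.
- by move=> lam; exact: main (bL lam) (dL lam) (kL lam).
move=> lam phi psi.
have [C mb] := decaying_matrix uo rho0 (dL lam).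
have [_ _ [_ ind]] :=
  kernel_of_Kinfty uo ut hD uD rho0 hkap hrho (bL lam) mb (kL lam).
(* Each of the two integral equations is an equation between operators. *)
have -> : {ae mu, forall x,
    H x * phi x - lam * cintegral mu (fun y => K (x, y) * phi y) = psi x} <->
    Hop phi - lam *: Kop phi = psi.
  have E1 := L2B (Hop phi) (lam *: Kop phi); have E2 := HopE phi.
  have E3 := L2Z lam (Kop phi); have E4 := K_induces.2 phi.
  split=> [h|<-].
    apply/L2P; near=> x; rewrite (near E1 x)// (near E2 x)// (near E3 x)//.
    by rewrite ((near E4 x _).2)// (near h x).
  near=> x; rewrite (near E1 x)// (near E2 x)// (near E3 x)//.
  by rewrite ((near E4 x _).2).
have -> : {ae (@lebesgue_measure R), forall s, cintegral (@lebesgue_measure R)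
      (fun t => (G0 (s, t) - lam * G (s, t)) * U phi t) = S psi s} <->
    op Hop (U phi) - lam *: op Kop (U phi) = S psi.
  have E1 := ind (U phi); split=> [h|<-].
    by apply/L2P; near=> s; rewrite ((near E1 s _).2)// (near h s).
  by apply: filterS E1 => s [_ <-].
have [_ _ SB SZ _] := lin_additive Sb.1.
rewrite /op /= VU -SZ -SB; split=> [->//|/eqP].
by rewrite -subr_eq0 -SB => /eqP/Sinj/eqP; rewrite subr_eq0 => /eqP.
Unshelve. all: by end_near. Qed.
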